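(* Let $I$ be the integral transform over unit circles in $\mathbb{R}^2$. Suppose $f\in\mathcal{E}'(\mathbb{R}^2)$ and $If\in C^\infty(\mathcal{M})$. Then $f$ is smooth.
   Context: The family of curves consists of all unit circles in $\mathbb{R}^2$ with a fixed orientation. These circles are parameterized by their centers, so the manifold of curves $\mathcal{M}$ is identified with $\mathbb{R}^2$. The transform is $$If(x_1,x_2)=\int_0^{2\pi}f(x_1+\cos\alpha,x_2+\sin\alpha)\,d\alpha,$$ extended to compactly supported distributions $f\in\mathcal{E}'(\mathbb{R}^2)$ in the usual way (i.e. by convolution with the arc length measure of the unit circle). *)

(* Defs.v *)
From HB Require Import structures.
From mathcomp Require Import all_boot all_order all_algebra.
From mathcomp Require Import complex.
From mathcomp Require Import all_classical all_reals all_analysis.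

Set Implicit Arguments.
Unset Strict Implicit.
Unset Printing Implicit Defensive.

Import Order.TTheory GRing.Theory Num.Theory.
Import numFieldNormedType.Exports.

Local Open Scope classical_set_scope.
Local Open Scope ring_scope.
Local Open Scope complex_scope.

Section SmoothFunctions.
Context {R : realType}.

Definition re_part (u : R * R -> R[i]) : R * R -> R := fun x => complex.Re (u x).
Definition im_part (u : R * R -> R[i]) : R * R -> R := fun x => complex.Im (u x).

Definition axis (j : bool) : R * R := if j then (0, 1) else (1, 0).

(* Iterated partial derivatives are indexed by words in the two coordinate
   directions rather than by multi-indices; for smooth functions the order of
   the letters is irrelevant. *)
Definition partials (s : seq bool) (u : R * R -> R) : R * R -> R :=
  foldr (fun j v => 'D_(axis j) v) u s.

Definition smooth_real (u : R * R -> R) : Prop :=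
  forall s : seq bool, continuous (partials s u) /\
    forall (j : bool) (x : R * R), derivable (partials s u) x (axis j).

Definition smooth (u : R * R -> R[i]) : Prop :=
  smooth_real (re_part u) /\ smooth_real (im_part u).

Definition cpartials (s : seq bool) (u : R * R -> R[i]) : R * R -> R[i] :=
  fun x => partials s (re_part u) x +i* partials s (im_part u) x.

Definition test_function (phi : R * R -> R[i]) : Prop :=
  smooth phi /\
  exists K : set (R * R), compact K /\ forall x, ~ K x -> phi x = 0.

End SmoothFunctions.

Section Distributions.
Context {R : realType}.

(* Distributions are represented by functionals on all functions R^2 -> C;
   their values outside the smooth functions are irrelevant. *)
Definition functional : Type := (R * R -> R[i]) -> R[i].

(* E'(R^2): the continuous C-linear forms on C^oo(R^2).  A number M bounding
   all the listed derivatives on K plays the role of the seminorm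
   sup_{|s| <= N, x in K} |d^s phi(x)|. *)
Definition compactly_supported_distribution (f : functional) : Prop :=
  (forall (a : R[i]) (phi psi : R * R -> R[i]), smooth phi -> smooth psi ->
     f (fun x => a * phi x + psi x) = a * f phi + f psi) /\
  exists (K : set (R * R)) (N : nat) (C : R), compact K /\
    forall (phi : R * R -> R[i]) (M : R), smooth phi ->
      (forall (s : seq bool) (x : R * R), (size s <= N)%N -> K x ->
         Normc.normc (cpartials s phi x) <= M) ->
      Normc.normc (f phi) <= C * M.

Definition plane_integral (u : R * R -> R[i]) : R[i] :=
  (\int[(lebesgue_measure \x lebesgue_measure)%E]_x re_part u x) +i*
  (\int[(lebesgue_measure \x lebesgue_measure)%E]_x im_part u x).

(* The distribution T is (given by integration against) a smooth function. *)
Definition smooth_distribution (T : functional) : Prop :=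
  exists g : R * R -> R[i], smooth g /\
    forall phi : R * R -> R[i], test_function phi ->
      T phi = plane_integral (fun x => g x * phi x).

(* The transpose of  u |-> int_0^{2 pi} u(x + (cos a, sin a)) da: substituting
   y = x + (cos a, sin a) in the pairing with phi leaves
   int u(y) (int_0^{2 pi} phi(y - (cos a, sin a)) da) dy. *)
Definition circle_transpose (phi : R * R -> R[i]) : R * R -> R[i] :=
  fun y =>
  (\int[lebesgue_measure]_(a in `[0, 2 * pi])
      re_part phi (y.1 - cos a, y.2 - sin a)) +i*
  (\int[lebesgue_measure]_(a in `[0, 2 * pi])
      im_part phi (y.1 - cos a, y.2 - sin a)).

(* I f, the convolution of f with the arc length measure of the unit circle
   (which is symmetric under x |-> - x). *)
Definition circle_transform (f : functional) : functional :=
  fun phi => f (circle_transpose phi).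

End Distributions.
Arguments functional : clear implicits.

(* Main.v *)
Require Import Defs.
From HB Require Import structures.
From mathcomp Require Import all_boot all_order all_algebra.
From mathcomp Require Import complex.
From mathcomp Require Import all_classical all_reals all_analysis.
From mathcomp Require Import measurable_realfun.
From mathcomp Require Import ring lra.

(** Let mu be the arc length measure of the unit circle. The transform I is
    convolution with mu, so the theorem follows once mu has, on every ball, a
    fundamental solution of finite order: for each ball there are a continuous
    k and an integer N with mu * Lap^N k = 8 pi^2 delta on that ball
    [circle_fundamental_solution]. Let chi be a cutoff equal to 1 near the
    support of f. For a test function phi, the function psi = chi' (k~ * Lap^N
    (chi phi)), where k~(w) = k(- w) and chi' is a second cutoff, has circle
    averages equal to 8 pi^2 phi near the support of f [local_inverse], so 8
    pi^2 f(phi) = <I f, psi>. If I f is a smooth function g, the operator phi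
    |-> psi is moved onto g by adjointness [lap_adjoint, conv_adjoint], and f
    is the function (8 pi^2)^-1 chi Lap^N (k * (chi' g)). It is smooth
    although k is only continuous, because all derivatives fall on g.

    The kernel k is an average of plane waves, rad e (x) = int e(x . w) dw
    over the unit directions w. Averaging over unit circles, and the
    Laplacian, both act on the profile alone: the circle average of rad e is
    rad of s |-> int_0^{2 pi} e(s + cos a) da [circle_rad], and the Laplacian
    of rad L is rad L'' [rad_lap_parts]. For the profile s^2 ln |s|, rad is
    (pi / 2) |x|^2 ln (|x|^2) plus a multiple of |x|^2 [rad_halfxlnx], a
    fundamental solution of the bilaplacian up to a factor [biharmonic,
    rad_biharmonic]. Hence it is enough to solve int_0^{2 pi} e(s + cos a) da
    = L(s) on a bounded interval, where L is an iterated primitive, of high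
    even order, of s^2 ln |s|.

    Write L as h(s) + h(- s), where h vanishes on the negative half line, and
    shift the variable so that the average has delays 1 + cos a in [0, 2]. The
    averaging operator V then preserves functions that vanish for s <= 0. Near
    the delay 0 it behaves like a multiple of the half-integral A f (s) =
    int_0^b f(s - x^2) dx, because 1 - cos a is of the order of a^2.
    Precisely, with J the primitive vanishing at 0, V = 2 sqrt 2 A + Z J + D,
    where Z is a small operator and D only has delays bounded below by a
    positive number [circ_decomp]; moreover A A = (pi / 4) J [sqavg_sqavg]. So
    V A = (c + A Z) J + A D with c > 0, where c + A Z is invertible by a
    Neumann series [neumann]. This solves V e = J r up to a remainder that
    starts later than r by a fixed delay. After n such steps V e = J^n h up to
    a remainder that starts beyond the bounded interval [prim_iter_solve].
    This is why one loses a number of derivatives growing with the size of the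
    ball, and why that loss is harmless for a distribution of compact support.
    *)

Set Implicit Arguments.
Unset Strict Implicit.
Unset Printing Implicit Defensive.

Import Order.TTheory GRing.Theory Num.Theory.
Import numFieldNormedType.Exports.

Local Open Scope classical_set_scope.
Local Open Scope ring_scope.

(** * Continuity, derivatives and oriented integrals on the line *)
Section Continuity.
Context {R : realType} {T : topologicalType}.
Implicit Types f g : T -> R.

Lemma contD f g : continuous f -> continuous g -> continuous (fun x => f x + g x).
Proof. by move=> cf cg x; apply: cvgD; [exact: cf|exact: cg]. Qed.
Lemma contB f g : continuous f -> continuous g -> continuous (fun x => f x - g x).
Proof. by move=> cf cg x; apply: cvgB; [exact: cf|exact: cg]. Qed.
Lemma contN f : continuous f -> continuous (fun x => - f x).
Proof. by move=> cf x; apply: cvgN; exact: cf. Qed.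
Lemma contM f g : continuous f -> continuous g -> continuous (fun x => f x * g x).
Proof. by move=> cf cg x; apply: cvgM; [exact: cf|exact: cg]. Qed.
Lemma contX n f : continuous f -> continuous (fun x => f x ^+ n).
Proof.
move=> cf; elim: n => [|n IH]; first exact: cst_continuous.
by under eq_fun do rewrite exprS; exact: contM.
Qed.
Lemma contV f : (forall x, f x != 0) -> continuous f -> continuous (fun x => (f x)^-1).
Proof. by move=> f0 cf x; apply: cvgV; [exact: f0|exact: cf]. Qed.
Lemma cont_comp (U : topologicalType) (h : U -> R) (f : T -> U) : continuous h -> continuous f ->
  continuous (fun x => h (f x)).
Proof. by move=> ch cf x; apply: (@continuous_comp _ _ _ f h); [exact: cf|exact: ch]. Qed.
Lemma cont_pair (U V : topologicalType) (f : T -> U) (g : T -> V) : continuous f -> continuous g -> continuous (fun x => (f x, g x)).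
Proof. by move=> cf cg x; exact: (cvg_pair (cf x) (cg x)). Qed.
Lemma cont_comp2 (U V : topologicalType) (u : U -> V -> R) (f : T -> U) (g : T -> V) :
  continuous (fun p : U * V => u p.1 p.2) -> continuous f -> continuous g ->
  continuous (fun x => u (f x) (g x)).
Proof.
move=> cu cf cg x.
by apply: (@continuous_comp _ _ _ (fun x => (f x, g x)) (fun p : U * V => u p.1 p.2));
  [exact: (cvg_pair (cf x) (cg x))|exact: cu].
Qed.
Lemma cont_compp (u : R * R -> R) f g :
  continuous u -> continuous f -> continuous g ->
  continuous (fun x => u (f x, g x)).
Proof.
move=> cu cf cg x.
by apply: (@continuous_comp _ _ _ (fun x => (f x, g x)) u);
  [exact: cont_pair|exact: cu].
Qed.
End Continuity.

Lemma cont_fst (T U V : topologicalType) (f : T -> U * V) :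
  continuous f -> continuous (fun x => (f x).1).
Proof.
move=> cf x; apply: (@cvg_comp _ _ _ f fst _ (nbhs (f x))); first exact: cf.
exact: cvg_fst.
Qed.
Lemma cont_snd (T U V : topologicalType) (f : T -> U * V) :
  continuous f -> continuous (fun x => (f x).2).
Proof.
move=> cf x; apply: (@cvg_comp _ _ _ f snd _ (nbhs (f x))); first exact: cf.
exact: cvg_snd.
Qed.

Section Derivation.
Context {R : realType}.
Implicit Types (f g : R -> R) (x : R).

(** A total way to speak of derivatives of real functions: the value is an
    argument, so that derivatives are computed by unification and compared
    afterwards with [der_eq]. *)
Definition hasD f x (d : R) : Prop := is_derive x 1 f d.

Lemma der_eq f x a b : hasD f x a -> a = b -> hasD f x b.
Proof. by move=> h <-. Qed.
Lemma derD f g x a b : hasD f x a -> hasD g x b ->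
  hasD (fun t => f t + g t) x (a + b).
Proof. exact: is_deriveD. Qed.
Lemma derB f g x a b : hasD f x a -> hasD g x b ->
  hasD (fun t => f t - g t) x (a - b).
Proof. exact: is_deriveB. Qed.
Lemma derN f x a : hasD f x a -> hasD (fun t => - f t) x (- a).
Proof. exact: is_deriveN. Qed.
Lemma derM f g x a b : hasD f x a -> hasD g x b ->
  hasD (fun t => f t * g t) x (a * g x + f x * b).
Proof.
move=> fa gb; apply: der_eq (is_deriveM fa gb) _.
by rewrite /GRing.scale/= addrC [a * _]mulrC.
Qed.
Lemma derC (c x : R) : hasD (fun=> c) x 0.
Proof. exact: is_derive_cst. Qed.
Lemma derId x : hasD (fun t => t) x 1.
Proof. exact: is_derive_id. Qed.
Lemma derX f n x a : hasD f x a ->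
  hasD (fun t => f t ^+ n.+1) x (n.+1%:R * f x ^+ n * a).
Proof.
move=> fa; elim: n => [|n IH]; first by rewrite expr0 !mul1r.
under eq_fun do rewrite exprS.
apply: der_eq; first exact: (derM fa IH).
by rewrite -[n.+2%:R]natr1 exprS; ring.
Qed.
Lemma derV f x a : f x != 0 -> hasD f x a ->
  hasD (fun t => (f t)^-1) x (- a / f x ^+ 2).
Proof.
move=> fx0 fa; apply: der_eq (@is_deriveV _ f x a 1 fx0 fa) _.
by rewrite /GRing.scale/=; ring.
Qed.
Lemma derComp f g x a b : hasD f (g x) a -> hasD g x b ->
  hasD (fun t => f (g t)) x (a * b).
Proof. exact: is_derive1_comp. Qed.
Lemma der_cont f : (forall x, exists a, hasD f x a) -> continuous f.
Proof.
move=> df x; have [a [da _]] := df x.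
by apply/differentiable_continuous/derivable1_diffP.
Qed.
Lemma der_near f g x a : (\forall y \near x, f y = g y) -> hasD f x a -> hasD g x a.
Proof. exact: near_eq_is_derive. Qed.
Lemma der_cst f (x y : R) : (forall x, hasD f x 0) -> f x = f y.
Proof. exact: is_derive_0_is_cst. Qed.
Lemma der_ln x : 0 < x -> hasD (@ln R) x x^-1.
Proof. exact: is_derive1_ln. Qed.
End Derivation.

Ltac der_step :=
  match goal with
  | H : hasD ?f ?x _ |- hasD ?f ?x _ => exact: H
  | H : forall x, hasD ?f x _ |- hasD ?f _ _ => exact: H
  | |- hasD (fun _ => ?c) _ _ => exact: derC
  | |- hasD (fun t => t) _ _ => exact: derId
  | |- hasD (fun t => _ + _) _ _ => first [apply: derD | apply: derB]
  | |- hasD (fun t => - _) _ _ => apply: derN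
  | |- hasD (fun t => _ * _) _ _ => apply: derM
  | |- hasD (fun t => _ ^+ _.+1) _ _ => apply: derX
  | |- hasD (@sin _) _ _ => exact: is_derive_sin
  | |- hasD (@cos _) _ _ => exact: is_derive_cos
  | |- hasD (@atan _) _ _ => exact: is_derive1_atan
  | |- hasD (fun t => sin (@?g t)) _ _ =>
      apply: (derComp (f := @sin _) (g := g)); [exact: is_derive_sin|]
  | |- hasD (fun t => cos (@?g t)) _ _ =>
      apply: (derComp (f := @cos _) (g := g)); [exact: is_derive_cos|]
  | |- hasD (fun t => atan (@?g t)) _ _ =>
      apply: (derComp (f := @atan _) (g := g)); [exact: is_derive1_atan|]
  | H : forall x, hasD ?f x _ |- hasD (fun t => ?f (@?g t)) _ _ =>
      apply: (derComp (f := f) (g := g)); [exact: H|]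
  | |- hasD (GRing.mul ?c) _ _ => apply: (derM (f := fun=> c) (g := fun t => t))
  | |- hasD (GRing.add ?c) _ _ => apply: (derD (f := fun=> c) (g := fun t => t))
  end; cbv beta.
Ltac der := cbv beta; repeat der_step.

Ltac cont_base :=
  match goal with
  | |- continuous (fun _ => ?c) => exact: cst_continuous
  | H : continuous ?f |- continuous ?f => exact H
  | H : continuous ?f |- continuous (fun x => ?f x) => exact H
  | |- continuous (fun x => x) => by move=> ?; exact: cvg_id
  | |- continuous (fun x => _ + _) => first [apply: contD | apply: contB]
  | |- continuous (fun x => - _) => apply: contN
  | |- continuous (fun x => _ * _) => apply: contM
  | |- continuous (fun x => _ ^+ _) => apply: contX
  | |- continuous (fun x => sin (@?g x)) => apply: (cont_comp (h := @sin _) (f := g) (@continuous_sin _))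
  | |- continuous (fun x => cos (@?g x)) => apply: (cont_comp (h := @cos _) (f := g) (@continuous_cos _))
  | |- continuous (fun x => (_, _)) => apply: cont_pair
  | H : continuous (fun p => ?u p.1 p.2) |- continuous (fun x => ?u (@?g x) (@?h x)) =>
      apply: (cont_comp2 (u := u) (f := g) (g := h) H)
  | H : continuous ?u |- continuous (fun x => ?u (@?g x, @?h x)) =>
      apply: (cont_compp (u := u) (f := g) (g := h) H)
  | H : continuous ?f |- continuous (fun x => ?f (@?g x)) =>
      apply: (cont_comp (h := f) (f := g) H)
  | |- continuous (fun x => (@?f x).1) => apply: (cont_fst (f := f))
  | |- continuous (fun x => (@?f x).2) => apply: (cont_snd (f := f))
  | |- continuous (fun x => _^-1) => apply: contV
  | |- continuous ?f =>
      lazymatch f with (fun _ => _) => fail | _ => change (continuous (fun z => f z)) end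
  end; cbv beta.
Ltac cont_step := cont_base.
Ltac cont := cbv beta; repeat cont_step.

Section Primitive.
Context {R : realType}.
Implicit Types (f g F : R -> R) (a b c x : R).
Local Notation mu := (@lebesgue_measure R).

(** Together with its projection [prim], a primitive that conversion cannot
    unfold: comparing two of them never leads the unifier into the definition of
    the Lebesgue integral. The integrals below are hidden in the same way. *)
Fact prim_spec : {F : (R -> R) -> R -> R | forall f x, F f x =
  if 0 <= x then \int[mu]_(t in `[0, x]) f t else - \int[mu]_(t in `[x, 0]) f t}.
Proof. by eexists. Qed.
Definition prim := sval prim_spec.
Lemma prim_Rintegral f x : prim f x =
  if 0 <= x then \int[mu]_(t in `[0, x]) f t else - \int[mu]_(t in `[x, 0]) f t.
Proof. exact: (svalP prim_spec). Qed.

Lemma cont_integrable f a b : continuous f -> mu.-integrable `[a, b] (EFin \o f).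
Proof.
move=> cf; apply: continuous_compact_integrable; first exact: segment_compact.
exact: continuous_subspaceT.
Qed.

Lemma prim_int f a x : continuous f -> a <= 0 -> a <= x ->
  prim f x = \int[mu]_(t in `[a, x]) f t - \int[mu]_(t in `[a, 0]) f t.
Proof.
move=> cf a0 ax; rewrite prim_Rintegral; case: leP => x0.
  have := @Rintegral_itvB R f (BLeft a) (BRight x) 0 (cont_integrable a x cf).
  rewrite !bnd_simp => /(_ a0 x0) ->.
  by rewrite Rintegral_itv_obnd_cbnd//; apply: (integrableS _ _ _ (cont_integrable 0 x cf))=> //;
    apply: subset_itvr; rewrite bnd_simp.
have := @Rintegral_itvB R f (BLeft a) (BRight 0) x (cont_integrable a 0 cf).
rewrite !bnd_simp => /(_ ax (ltW x0)).
rewrite Rintegral_itv_obnd_cbnd; last by apply: (integrableS _ _ _ (cont_integrable x 0 cf))=> //;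
    apply: subset_itvr; rewrite bnd_simp.
by move=> <-; ring.
Qed.

(** To the right of a, the integral from a has derivative f; [prim_int] moves the
    base point from 0 to some a on the left of x, at the cost of a constant. *)
Lemma prim_derive f x : continuous f -> hasD (prim f) x (f x).
Proof.
move=> cf; pose a := Num.min 0 x - 1; pose G y := \int[mu]_(t in `[a, y]) f t.
have ax : a < x by rewrite /a; case: (leP 0 x) => ?; lra.
have a0 : a <= 0 by rewrite /a; case: (leP 0 x) => ?; lra.
have [dG G'] : derivable G x 1 /\ (G^`())%classic x = f x.
  apply: (@continuous_FTC1_closed _ f a x (x + 1)) => //; first by lra.
    exact: cont_integrable.
  exact: cf.
have HG : hasD G x (f x) by rewrite -G' derive1E; exact: DeriveDef.
apply: (@der_near _ (fun y => G y - G 0)).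
  near=> y; rewrite (prim_int cf a0)//.
  by apply/ltW; rewrite -ltrN2; near: y; apply: Nlt_nbhsl; rewrite ltrN2.
by rewrite -[f x]subr0; exact: (derB HG (derC _ _)).
Unshelve. all: by end_near. Qed.

(** The oriented integral, for which endpoints need no order: most rules for it on
    continuous functions follow from [oint_FTC] by differentiation. *)
Fact oint_spec : {J : R -> R -> (R -> R) -> R |
  forall a b f, J a b f = prim f b - prim f a}.
Proof. by exists (fun a b f => prim f b - prim f a). Qed.
Definition oint := sval oint_spec.
Lemma ointE a b f : oint a b f = prim f b - prim f a.
Proof. exact: (svalP oint_spec). Qed.

Lemma oint_FTC f F a b : continuous f -> (forall x, hasD F x (f x)) ->
  oint a b f = F b - F a.
Proof.
move=> cf dF; have : prim f b - F b = prim f a - F a.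
  apply: (@der_cst _ (fun x => prim f x - F x)) => x.
  by rewrite -(subrr (f x)); apply: derB => //; exact: prim_derive.
by rewrite !ointE; lra.
Qed.

Lemma oint_Rintegral f a b : continuous f -> a <= b ->
  \int[mu]_(t in `[a, b]) f t = oint a b f.
Proof.
move=> cf ab; pose c := Num.min 0 a.
have ca : c <= a by rewrite ge_min lexx orbT.
have c0 : c <= 0 by rewrite ge_min lexx.
rewrite !ointE !(prim_int cf c0)// ?(le_trans ca)//.
have := @Rintegral_itvB R f (BLeft c) (BRight b) a (cont_integrable c b cf).
rewrite !bnd_simp => /(_ ca ab).
rewrite Rintegral_itv_obnd_cbnd; last by apply: (integrableS _ _ _ (cont_integrable a b cf))=> //;
    apply: subset_itvr; rewrite bnd_simp.
by move=> <-; ring.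
Qed.

Lemma oint_MVT f a b : continuous f -> a <= b ->
  exists2 c, c \in `[a, b] & oint a b f = f c * (b - a).
Proof.
move=> cf ab; rewrite ointE; apply: (@MVT_segment _ (prim f) f a b ab).
  by move=> x _; exact: prim_derive.
apply: continuous_subspaceT; apply: der_cont => x; exists (f x); exact: prim_derive.
Qed.
Lemma prim_cont f : continuous f -> continuous (prim f).
Proof. by move=> cf; apply: der_cont => x; exists (f x); exact: prim_derive. Qed.

Lemma prim0 f : prim f 0 = 0.
Proof. by rewrite prim_Rintegral lexx set_itv1 Rintegral_set1. Qed.

Lemma eq_oint f g a b : f =1 g -> oint a b f = oint a b g.
Proof. by move=> /funext ->. Qed.

Lemma oint_swap a b f : oint a b f = - oint b a f. Proof. by rewrite !ointE opprB. Qed.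
Lemma ointaa a f : oint a a f = 0. Proof. by rewrite !ointE subrr. Qed.
Lemma oint_cat c a b f : oint a b f = oint a c f + oint c b f.
Proof. by rewrite !ointE; ring. Qed.

Lemma oint_bound f a b M : continuous f -> a <= b ->
  (forall t, a <= t <= b -> `|f t| <= M) -> `|oint a b f| <= M * (b - a).
Proof.
move=> cf ab fM; have [c cab ->] := oint_MVT cf ab.
rewrite normrM [X in _ * X]ger0_norm ?subr_ge0//; apply: ler_wpM2r; first by rewrite subr_ge0.
by apply: fM; move: cab; rewrite in_itv.
Qed.

Lemma ointD f g a b : continuous f -> continuous g ->
  oint a b (fun t => f t + g t) = oint a b f + oint a b g.
Proof.
move=> cf cg; rewrite (@oint_FTC _ (fun t => prim f t + prim g t)); first by rewrite !ointE; ring.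
  by cont.
by move=> x; apply: derD; exact: prim_derive.
Qed.
Lemma ointZ f c a b : continuous f -> oint a b (fun t => c * f t) = c * oint a b f.
Proof.
move=> cf; rewrite (@oint_FTC _ (fun t => c * prim f t)); first by rewrite !ointE; ring.
  by cont.
move=> x; apply: der_eq; first by apply: derM; [exact: derC|exact: prim_derive].
by rewrite mul0r add0r.
Qed.
Lemma ointZr f c a b : continuous f -> oint a b (fun t => f t * c) = oint a b f * c.
Proof. by move=> cf; under eq_fun do rewrite mulrC; rewrite ointZ// mulrC. Qed.
Lemma ointN f a b : continuous f -> oint a b (fun t => - f t) = - oint a b f.
Proof. by move=> cf; under eq_fun do rewrite -mulN1r; rewrite ointZ// mulN1r. Qed.
Lemma ointB f g a b : continuous f -> continuous g ->
  oint a b (fun t => f t - g t) = oint a b f - oint a b g.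
Proof. by move=> cf cg; rewrite ointD ?ointN//; cont. Qed.
Lemma oint_cst c a b : oint a b (fun=> c) = c * (b - a).
Proof.
rewrite (@oint_FTC _ (fun t => c * t)); [by ring|by cont|].
move=> x; apply: der_eq; first by apply: derM; [exact: derC|exact: derId].
by rewrite mul0r add0r mulr1.
Qed.
Lemma oint0 a b : oint a b (fun=> 0) = 0.
Proof. by rewrite oint_cst mul0r. Qed.

Lemma oint_ext f g a b : continuous f -> continuous g -> a <= b ->
  (forall t, a <= t <= b -> f t = g t) -> oint a b f = oint a b g.
Proof.
move=> cf cg ab fg; apply/eqP; rewrite -subr_eq0 -ointB// -normr_le0.
apply: (le_trans (@oint_bound _ _ _ 0 _ ab _)); first by cont.
  by move=> t /fg ->; rewrite subrr normr0.
by rewrite mul0r.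
Qed.

Lemma oint_ge0 f a b : continuous f -> a <= b ->
  (forall t, a <= t <= b -> 0 <= f t) -> 0 <= oint a b f.
Proof.
move=> cf ab f0; have [c cab ->] := oint_MVT cf ab.
by rewrite mulr_ge0 ?subr_ge0// f0//; move: cab; rewrite in_itv.
Qed.

Lemma oint_le f g a b : continuous f -> continuous g -> a <= b ->
  (forall t, a <= t <= b -> f t <= g t) -> oint a b f <= oint a b g.
Proof.
move=> cf cg ab fg; rewrite -subr_ge0 -ointB//; apply: oint_ge0 => //; first by cont.
by move=> t /fg; rewrite subr_ge0.
Qed.

Lemma oint_subst f (G g : R -> R) a b : continuous f -> continuous g ->
  (forall x, hasD G x (g x)) ->
  oint a b (fun t => f (G t) * g t) = oint (G a) (G b) f.
Proof.
move=> cf cg dG; have cG : continuous G by apply: der_cont => x; exists (g x).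
rewrite (@oint_FTC _ (fun t => prim f (G t))); [by rewrite ointE|by cont|].
by move=> x; apply: (derComp (f := prim f)) => //; exact: prim_derive.
Qed.

Lemma oint_shift f c a b : continuous f ->
  oint a b (fun t => f (t + c)) = oint (a + c) (b + c) f.
Proof.
move=> cf; rewrite -(@oint_subst f (fun t => t + c) (fun=> 1)); [|by []|by cont|].
  by under [in RHS]eq_fun do rewrite mulr1.
move=> x; apply: der_eq; first by apply: derD; [exact: derId|exact: derC].
by rewrite addr0.
Qed.
Lemma oint_scale f c a b : continuous f ->
  c * oint a b (fun t => f (c * t)) = oint (c * a) (c * b) f.
Proof.
move=> cf; rewrite -(@oint_subst f (fun t => c * t) (fun=> c)); [|by []|by cont|].
  by rewrite ointZr 1?mulrC//; cont.
move=> x; apply: der_eq; first by apply: derM; [exact: derC|exact: derId].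
by rewrite mul0r add0r mulr1.
Qed.
Lemma oint_opp f a b : continuous f -> oint a b (fun t => f (- t)) = oint (- b) (- a) f.
Proof.
move=> cf; have := @oint_scale f (-1) a b cf; rewrite !mulN1r [RHS]oint_swap.
by move=> /oppr_inj <-; congr oint; apply/funext => t; rewrite mulN1r.
Qed.

Lemma oint_parts (F f G g : R -> R) a b : continuous f -> continuous g ->
  (forall x, hasD F x (f x)) -> (forall x, hasD G x (g x)) ->
  oint a b (fun t => F t * g t) = F b * G b - F a * G a - oint a b (fun t => f t * G t).
Proof.
move=> cf cg dF dG.
have cF : continuous F by apply: der_cont => x; exists (f x).
have cG : continuous G by apply: der_cont => x; exists (g x).
have : oint a b (fun t => f t * G t + F t * g t) = F b * G b - F a * G a.
  apply: (@oint_FTC _ (fun t => F t * G t)); first by cont.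
  by move=> x; exact: derM.
by rewrite ointD; [lra|cont|cont].
Qed.
End Primitive.

(** * Integrals depending on a parameter *)
Section ParamIntegral.
Context {R : realType}.

(** On the compact interval of integration the continuity of u in the parameter is
    uniform. *)
Lemma cont_oint_fixed (T : topologicalType) (u : T -> R -> R) (a b : R) :
  continuous (fun p : T * R => u p.1 p.2) -> continuous (fun x => oint a b (u x)).
Proof.
move=> cu; have cux x : continuous (u x) by cont.
wlog ab : a b / a <= b.
  move=> H; case: (leP a b) => [/H//|/ltW ba].
  by under eq_fun do rewrite oint_swap; apply: contN; exact: H.
move=> x; apply/cvgrPdist_le => e e0.
pose d := e / (b - a + 1).
have d0 : 0 < d by rewrite divr_gt0//; lra.
have K : \forall y \near x, `[a, b] `<=` (fun t => `|u x t - u y t| <= d).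
  have /compact_near_coveringP := segment_compact (a := a) (b := b).
  apply => t _.
  have d20 : 0 < d / 2 by rewrite divr_gt0.
  have /cvgrPdist_le/(_ _ d20) h1 := cu (x, t).
  have /cvgrPdist_le/(_ _ d20) h2 := cux x t.
  case: h1 => -[/= P Q] [Px Qt] PQ.
  exists ((fun t' => `|u x t - u x t'| <= d / 2) `&` Q, P) => /=.
    by split => //; exact: filterI.
  move=> [t' y] /= [[h2' Qt'] Py].
  have := PQ (y, t') (conj Py Qt') => /= h1'.
  rewrite (_ : _ - _ = (u x t - u y t') - (u x t - u x t')); last by ring.
  by apply: le_trans (ler_normB _ _) _; lra.
apply: filterS K => y Ky.
have {}Ky : forall t, a <= t <= b -> `|u x t - u y t| <= d.
  by move=> t tab; apply: Ky; rewrite /= in_itv.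
rewrite -ointB//; apply: le_trans (oint_bound _ ab Ky) _; first by cont.
by rewrite /d mulrAC ler_pdivrMr ?ler_wpM2l//; lra.
Qed.

Lemma seg0 (a b : R) : a + 0 * (b - a) = a. Proof. by ring. Qed.
Lemma seg1 (a b : R) : a + 1 * (b - a) = b. Proof. by ring. Qed.

(** Moving the endpoints into the integrand turns variable endpoints into a
    parameter. *)
Lemma oint_unit (f : R -> R) a b : continuous f ->
  oint a b f = (b - a) * oint 0 1 (fun s => f (a + s * (b - a))).
Proof.
move=> cf; rewrite mulrC -ointZr; last by cont.
rewrite (@oint_subst _ f (fun s => a + s * (b - a)) (fun=> b - a)) //; last 2 first.
- by cont.
- by move=> x; apply: der_eq; [der|cbv beta; ring].
by rewrite seg0 seg1.
Qed.

Lemma cont_oint (T : topologicalType) (u : T -> R -> R) (a b : T -> R) :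
  continuous (fun p : T * R => u p.1 p.2) -> continuous a -> continuous b ->
  continuous (fun x => oint (a x) (b x) (u x)).
Proof.
move=> cu ca cb.
rewrite (_ : (fun _ => _) = fun x => (b x - a x) *
    oint 0 1 (fun s => u x (a x + s * (b x - a x)))).
  by apply: contM; [cont|apply: cont_oint_fixed; cont].
by apply/funext => x; rewrite oint_unit//; cont.
Qed.


(** By Caratheodory: the difference quotient of u in its first variable is the
    mean value int_0^1 du (x + s (z - x)) ds, which is jointly continuous, so that
    its integral over t is continuous in z. *)
Lemma der_oint (u du : R -> R -> R) a b x :
  (forall x t, hasD (fun y => u y t) x (du x t)) ->
  continuous (fun p : R * R => u p.1 p.2) ->
  continuous (fun p : R * R => du p.1 p.2) ->
  hasD (fun y => oint a b (u y)) x (oint a b (du x)).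
Proof.
move=> Hd cu cdu; apply/is_derive1_caratheodory.
exists (fun z => oint a b (fun t => oint 0 1 (fun s => du (x + s * (z - x)) t))); split.
- move=> z; rewrite -ointB; [|by cont|by cont].
  rewrite -ointZr; last by apply: cont_oint; cont.
  congr oint; apply/funext => t; rewrite -ointZr; last by cont.
  rewrite (@oint_FTC _ _ (fun s => u (x + s * (z - x)) t)).
  + by rewrite seg0 seg1.
  + by cont.
  + move=> s; apply: der_eq.
      apply: (derComp (f := fun y => u y t) (g := fun s => x + s * (z - x))); first exact: Hd.
      by der.
    by cbv beta; ring.
- apply: cont_oint; [|by cont|by cont]; apply: cont_oint; by cont.
- congr oint; apply/funext => t; under eq_fun do rewrite subrr mulr0 addr0.
  by rewrite oint_cst subr0 mulr1.
Qed.

Lemma der_oint_end (f : R -> R) a x : continuous f ->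
  hasD (fun t => oint a t f) x (f x).
Proof. by move=> cf; under eq_fun do rewrite ointE; rewrite -[f x]subr0; apply: derB; [exact: prim_derive|exact: derC]. Qed.

(** Both sides vanish for b = a and have the same derivative in b. *)
Lemma oint_Fubini (u : R -> R -> R) a b c d :
  continuous (fun p : R * R => u p.1 p.2) ->
  oint a b (fun x => oint c d (fun y => u x y)) = oint c d (fun y => oint a b (fun x => u x y)).
Proof.
move=> cu; rewrite (@oint_FTC _ _ (fun t => oint c d (fun y => oint a t (fun x => u x y)))).
- by rewrite [X in _ - X](_ : _ = 0) ?subr0//; under eq_fun do rewrite ointaa; rewrite oint0.
- by apply: cont_oint; cont.
- move=> x; apply: (@der_oint (fun t y => oint a t (fun x => u x y)) (fun t y => u t y)).
  + by move=> t y; apply: der_oint_end; cont.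
  + by apply: cont_oint; cont.
  + by cont.
Qed.

(** The chain rule for a function with continuous partial derivatives, again by
    writing the two increments as mean values of the partial derivatives. *)
Lemma der_chain (u ux uy : R -> R -> R) (f g : R -> R) x a b :
  (forall x t, hasD (fun y => u y t) x (ux x t)) ->
  (forall x t, hasD (fun y => u x y) t (uy x t)) ->
  continuous (fun p : R * R => ux p.1 p.2) ->
  continuous (fun p : R * R => uy p.1 p.2) ->
  continuous f -> continuous g ->
  hasD f x a -> hasD g x b ->
  hasD (fun t => u (f t) (g t)) x (ux (f x) (g x) * a + uy (f x) (g x) * b).
Proof.
move=> Hx Hy cx cy cf cg /is_derive1_caratheodory[f' [ff' cf' f'a]]
  /is_derive1_caratheodory[g' [gg' cg' g'b]].
apply/is_derive1_caratheodory.
exists (fun z => oint 0 1 (fun s => ux (f x + s * (f z - f x)) (g z)) * f' z +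
                 oint 0 1 (fun s => uy (f x) (g x + s * (g z - g x))) * g' z); split.
- move=> z.
  have Ex : u (f z) (g z) - u (f x) (g z) =
      oint 0 1 (fun s => ux (f x + s * (f z - f x)) (g z)) * (f z - f x).
    rewrite -ointZr; last by cont.
    rewrite (@oint_FTC _ _ (fun s => u (f x + s * (f z - f x)) (g z))).
    + by rewrite seg0 seg1.
    + by cont.
    + move=> s; apply: der_eq.
        apply: (derComp (f := fun y => u y (g z)) (g := fun s => f x + s * (f z - f x))).
          exact: Hx.
        by der.
      by cbv beta; ring.
  have Ey : u (f x) (g z) - u (f x) (g x) =
      oint 0 1 (fun s => uy (f x) (g x + s * (g z - g x))) * (g z - g x).
    rewrite -ointZr; last by cont.
    rewrite (@oint_FTC _ _ (fun s => u (f x) (g x + s * (g z - g x)))).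
    + by rewrite seg0 seg1.
    + by cont.
    + move=> s; apply: der_eq.
        apply: (derComp (f := fun y => u (f x) y) (g := fun s => g x + s * (g z - g x))).
          exact: Hy.
        by der.
      by cbv beta; ring.
  by rewrite mulrDl -!mulrA -ff' -gg' -Ex -Ey addrA subrK.
- apply: cvgD; apply: cvgM => //.
  + by apply: (@cont_oint _ (fun z s => ux (f x + s * (f z - f x)) (g z))); cont.
  + by apply: (@cont_oint _ (fun z s => uy (f x) (g x + s * (g z - g x)))); cont.
- rewrite f'a g'b !subrr; congr (_ * _ + _ * _).
  + by under eq_fun do rewrite mulr0 addr0; rewrite oint_cst subr0 mulr1.
  + by under eq_fun do rewrite mulr0 addr0; rewrite oint_cst subr0 mulr1.
Qed.

Lemma primE (f : R -> R) s : prim f s = oint 0 s f.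
Proof. by rewrite ointE prim0 subr0. Qed.

Lemma eq_prim (f g : R -> R) T s : continuous f -> continuous g -> 0 <= T -> s <= T ->
  (forall t, t <= T -> f t = g t) -> prim f s = prim g s.
Proof.
move=> cf cg T0 sT fg; rewrite !primE; case: (leP 0 s) => s0.
  by apply: oint_ext => // t /andP[_ ts]; apply: fg; lra.
rewrite oint_swap [RHS]oint_swap; congr (- _); apply: oint_ext => //; first exact: ltW.
by move=> t /andP[_ ts]; apply: fg; lra.
Qed.

(** The square is cut along its diagonal, and in each triangle the smaller
    coordinate is written as u times the larger one, with u in [0, 1]. Both sides
    vanish for B = 0 and have the same derivative in B, so no change of variables
    in the plane is needed. *)
Lemma oint_Duffy (h : R -> R -> R) B : continuous (fun p : R * R => h p.1 p.2) ->
  oint 0 B (fun x => oint 0 B (h x)) =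
  oint 0 B (fun x => x * oint 0 1 (fun u => h x (x * u)) + x * oint 0 1 (fun u => h (x * u) x)).
Proof.
move=> ch.
have key x : hasD (fun B => oint 0 B (fun x => oint 0 B (h x))) x
   (oint 0 x (h x) * 1 + oint 0 x (fun y => h y x) * 1).
  apply: (@der_chain (fun a b => oint 0 a (fun x => oint 0 b (h x))) (fun a b => oint 0 b (h a))
    (fun a b => oint 0 a (fun x => h x b)) (fun t => t) (fun t => t)).
  + by move=> a b; apply: der_oint_end; apply: cont_oint; cont.
  + move=> a b; apply: (@der_oint (fun t y => oint 0 t (h y)) (fun t y => h y t)).
    * by move=> t y; apply: der_oint_end; cont.
    * by apply: cont_oint; cont.
    * by cont.
  + by apply: cont_oint; cont.
  + by apply: cont_oint; cont.
  + by cont.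
  + by cont.
  + exact: derId.
  + exact: derId.
apply/esym; rewrite (@oint_FTC _ _ (fun B => oint 0 B (fun x => oint 0 B (h x)))).
- by rewrite [X in _ - X]ointaa subr0.
- by apply: contD; apply: contM; do ?[by cont]; apply: cont_oint; cont.
move=> x; apply: der_eq (key x) _.
rewrite !mulr1 !(oint_unit 0 x) ?subr0; [|by cont|by cont].
congr (_ * oint 0 1 _ + _ * oint 0 1 _); apply/funext => t; by rewrite add0r mulrC.
Qed.
End ParamIntegral.

Ltac cont_integral :=
  lazymatch goal with
  | |- continuous (fun _ => ?c) => fail
  | |- continuous (fun x => oint (@?a x) (@?b x) (fun t => @?u x t)) =>
      apply: (cont_oint (u := u) (a := a) (b := b))
  end; cbv beta.
Ltac cont_step ::= first [cont_integral | cont_base].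

(** * Causal averages, the half-integral and a Neumann series *)
Section Averages.
Context {R : realType}.
Implicit Types (f g p q : R -> R) (a b r s : R).

(** Causal functions: the delayed averages below keep them causal, and can only
    increase r. *)
Definition vanishing r f := continuous f /\ forall s, s <= r -> f s = 0.

(** Averages of f with delays p and weights q. All the convolution operators on
    the line used here have this form, so that they commute with each other and
    with the primitive. *)
Definition avg a b p q f s : R := oint a b (fun t => q t * f (s - p t)).

Lemma avg_cont a b p q f : continuous p -> continuous q -> continuous f ->
  continuous (avg a b p q f).
Proof. by move=> cp cq cf; apply: cont_oint; cont. Qed.

Lemma avg_vanishing a b p q f r d : continuous p -> continuous q -> a <= b ->
  (forall t, a <= t <= b -> d <= p t) -> vanishing r f ->
  vanishing (r + d) (avg a b p q f).
Proof.
move=> cp cq ab dp [cf f0]; split; first exact: avg_cont.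
move=> s sr; rewrite /avg -[RHS](oint0 a b).
apply: oint_ext => //; [by cont|by cont|move=> t /dp dpt].
by rewrite f0 ?mulr0//; lra.
Qed.

Lemma avg_comm a b p q a' b' p' q' f :
  continuous p -> continuous q -> continuous p' -> continuous q' -> continuous f ->
  avg a b p q (avg a' b' p' q' f) =1 avg a' b' p' q' (avg a b p q f).
Proof.
move=> cp cq cp' cq' cf s; rewrite /avg.
transitivity (oint a b (fun t => oint a' b' (fun x => q t * (q' x * f (s - p t - p' x))))).
  by congr oint; apply/funext => t; rewrite ointZ//; cont.
rewrite oint_Fubini; last by cont.
congr oint; apply/funext => t; rewrite -ointZ; last by cont.
by congr oint; apply/funext => x; rewrite mulrCA addrAC.
Qed.

Lemma prim_vanishing r f : 0 <= r -> vanishing r f -> vanishing r (prim f).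
Proof.
move=> r0 [cf f0]; split; first exact: prim_cont.
move=> s sr; rewrite primE.
rewrite -[RHS](oint0 0 s); case: (leP 0 s) => s0.
  by apply: oint_ext => //; [cont|move=> t ts; rewrite f0//; lra].
rewrite oint_swap [RHS]oint_swap; congr (- _).
by apply: oint_ext => //; [cont|exact: ltW|move=> t ts; rewrite f0//; lra].
Qed.

(** Both sides have the same derivative and vanish at 0, since f is causal and the
    delays are nonnegative. *)
Lemma prim_avg a b p q f : continuous p -> continuous q -> a <= b ->
  (forall t, a <= t <= b -> 0 <= p t) -> vanishing 0 f ->
  prim (avg a b p q f) =1 avg a b p q (prim f).
Proof.
move=> cp cq ab p0 f0; have [cf _] := f0.
have cF := prim_cont cf; have cA := avg_cont (a := a) (b := b) cp cq cf.
have dF x : hasD (prim f) x (f x) by exact: prim_derive.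
move=> s; apply/eqP; rewrite -subr_eq0.
rewrite (@der_cst _ (fun s => prim (avg a b p q f) s - avg a b p q (prim f) s) s 0).
  rewrite prim0 sub0r oppr_eq0.
  have [_ ->//] : vanishing (0 + 0) (avg a b p q (prim f)).
    by apply: avg_vanishing => //; exact: prim_vanishing.
move=> x; rewrite -(subrr (avg a b p q f x)); apply: derB; first exact: prim_derive.
apply: (@der_oint _ (fun s t => q t * prim f (s - p t)) (fun s t => q t * f (s - p t))).
- by move=> y t; apply: der_eq; [der|cbv beta; ring].
- by cont.
- by cont.
Qed.

Lemma avg_bound a b p q f M Q s : continuous p -> continuous q -> continuous f ->
  a <= b -> (forall t, a <= t <= b -> 0 <= p t) ->
  (forall t, a <= t <= b -> `|q t| <= Q) ->
  (forall t, t <= s -> `|f t| <= M) -> `|avg a b p q f s| <= Q * M * (b - a).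
Proof.
move=> cp cq cf ab p0 qQ fM; apply: oint_bound => //; first by cont.
move=> t tab; rewrite normrM; apply: ler_pM => //; first exact: qQ.
by apply: fM; have := p0 t tab; lra.
Qed.

Lemma avgB a b p q f g : continuous p -> continuous q -> continuous f -> continuous g ->
  avg a b p q (fun t => f t - g t) =1 (fun s => avg a b p q f s - avg a b p q g s).
Proof.
move=> cp cq cf cg s; rewrite /avg -ointB; [|by cont|by cont].
by congr oint; apply/funext => t; rewrite mulrBr.
Qed.
Lemma avgD a b p q f g : continuous p -> continuous q -> continuous f -> continuous g ->
  avg a b p q (fun t => f t + g t) =1 (fun s => avg a b p q f s + avg a b p q g s).
Proof.
move=> cp cq cf cg s; rewrite /avg -ointD; [|by cont|by cont].
by congr oint; apply/funext => t; rewrite mulrDr.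
Qed.
Lemma avgZ a b p q f (c : R) : continuous p -> continuous q -> continuous f ->
  avg a b p q (fun t => c * f t) =1 (fun s => c * avg a b p q f s).
Proof.
move=> cp cq cf s; rewrite /avg -ointZ; last by cont.
by congr oint; apply/funext => t; rewrite mulrCA.
Qed.

(** The half-integral: with t = x^2 this is int_0^{b^2} f(s - t) dt / (2 sqrt t),
    that is, up to a constant, the Abel fractional integral of order 1/2 as long
    as s <= b^2. *)
Definition sqavg b := avg 0 b (fun x => x ^+ 2) (fun=> 1).

Lemma cont_sqr : continuous (fun x : R => x ^+ 2).
Proof. by cont. Qed.

Lemma add1sqr_gt0 (u : R) : 0 < 1 + u ^+ 2.
Proof. by rewrite ltr_pwDl// sqr_ge0. Qed.
Lemma add1sqr_neq0 (u : R) : 1 + u ^+ 2 != 0.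
Proof. exact: lt0r_neq0 (add1sqr_gt0 u). Qed.

Lemma oint_atan : oint 0 1 (fun u : R => (1 + u ^+ 2)^-1) = pi / 4.
Proof.
rewrite (@oint_FTC _ _ atan) ?atan1 ?atan0 ?subr0//.
- by cont; exact: add1sqr_neq0.
- by move=> x; exact: is_derive1_atan.
Qed.

(** The semigroup law of fractional integrals. In the square [0, b]^2 the delay is
    x^2 + y^2; on the ray y = u x it is x^2 (1 + u^2), so that the integral in x
    is a primitive of f divided by 1 + u^2, and the integral of 1 / (1 + u^2) over
    [0, 1] is pi / 4. *)
Lemma sqavg_sqavg b f s : 0 <= b -> vanishing 0 f -> s <= b ^+ 2 ->
  sqavg b (sqavg b f) s = pi / 4 * prim f s.
Proof.
move=> b0 [cf f0] sb; have cF := prim_cont cf.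
have dF x : hasD (prim f) x (f x) by exact: prim_derive.
have -> : sqavg b (sqavg b f) s = oint 0 b (fun x => oint 0 b (fun y => f (s - x ^+ 2 - y ^+ 2))).
  rewrite /sqavg /avg; congr oint; apply/funext => x; rewrite mul1r.
  by congr oint; apply/funext => y; rewrite mul1r.
rewrite oint_Duffy; last by cont.
have -> : (fun x => x * oint 0 1 (fun u => f (s - x ^+ 2 - (x * u) ^+ 2)) +
                    x * oint 0 1 (fun u => f (s - (x * u) ^+ 2 - x ^+ 2))) =
  (fun x => oint 0 1 (fun u => 2 * x * f (s - x ^+ 2 * (1 + u ^+ 2)))).
  apply/funext => x; rewrite -!ointZ; [|by cont|by cont].
  rewrite -ointD; [|by cont|by cont]; congr oint; apply/funext => u.
  have -> : s - x ^+ 2 - (x * u) ^+ 2 = s - x ^+ 2 * (1 + u ^+ 2) by ring.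
  have -> : s - (x * u) ^+ 2 - x ^+ 2 = s - x ^+ 2 * (1 + u ^+ 2) by ring.
  by ring.
rewrite oint_Fubini; last by cont.
have -> : (fun u => oint 0 b (fun x => 2 * x * f (s - x ^+ 2 * (1 + u ^+ 2)))) =
   (fun u => (1 + u ^+ 2)^-1 * prim f s).
  apply/funext => u; have u0 := add1sqr_neq0 u; have u1 := add1sqr_gt0 u.
  rewrite (@oint_FTC _ _ (fun x => - (1 + u ^+ 2)^-1 * prim f (s - x ^+ 2 * (1 + u ^+ 2)))).
  - have [_ ->] : vanishing 0 (prim f) by exact: prim_vanishing.
      by rewrite expr0n/= mul0r subr0; ring.
    rewrite subr_le0; apply: le_trans sb _; rewrite ler_peMr ?sqr_ge0//.
    by rewrite lerDl sqr_ge0.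
  - by cont.
  - by move=> x; apply: der_eq; [der|cbv beta; field].
rewrite ointZr; first by rewrite oint_atan.
by cont; exact: add1sqr_neq0.
Qed.

(** A causal operator W of norm at most 1/2 on every half line ]-oo, s]. *)
Section Neumann.
Variable W : (R -> R) -> R -> R.
Hypothesis Wvan : forall r f, 0 <= r -> vanishing r f -> vanishing r (W f).
Hypothesis WB : forall f g, continuous f -> continuous g ->
  W (fun t => f t - g t) =1 (fun s => W f s - W g s).
Hypothesis Wle : forall f (M s : R), continuous f -> (forall t, t <= s -> `|f t| <= M) ->
  `|W f s| <= M / 2.

Lemma vanishing_bounded r h T : 0 <= r -> vanishing r h ->
  exists2 M, 0 <= M & forall t, t <= T -> `|h t| <= M.
Proof.
move=> r0 [ch h0]; have [T0|T0] := leP T 0.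
  by exists 0 => // t tT; rewrite h0 ?normr0//; lra.
have [c _ hc] := @EVT_max R (fun t => `|h t|) 0 T (ltW T0)
  (continuous_subspaceT (fun x => cvg_norm (ch x))).
exists `|h c| => // t tT; have [t0|t0] := leP t 0.
  by rewrite h0 ?normr0//; lra.
by apply: hc; rewrite in_itv/= tT ltW.
Qed.

(** The fixed point iteration g |-> h - W g. Evaluating at min s T makes h
    bounded, so that the iteration converges uniformly on the whole line and the
    limit is continuous; for s <= T the equation is the original one. *)
Lemma neumann r h T : 0 <= r -> vanishing r h ->
  exists2 g, vanishing r g & forall s, s <= T -> g s + W g s = h s.
Proof.
move=> r0 hv; have [ch h0] := hv.
have [M M0 hM] := vanishing_bounded T r0 hv.
have cmin : continuous (fun s : R => Num.min s T).
  by move=> s; apply: (@continuous_min _ _ (fun s => s) (fun=> T)); [exact: cvg_id|exact: cvg_cst].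
pose step g := fun s => h (Num.min s T) - W g (Num.min s T).
pose g_ k := iter k step (fun=> 0).
have gS k s : g_ k.+1 s = h (Num.min s T) - W (g_ k) (Num.min s T) by [].
have gv k : vanishing r (g_ k).
  elim: k => [|k [cg g0]]; first by split => //; exact: cst_continuous.
  have [cW W0] := Wvan r0 (conj cg g0).
  split; first by rewrite /g_ iterS -/(g_ k) /step; cont.
  by move=> s sr; rewrite gS h0 ?W0 ?subrr//; rewrite ge_min sr.
have cg k : continuous (g_ k) by case: (gv k).
pose d_ k s := g_ k.+1 s - g_ k s.
have dM k s : `|d_ k s| <= M * (2^-1) ^+ k.
  elim: k s => [|k IH] s.
    have W0 : forall t, W (fun=> 0) t = 0.
      move=> t; have H : `|W (fun=> 0) t| <= 0 / 2.
        by apply: Wle => [|? _]; [exact: cst_continuous|rewrite /= normr0].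
      by move: H; rewrite mul0r normr_le0 => /eqP.
    by rewrite /d_ gS /g_ /= W0 !subr0 mulr1 hM// ge_min lexx orbT.
  rewrite /d_ (gS k.+1) (gS k).
  rewrite (_ : _ - _ = - (W (g_ k.+1) (Num.min s T) - W (g_ k) (Num.min s T))); last by ring.
  rewrite normrN -WB//.
  apply: le_trans (@Wle (d_ k) _ _ _ (fun t _ => IH t)) _; first by rewrite /d_; cont.
  by rewrite exprS; lra.
have gseries n s : g_ n s = series (d_ ^~ s) n.
  rewrite seriesEnat /=; elim: n => [|n IH]; first by rewrite big_geq.
  by rewrite big_nat_recr//= -IH /d_ addrC subrK.
have half : `|2^-1 : R| < 1 by rewrite ger0_norm; lra.
have gcvg s : cvgn (g_ ^~ s).
  rewrite (_ : g_ ^~ s = series (d_ ^~ s)); last by apply/funext => n; exact: gseries.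
  apply: normed_cvg; apply: (series_le_cvg (v_ := geometric M 2^-1)).
  - by move=> n; exact: normr_ge0.
  - by move=> n; rewrite /geometric /= mulr_ge0// exprn_ge0.
  - by move=> n; exact: dM.
  - exact: is_cvg_geometric_series.
have gap n k s : `|g_ (n + k)%N s - g_ n s| <= 2 * M * (2^-1) ^+ n.
  suff : `|g_ (n + k)%N s - g_ n s| <= 2 * M * (2^-1) ^+ n * (1 - (2^-1) ^+ k).
    move=> H; apply: le_trans H _; apply: ler_piMr.
      by rewrite mulr_ge0 ?exprn_ge0// mulr_ge0.
    by rewrite gerBl exprn_ge0.
  elim: k => [|k IH]; first by rewrite addn0 subrr normr0 expr0 subrr mulr0.
  rewrite addnS (_ : _ - _ = d_ (n + k)%N s + (g_ (n + k)%N s - g_ n s)); last first.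
    by rewrite /d_; ring.
  apply: le_trans (ler_normD _ _) _; apply: le_trans (lerD (dM _ _) IH) _.
  by rewrite exprD exprS; lra.
pose g s := limn (g_ ^~ s).
have glim n s : `|g s - g_ n s| <= 2 * M * (2^-1) ^+ n.
  have cv : (fun k => `|g_ k s - g_ n s|) @ \oo --> `|g s - g_ n s|.
    by apply: cvg_norm; apply: cvgB; [exact: gcvg|exact: cvg_cst].
  rewrite -(cvg_lim _ cv)//; apply: limr_le; first by apply/cvg_ex; eexists; exact: cv.
  by exists n => // k /= nk; rewrite -(subnKC nk) gap.
have small e : 0 < e -> exists n, 4 * M * (2^-1) ^+ n < e.
  move=> e0.
  have : (fun n => 4 * M * (2^-1) ^+ n) @ \oo --> 4 * M * 0.
    by apply: cvgMr; exact: cvg_expr.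
  rewrite mulr0 => /cvgrPdist_lt/(_ e e0)[n _ /(_ n)] /= /(_ (leqnn n)) H.
  by exists n; apply: le_lt_trans H; rewrite sub0r normrN ler_norm.
have gcont : continuous g.
  move=> s; apply/cvgrPdist_le => e e0.
  have e2 : 0 < e / 2 by lra.
  have [n nE] := small _ e2.
  have /cvgrPdist_le/(_ _ e2) := cg n s.
  apply: filterS => t H.
  rewrite (_ : _ - _ = (g s - g_ n s) + (g_ n s - g_ n t) - (g t - g_ n t)); last by ring.
  apply: le_trans (ler_normB _ _) _; apply: le_trans (lerD (ler_normD _ _) (lexx _)) _.
  by have := glim n s; have := glim n t; lra.
exists g.
  split => // s sr; rewrite /g (_ : g_ ^~ s = fun=> 0) ?lim_cst//.
  by apply/funext => n; case: (gv n) => _ ->.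
move=> s sT; apply/eqP; rewrite -subr_eq0 -normr_le0; apply/ler_addgt0Pl => e e0.
have [n nE] := small e e0; rewrite addr0; apply: le_trans (ltW nE).
have E : g s + W g s - h s = (g s - g_ n.+1 s) + W (fun t => g t - g_ n t) s.
  by rewrite WB// gS min_l//; ring.
rewrite E; apply: le_trans (ler_normD _ _) _.
have H1 := glim n.+1 s.
have H2 := @Wle (fun t => g t - g_ n t) _ s ltac:(by cont) (fun t _ => glim n t).
have H3 : 0 <= M * 2^-1 ^+ n by rewrite mulr_ge0// exprn_ge0.
by rewrite exprS in H1; lra.
Qed.
End Neumann.
End Averages.

(** * Inverting the circle average on causal functions *)
Section CircleAverage.
Context {R : realType}.
Implicit Types (f g : R -> R) (u s r : R).

(** The average over the circle of a plane wave of profile f, in the causal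
    normalisation: the delays 1 + cos a start at 0, where a = pi. *)
Definition circ f := avg 0 (2 * pi) (fun a => 1 + cos a) (fun=> 1) f.

Lemma cont_1Bcos : continuous (fun a : R => 1 - cos a). Proof. by cont. Qed.
Lemma cont_1Dcos : continuous (fun a : R => 1 + cos a). Proof. by cont. Qed.
Lemma cont_1 : continuous (fun _ : R => 1 : R). Proof. by cont. Qed.

Lemma der_mul2atan (x : R) : hasD (fun x => 2 * atan x) x (2 / (1 + x ^+ 2)).
Proof. by apply: der_eq; [der|cbv beta; ring]. Qed.

(** By symmetry both halves of the circle contribute equally; measured from the
    point where the delay vanishes, the delay is 1 - cos a. *)
Lemma circ_half f s : continuous f ->
  circ f s = 2 * avg 0 pi (fun a => 1 - cos a) (fun=> 1) f s.
Proof.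
move=> cf; rewrite /circ /avg (oint_cat pi).
pose F a := 1 * f (s - (1 - cos a)); pose H a := 1 * f (s - (1 + cos a)).
have cF : continuous F by rewrite /F; cont.
have cH : continuous H by rewrite /H; cont.
have E1 : oint 0 pi H = oint 0 pi F.
  have -> : F = (fun a => H (- a + pi)).
    by apply/funext => a; rewrite /F /H cosDpi cosN.
  rewrite (oint_opp (f := fun a => H (a + pi))); last by cont.
  by rewrite (oint_shift (f := H))// oppr0 add0r addNr.
have E2 : oint pi (2 * pi) H = oint 0 pi F.
  have -> : F = (fun a => H (a + pi)) by apply/funext => a; rewrite /F /H cosDpi.
  by rewrite (oint_shift (f := H))// add0r -mulr2n mulr_natl.
transitivity (oint 0 pi F + oint 0 pi F); last by rewrite -/F; ring.
exact: congr2 E1 E2.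
Qed.

(** The functions below express the geometry of the circle in the rational
    parameter u = tan (a / 2): secant is 1 / cos (a / 2), the delay 1 - cos a is
    the versine, and the chord is the square root of the delay. *)
Definition secant u : R := Num.sqrt (1 + u ^+ 2).
Definition versine u : R := 2 * u ^+ 2 / (1 + u ^+ 2).
Definition chord u : R := Num.sqrt 2 * u / secant u.

(** The remainder after comparing 1 - cos a = x^2 with its leading order: the
    density of angles exceeds that of a multiple of the half-integral by weight
    times the density of the delay [weightE]. Being of the order of u, the weight
    allows an integration by parts, which turns f into its primitive. *)
Definition weight u : R := u * secant u / (secant u + 1).
Definition dweight u : R := secant u / (secant u + 1) + u ^+ 2 / (secant u * (secant u + 1) ^+ 2).

Lemma secant_gt0 u : 0 < secant u. Proof. by rewrite sqrtr_gt0 add1sqr_gt0. Qed.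
Lemma secant_neq0 u : secant u != 0. Proof. exact: lt0r_neq0 (secant_gt0 u). Qed.
Lemma secant1_gt0 u : 0 < secant u + 1. Proof. by rewrite addr_gt0 ?secant_gt0. Qed.
Lemma secant1_neq0 u : secant u + 1 != 0. Proof. exact: lt0r_neq0 (secant1_gt0 u). Qed.
Lemma secant_sq u : secant u ^+ 2 = 1 + u ^+ 2.
Proof. by rewrite sqr_sqrtr// ltW ?add1sqr_gt0. Qed.
Lemma sqr_secant u : u ^+ 2 = (secant u - 1) * (secant u + 1).
Proof. by rewrite -subr_sqr secant_sq expr1n addrC addKr. Qed.
Lemma sqrt2_sq : Num.sqrt 2 ^+ 2 = 2 :> R. Proof. by rewrite sqr_sqrtr. Qed.
Lemma der_secant u : hasD secant u (u / secant u).
Proof.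
apply: der_eq.
  apply: (derComp (f := Num.sqrt) (g := fun u => 1 + u ^+ 2)); last by der.
  exact: is_derive1_sqrt (add1sqr_gt0 u).
by cbv beta; rewrite -/(secant u) /=; field; exact: secant_neq0.
Qed.
Lemma cont_secant : continuous secant.
Proof. by apply: der_cont => u; exists (u / secant u); exact: der_secant. Qed.
Lemma der_versine u : hasD versine u (4 * u / secant u ^+ 4).
Proof.
apply: der_eq.
  by rewrite /versine; apply: derM; [der|apply: derV; [exact: add1sqr_neq0|der]].
have -> : secant u ^+ 4 = (1 + u ^+ 2) ^+ 2 by rewrite -secant_sq -exprM.
by cbv beta; field; exact: add1sqr_neq0.
Qed.
Lemma cont_versine : continuous versine.
Proof. by apply: der_cont => u; eexists; exact: der_versine. Qed.
Lemma chord_sq u : chord u ^+ 2 = versine u.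
Proof. by rewrite /chord /versine -secant_sq !exprMn exprVn sqrt2_sq. Qed.
Lemma chord_gt0 u : 0 < u -> 0 < chord u.
Proof. by move=> u0; rewrite divr_gt0 ?secant_gt0// mulr_gt0 ?sqrtr_gt0. Qed.
Lemma der_chord u : hasD chord u (Num.sqrt 2 / secant u ^+ 3).
Proof.
apply: der_eq.
  by rewrite /chord; apply: derM; [der|apply: derV; [exact: secant_neq0|exact: der_secant]].
have -> : Num.sqrt 2 / secant u ^+ 3 = Num.sqrt 2 * (secant u ^+ 2 - u ^+ 2) / secant u ^+ 3.
  by rewrite secant_sq addrK mulr1.
by cbv beta; field; exact: secant_neq0.
Qed.
Lemma der_weight u : hasD weight u (dweight u).
Proof.
have dw := der_secant; apply: der_eq.
  rewrite /weight; apply: derM; last by apply: derV; [exact: secant1_neq0|der].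
  by der.
by rewrite /dweight; cbv beta; field; rewrite secant_neq0 secant1_neq0.
Qed.
Lemma cont_dweight : continuous dweight.
Proof.
have cw := cont_secant.
rewrite /dweight; cont => u; first exact: secant1_neq0.
by rewrite mulf_neq0 ?expf_neq0 ?secant_neq0 ?secant1_neq0.
Qed.
Lemma weightE u : 4 / (1 + u ^+ 2) =
  2 * Num.sqrt 2 * (Num.sqrt 2 / secant u ^+ 3) + weight u * (4 * u / secant u ^+ 4).
Proof.
have -> : 2 * Num.sqrt 2 * (Num.sqrt 2 / secant u ^+ 3) = 4 / secant u ^+ 3 :> R.
  rewrite mulrA -[2 * _ * _]mulrA -expr2 sqrt2_sq; congr (_ / _); ring.
have -> : weight u * (4 * u / secant u ^+ 4) = 4 * u ^+ 2 / (secant u + 1) / secant u ^+ 3.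
  by rewrite /weight; field; rewrite secant_neq0 secant1_neq0.
by rewrite -secant_sq (sqr_secant u); field; rewrite secant_neq0 secant1_neq0.
Qed.
Lemma dweight_bound u : `|dweight u| <= 2.
Proof.
have h1 : 0 <= secant u / (secant u + 1) <= 1.
  apply/andP; split; first by rewrite divr_ge0 ?ltW ?secant_gt0 ?secant1_gt0.
  by rewrite ler_pdivrMr ?secant1_gt0// mul1r lerDl ler01.
have h2 : 0 <= u ^+ 2 / (secant u * (secant u + 1) ^+ 2) <= 1.
  apply/andP; split; first by apply: divr_ge0; [exact: sqr_ge0|apply: mulr_ge0; [exact: ltW (secant_gt0 u)|exact: sqr_ge0]].
  rewrite ler_pdivrMr ?mul1r ?mulr_gt0 ?exprn_gt0 ?secant_gt0 ?secant1_gt0//.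
  have := secant_gt0 u; have := secant_sq u; set x := secant u => xx x0; nra.
by rewrite /dweight ger0_norm; lra.
Qed.
Lemma versine_ge0 u : 0 <= versine u. Proof. by rewrite -chord_sq sqr_ge0. Qed.
Lemma cos_2atan u : 1 - cos (2 * atan u) = versine u.
Proof.
rewrite mulr_natl cos_mulr2n cos_atan -/(secant u) exprVn secant_sq /versine mulr2n.
by field; exact: add1sqr_neq0.
Qed.

(** What is left of the circle and of the half-integral at delays at least versine
    u, together with the boundary term of the integration by parts. *)
Definition tailop u b f s : R :=
  2 * avg (2 * atan u) pi (fun a => 1 - cos a) (fun=> 1) f s
  - 2 * Num.sqrt 2 * avg (chord u) b (fun x => x ^+ 2) (fun=> 1) f s
  - weight u * prim f (s - versine u).
Definition headop u f := avg 0 u versine dweight f.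

(** With the substitutions a = 2 atan u and x = chord u, small delays contribute a
    multiple of the half-integral plus the integral of f against weight
    d(versine); the latter is integrated by parts. *)
Lemma circ_decomp u b f s : continuous f -> 0 <= u -> vanishing 0 f ->
  circ f s = 2 * Num.sqrt 2 * sqavg b f s + headop u (prim f) s + tailop u b f s.
Proof.
move=> cf u0 f0; rewrite circ_half//.
have cF := prim_cont cf; have cw := cont_secant; have cv := cont_versine.
have cdm := cont_dweight; have dv := der_versine.
have dF x : hasD (prim f) x (f x) by exact: prim_derive.
have cw3 : continuous (fun u => Num.sqrt 2 / secant u ^+ 3).
  by cont => ?; rewrite expf_neq0 ?secant_neq0.
have cdp : continuous (fun u => 4 * u / secant u ^+ 4).
  by cont => ?; rewrite expf_neq0 ?secant_neq0.
have cm : continuous weight by apply: der_cont => x; eexists; exact: der_weight.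
have Ev : oint 0 (chord u) (fun x => 1 * f (s - x ^+ 2)) =
    oint 0 u (fun x => f (s - versine x) * (Num.sqrt 2 / secant x ^+ 3)).
  have v0 : chord 0 = 0 by rewrite /chord mulr0 mul0r.
  have := @oint_subst _ (fun x => 1 * f (s - x ^+ 2)) chord (fun u => Num.sqrt 2 / secant u ^+ 3)
    0 u ltac:(by cont) cw3 der_chord.
  rewrite v0 => <-.
  by congr oint; apply/funext => x; rewrite mul1r chord_sq.
have Em : oint 0 u (fun x => weight x * (4 * x / secant x ^+ 4 * f (s - versine x))) =
    oint 0 u (fun x => dweight x * prim f (s - versine x)) - weight u * prim f (s - versine u).
  rewrite (@oint_parts _ weight dweight (fun x => - prim f (s - versine x))) //.
  - rewrite {2}/weight !mul0r subr0 mulrN addrC; congr (_ - _).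
    rewrite -ointN; last by cont.
    by congr oint; apply/funext => x; rewrite mulrN opprK.
  - by cont.
  - exact: der_weight.
  - by move=> x; apply: der_eq; [der|cbv beta; ring].
have Eh : 2 * oint 0 (2 * atan u) (fun a => 1 * f (s - (1 - cos a))) =
    oint 0 u (fun x => f (s - versine x) * (4 / (1 + x ^+ 2))).
  have a0 : 2 * atan 0 = 0 :> R by rewrite atan0 mulr0.
  have ca : continuous (@atan R) by exact: continuous_atan.
  have ci : continuous (fun x : R => 2 / (1 + x ^+ 2)) by cont; exact: add1sqr_neq0.
  have := @oint_subst _ (fun a => 1 * f (s - (1 - cos a))) (fun x => 2 * atan x)
    (fun x => 2 / (1 + x ^+ 2)) 0 u ltac:(by cont) ci der_mul2atan.
  rewrite a0 => <-; rewrite -ointZ; last by cont; exact: add1sqr_neq0.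
  congr oint; apply/funext => x; rewrite cos_2atan mul1r.
  by field; exact: add1sqr_neq0.
have Ew : oint 0 u (fun x => f (s - versine x) * (4 / (1 + x ^+ 2))) =
   2 * Num.sqrt 2 * oint 0 u (fun x => f (s - versine x) * (Num.sqrt 2 / secant x ^+ 3)) +
   oint 0 u (fun x => weight x * (4 * x / secant x ^+ 4 * f (s - versine x))).
  rewrite -ointZ -?ointD; [|by cont|by cont|by cont].
  by congr oint; apply/funext => x; rewrite weightE; ring.
rewrite /avg (oint_cat (2 * atan u)) mulrDr Eh Ew -Ev Em /sqavg /tailop /headop /avg.
by rewrite (oint_cat (chord u) 0 b); ring.
Qed.

(** Each term of [tailop] delays by at least versine u; for the half-integral the
    range of integration starts at chord u, whose square is the versine. *)
Lemma tailop_vanishing u b f r : 0 < u -> chord u <= b -> 0 <= r -> vanishing r f ->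
  vanishing (r + versine u) (tailop u b f).
Proof.
move=> u0 vb r0 fv; have [cf _] := fv.
have [cF F0] := prim_vanishing r0 fv.
have vu0 := chord_gt0 u0.
have apos : 0 < atan u by rewrite -[ltLHS](@atan0 R); exact: lt_atan.
have api : 2 * atan u <= pi by have := atan_ltpi2 u; lra.
have [c1 z1] : vanishing (r + versine u) (avg (2 * atan u) pi (fun a => 1 - cos a) (fun=> 1) f).
  apply: avg_vanishing => //; [exact: cont_1Bcos|exact: cont_1|].
  move=> t tab; rewrite -cos_2atan lerD2l lerN2 leNgt ltr_cos ?in_itv /=; lra.
have [c2 z2] : vanishing (r + versine u) (avg (chord u) b (fun x => x ^+ 2) (fun=> 1) f).
  apply: avg_vanishing => //; [exact: cont_sqr|exact: cont_1|].
  by move=> t /andP[vt _]; rewrite -chord_sq lerXn2r// nnegrE; lra.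
split; first by rewrite /tailop; cont.
move=> s sr; rewrite /tailop z1// z2// F0; [ring|lra].
Qed.

(** V A = (k + A Z) J + A D, where V, A, Z, D are the circle average, the
    half-integral, [headop] and [tailop]. The parameter u is taken so small that
    k^-1 A Z has norm at most 1/2; it also fixes the delay versine u gained at
    each step. *)
Lemma prim_iter_solve (T : R) : exists n0, forall n h, (n0 <= n)%N -> vanishing 0 h ->
  exists2 e, vanishing 0 e & forall s, s <= T -> circ e s = iter n prim h s.
Proof.
wlog T0 : T / 0 < T.
  move=> H; have [|n0 Hn] := H (Num.max T 1); first by rewrite lt_max ltr01 orbT.
  exists n0 => n h nn hv; have [e ev eE] := Hn n h nn hv; exists e => // s sT.
  by apply: eE; rewrite le_max sT.
pose b := Num.max T 1; have b1 : 1 <= b by rewrite le_max lexx orbT.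
have bT : T <= b ^+ 2.
  have : T <= b by rewrite le_max lexx.
  by move=> ?; nra.
have b0 : 0 < b by lra.
pose k : R := 2 * Num.sqrt 2 * (pi / 4).
have k0 : 0 < k.
  by rewrite !mulr_gt0 ?sqrtr_gt0 ?invr_gt0 ?pi_gt0.
(* headop u has norm at most 2 u and the half-integral has norm at most b, so
   that u <= k / (4 b) bounds the norm of k^-1 A Z by 1/2. *)
pose u := Num.min (2^-1) (k / (4 * b)).
have u0 : 0 < u by rewrite lt_min; apply/andP; split; [lra|rewrite divr_gt0// mulr_gt0].
have u1 : u <= 2^-1 by rewrite ge_min lexx.
have uk : 4 * b * u <= k.
  rewrite mulrC -ler_pdivlMr ?mulr_gt0//.
  by rewrite ge_min lexx orbT.
have vb : chord u <= b.
  have : chord u <= 1.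
    have p1 : versine u <= 1.
      by rewrite /versine ler_pdivrMr ?add1sqr_gt0// mul1r; nra.
    by rewrite leNgt; apply/negP => v1; have := chord_sq u; nra.
  lra.
have csq := @cont_sqr R; have c1 := cont_1.
have cp := cont_versine; have cdm := cont_dweight.
have sqv r f : 0 <= r -> vanishing r f -> vanishing r (sqavg b f).
  move=> r0 fv; rewrite -[r]addr0; apply: avg_vanishing => //; first exact: ltW.
  by move=> t _; exact: sqr_ge0.
have hdv r f : 0 <= r -> vanishing r f -> vanishing r (headop u f).
  move=> r0 fv; rewrite -[r]addr0; apply: avg_vanishing => //; first exact: ltW.
  by move=> t _; exact: versine_ge0.
pose W f s : R := k^-1 * sqavg b (headop u f) s.
have csqv f : continuous f -> continuous (sqavg b f) by move=> ?; apply: avg_cont.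
have chdv f : continuous f -> continuous (headop u f) by move=> ?; apply: avg_cont.
have Wvan r f : 0 <= r -> vanishing r f -> vanishing r (W f).
  move=> r0 fv; have [cA A0] := sqv _ _ r0 (hdv _ _ r0 fv).
  split; first by rewrite /W; cont.
  by move=> s sr; rewrite /W A0 ?mulr0.
have headB f g : continuous f -> continuous g ->
    headop u (fun t => f t - g t) = (fun s => headop u f s - headop u g s).
  by move=> cf cg; apply/funext => s; exact: avgB.
have WB f g : continuous f -> continuous g ->
    W (fun t => f t - g t) =1 (fun s => W f s - W g s).
  move=> cf cg s; have ch1 := chdv f cf; have ch2 := chdv g cg.
  rewrite /W (headB f g cf cg) -mulrBr; congr (_ * _); exact: avgB.
have Wle f (M : R) s : continuous f -> (forall t, t <= s -> `|f t| <= M) ->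
    `|W f s| <= M / 2.
  move=> cf fM.
  have M0 : 0 <= M by exact: le_trans (normr_ge0 _) (fM s (lexx s)).
  have H1 t : t <= s -> `|headop u f t| <= 2 * M * (u - 0).
    move=> ts; apply: avg_bound => //; [exact: ltW|by move=> *; exact: versine_ge0|
      by move=> *; exact: dweight_bound|].
    by move=> x xt; apply: fM; exact: le_trans xt ts.
  have H2 : `|sqavg b (headop u f) s| <= 1 * (2 * M * (u - 0)) * (b - 0).
    apply: avg_bound => //; [exact: chdv|exact: ltW|by move=> *; exact: sqr_ge0|].
    by move=> *; rewrite normr1.
  rewrite /W normrM gtr0_norm ?invr_gt0// mulrC ler_pdivrMr//.
  apply: le_trans H2 _; rewrite !subr0 mul1r.
  have := ler_wpM2l M0 uk; lra.
have pu0 : 0 < versine u by rewrite -chord_sq exprn_gt0// chord_gt0.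
(* Each step trades one primitive for a delay: the residual r starts later
   by versine u. *)
have step n (h : R -> R) : vanishing 0 h -> exists e r : R -> R, [/\ vanishing 0 e, vanishing (n%:R * versine u) r &
    forall s, s <= T -> iter n prim h s = circ e s + r s].
  move=> hv; elim: n => [|n [e [r [ev rv E]]]].
    exists (fun=> 0), h; split=> //; first by split => //; exact: cst_continuous.
      by rewrite mul0r.
    move=> s _ /=; rewrite /circ /avg; under eq_fun do rewrite mulr0.
    by rewrite oint0 add0r.
  have nr0 : 0 <= n%:R * versine u by rewrite mulr_ge0// ltW.
  have rv' : vanishing (n%:R * versine u) (fun s => k^-1 * r s).
    have [cr r0] := rv; split; first by cont.
    by move=> s sr; rewrite r0 ?mulr0.
  have [g gv gE] := neumann Wvan WB Wle T nr0 rv'.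
  have gv0 : vanishing 0 g.
    by have [cg g0] := gv; split => // s s0; apply: g0; exact: le_trans nr0.
  have [cg _] := gv; have cG := prim_cont cg.
  exists (fun s => prim e s + sqavg b g s), (fun s => - sqavg b (tailop u b g) s).
  have ev' := prim_vanishing (lexx 0) ev.
  have [ce _] := ev'; have [cA A0] := sqv _ _ (lexx 0) gv0.
  have tv : vanishing (n%:R * versine u + versine u) (tailop u b g) by exact: tailop_vanishing.
  have tv0 : 0 <= n%:R * versine u + versine u by rewrite addr_ge0// ltW.
  have [ct t0] := sqv _ _ tv0 tv.
  split.
  - split; first by cont.
    by move=> s s0; case: ev' => _ ->//; rewrite A0// addr0.
  - split; first by cont.
    by move=> s sn; rewrite t0 ?oppr0//; move: sn; rewrite -natr1 mulrDl mul1r.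
  move=> s sT; rewrite iterS.
  have [ce0 _] := ev; have [cr _] := rv.
  have ccirc : continuous (circ e) by apply: avg_cont => //; exact: cont_1Dcos.
  have cZ := chdv _ cg; have cAZ := csqv _ cZ.
  have c0 := @cont_1Dcos; have cZG := chdv _ cG.
  have [cT _] := tv.
  rewrite (@eq_prim _ _ (fun s => circ e s + r s) T)//; last 3 first.
  - by elim: n {E rv nr0 rv' gv tv tv0 t0} => [|n IH] /=; [case: hv|exact: prim_cont].
  - by cont.
  - exact: ltW.
  have -> : prim (fun s => circ e s + r s) s = prim (circ e) s + prim r s.
    by rewrite !primE ointD.
  have -> : prim r s = k * prim g s + sqavg b (headop u (prim g)) s.
    rewrite (@eq_prim _ _ (fun s => k * g s + sqavg b (headop u g) s) T)//; last 3 first.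
    - by cont.
    - exact: ltW.
    - move=> t tT; have := gE t tT; rewrite /W => H.
      have -> : r t = k * (k^-1 * r t) by rewrite mulrA divff ?mul1r// lt0r_neq0.
      by rewrite -H; field; exact: lt0r_neq0.
    rewrite primE ointD; [|by cont|by cont].
    rewrite ointZ// -!primE; congr (_ + _).
    have Eh : prim (headop u g) = headop u (prim g).
      by apply/funext => t; exact: (prim_avg cp cdm (ltW u0) (fun t _ => versine_ge0 t) gv0 t).
    rewrite -Eh; apply: prim_avg => //; first exact: ltW.
      by move=> *; exact: sqr_ge0.
    exact: hdv.
  have -> : prim (circ e) s = circ (prim e) s.
    have p1 (t : R) : 0 <= t <= 2 * pi -> 0 <= 1 + cos t.
      by move=> _; have := cos_geN1 t; lra.
    by apply: (prim_avg c0 c1 _ p1 ev); rewrite mulr_ge0// pi_ge0.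
  rewrite /circ avgD// -/(circ (prim e)) -/(circ (sqavg b g)).
  have -> : circ (sqavg b g) s = sqavg b (circ g) s by apply: avg_comm.
  have -> : circ g = (fun s => 2 * Num.sqrt 2 * sqavg b g s +
      headop u (prim g) s + tailop u b g s).
    by apply/funext => t; apply: circ_decomp => //; exact: ltW.
  have csg := csqv _ cg.
  have sqD F G : continuous F -> continuous G ->
      sqavg b (fun t => F t + G t) s = sqavg b F s + sqavg b G s.
    by move=> cF' cG'; exact: avgD.
  have cS : continuous (fun s => 2 * Num.sqrt 2 * sqavg b g s) by cont.
  have cSH : continuous (fun s => 2 * Num.sqrt 2 * sqavg b g s + headop u (prim g) s).
    by cont.
  rewrite (sqD _ _ cSH cT) (sqD _ _ cS cZG).
  have -> : sqavg b (fun s => 2 * Num.sqrt 2 * sqavg b g s) s =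
      2 * Num.sqrt 2 * sqavg b (sqavg b g) s by exact: avgZ.
  by rewrite (sqavg_sqavg (ltW b0) gv0 (le_trans sT bT)) /k; ring.
have [n0 n0E] : exists n0 : nat, T < n0%:R * versine u.
  exists (Num.truncn (T / versine u)).+1.
  by rewrite -ltr_pdivrMr//; exact: truncnS_gt.
exists n0 => n h nn hv; have [e [r [ev rv E]]] := step n h hv.
exists e => // s sT; rewrite E// (proj2 rv) ?addr0//.
apply: le_trans sT _; apply: le_trans (ltW n0E) _.
by rewrite ler_pM2r// ler_nat.
Qed.
End CircleAverage.

(** * Smooth functions on the plane *)
Section Partials.
Context {R : realType}.
Implicit Types (u v : R * R -> R) (p : R * R).

(** A partial derivative that conversion cannot unfold. *)
Fact pd_spec : {d : bool -> (R * R -> R) -> R * R -> R |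
  forall j u, d j u = 'D_(axis j) u}.
Proof. by eexists. Qed.
Definition pd := sval pd_spec.
Lemma pd_derive j u : pd j u = 'D_(axis j) u.
Proof. exact: (svalP pd_spec). Qed.

Lemma slice_quotient j u p : (fun h : R => h^-1 *: (u (h *: axis j + p) - u p)) =
  (fun h : R => h^-1 *: ((fun t => if j then u (p.1, t) else u (t, p.2))
     (h *: 1 + (if j then p.2 else p.1)) - u p)).
Proof.
apply/funext => h; congr (_ *: (_ - _)); case: p => x y; case: j => /=.
  by congr u; congr pair; rewrite /= scaler0 add0r.
by congr u; congr pair; rewrite /= scaler0 add0r.
Qed.

(** The restriction of u to the line through p in direction j, parametrised by the
    coordinate itself, so that partial derivatives are ordinary derivatives
    [is_derive_slice]. *)
Definition slice (j : bool) u p (t : R) := if j then u (p.1, t) else u (t, p.2).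
Definition coord (j : bool) (p : R * R) : R := if j then p.2 else p.1.
Lemma slice_coord j u p : slice j u p (coord j p) = u p.
Proof. by case: p => x y; case: j. Qed.

Lemma is_derive_slice j u p d :
  is_derive p (axis j) u d <-> hasD (slice j u p) (coord j p) d.
Proof.
rewrite /hasD; split => -[]; rewrite /derivable /derive => h e;
  (split; [move: h|move: e]);
  rewrite /derivable /derive slice_quotient slice_coord //.
Qed.

(** A record, because smooth_real unfolds to a quantified statement, which tactics
    would apply instead of treating it as a property of u. *)
Record Cinf u : Prop := MkCinf { CinfP : smooth_real u }.

Lemma smooth_cont u : Cinf u -> continuous u.
Proof. by move=> [/(_ [::])[]]. Qed.

Lemma smooth_pd j u : Cinf u -> Cinf (pd j u).
Proof. rewrite pd_derive; by move=> [su]; split=> s; have := su (rcons s j); rewrite /partials -cats1 foldr_cat. Qed.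

Lemma smooth_hasD j u p : Cinf u -> hasD (slice j u p) (coord j p) (pd j u p).
Proof.
move=> [su]; rewrite pd_derive; apply/is_derive_slice; apply: derivableP.
by have [_] := su [::]; exact.
Qed.

Lemma smooth_hasDx u x y : Cinf u -> hasD (fun t => u (t, y)) x (pd false u (x, y)).
Proof. by move=> su; exact: (smooth_hasD false (x, y) su). Qed.
Lemma smooth_hasDy u x y : Cinf u -> hasD (fun t => u (x, t)) y (pd true u (x, y)).
Proof. by move=> su; exact: (smooth_hasD true (x, y) su). Qed.

Lemma pdE j u d : (forall p, hasD (slice j u p) (coord j p) (d p)) -> pd j u = d.
Proof.
by move=> h; rewrite pd_derive; apply/funext => p; have /is_derive_slice[_ <-] := h p.
Qed.

(** A class of continuous functions closed under partial derivatives consists of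
    smooth functions. This replaces formulas for iterated derivatives: smoothness
    of products, translates, convolutions and cutoffs below is proved by naming
    such a class. *)
Lemma smooth_class (P : (R * R -> R) -> Prop) :
  (forall u, P u -> continuous u) ->
  (forall u j, P u -> exists2 v, P v & forall p, hasD (slice j u p) (coord j p) (v p)) ->
  forall u, P u -> Cinf u.
Proof.
move=> Pc Pd u Pu; split=> s.
have Ps : P (partials s u).
  elim: s => [//|j s IH]; have [v Pv vE] := Pd _ j IH.
  by rewrite /= -/(partials s u) -pd_derive (pdE vE).
split; first exact: Pc.
move=> j p; have [v _ /(_ p)/is_derive_slice[]] := Pd _ j Ps.
by [].
Qed.

Lemma smooth_sliceD j u v p d e :
  hasD (slice j u p) (coord j p) d -> hasD (slice j v p) (coord j p) e ->
  hasD (slice j (fun q => u q + v q) p) (coord j p) (d + e).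
Proof. by case: j; exact: derD. Qed.

Lemma smooth_sliceM j u v p d e :
  hasD (slice j u p) (coord j p) d -> hasD (slice j v p) (coord j p) e ->
  hasD (slice j (fun q => u q * v q) p) (coord j p) (d * v p + u p * e).
Proof.
move=> hu hv; apply: der_eq.
  by move: hu hv; case: j; exact: derM.
by rewrite !slice_coord.
Qed.

(** By the Leibniz rule, this class contains the partial derivatives of its
    members. *)
Inductive sop_class : (R * R -> R) -> Prop :=
| SopM u v : Cinf u -> Cinf v -> sop_class (fun p => u p * v p)
| SopD u v : sop_class u -> sop_class v -> sop_class (fun p => u p + v p).

Lemma smooth_sop u : sop_class u -> Cinf u.
Proof.
apply: (@smooth_class sop_class).
  move=> {}u; elim=> {}u v.
    by move=> /smooth_cont cu /smooth_cont cv; cont.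
  by move=> _ cu _ cv; cont.
move=> {}u j; elim=> {}u v.
  move=> su sv; exists (fun p => pd j u p * v p + u p * pd j v p).
    by apply: SopD; apply: SopM => //; exact: smooth_pd.
  by move=> p; apply: smooth_sliceM; exact: smooth_hasD.
move=> _ [u' cu hu] _ [v' cv hv]; exists (fun p => u' p + v' p); first exact: SopD.
by move=> p; exact: smooth_sliceD.
Qed.

Lemma smooth_cst (c : R) : Cinf (fun=> c).
Proof.
apply: (@smooth_class (fun u => exists c, u = fun=> c)); last by exists c.
  by move=> u [d ->]; exact: cst_continuous.
move=> u j [d ->]; exists (fun=> 0); first by exists 0.
by move=> p; case: j; exact: derC.
Qed.

Lemma smoothM u v : Cinf u -> Cinf v -> Cinf (fun p => u p * v p).
Proof. by move=> su sv; apply: smooth_sop; exact: SopM. Qed.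

Lemma smoothD u v : Cinf u -> Cinf v -> Cinf (fun p => u p + v p).
Proof.
move=> su sv; apply: smooth_sop.
rewrite (_ : (fun p => _) = (fun p => (1 * u p) + 1 * v p)).
  by apply: SopD; apply: SopM => //; exact: smooth_cst.
by apply/funext => p; rewrite !mul1r.
Qed.


Lemma slice_shift j u q p t :
  slice j (fun p => u (p.1 + q.1, p.2 + q.2)) p t =
  slice j u (p.1 + q.1, p.2 + q.2) (t + coord j q).
Proof. by case: j. Qed.

Lemma smooth_shift u q : Cinf u -> Cinf (fun p => u (p.1 + q.1, p.2 + q.2)).
Proof.
move=> su.
apply: (@smooth_class (fun v => exists2 u, Cinf u & v = fun p => u (p.1 + q.1, p.2 + q.2)));
  last by exists u.
  by move=> _ [v /smooth_cont cv ->]; cont.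
move=> _ j [v sv ->]; exists (fun p => pd j v (p.1 + q.1, p.2 + q.2)).
  by exists (pd j v) => //; exact: smooth_pd.
move=> p; rewrite (_ : slice _ _ _ = fun t => slice j v (p.1 + q.1, p.2 + q.2) (t + coord j q)).
  apply: der_eq.
    apply: (derComp (f := slice j v (p.1 + q.1, p.2 + q.2)) (g := fun t => t + coord j q)).
      rewrite (_ : coord j p + coord j q = coord j (p.1 + q.1, p.2 + q.2)); last by case: j.
      exact: smooth_hasD.
    by der.
  by rewrite addr0 mulr1.
by apply/funext => t; exact: slice_shift.
Qed.

Lemma pd_shift j u q : Cinf u ->
  pd j (fun p => u (p.1 + q.1, p.2 + q.2)) = (fun p => pd j u (p.1 + q.1, p.2 + q.2)).
Proof.
move=> su; apply: pdE => p.
rewrite (_ : slice _ _ _ = fun t => slice j u (p.1 + q.1, p.2 + q.2) (t + coord j q)).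
  apply: der_eq.
    apply: (derComp (f := slice j u (p.1 + q.1, p.2 + q.2)) (g := fun t => t + coord j q)).
      rewrite (_ : coord j p + coord j q = coord j (p.1 + q.1, p.2 + q.2)); last by case: j.
      exact: smooth_hasD.
    by der.
  by rewrite addr0 mulr1.
by apply/funext => t; exact: slice_shift.
Qed.

Lemma eq_near_partials (U : set (R * R)) u v s : open U -> {in U, u =1 v} ->
  {in U, partials s u =1 partials s v}.
Proof.
move=> oU uv; elim: s => [//|j s IH] p /set_mem Up /=.
apply: near_eq_derive; near=> q; apply: IH; apply/mem_set.
by near: q; exact: open_nbhs_nbhs.
Unshelve. all: by end_near. Qed.

Definition supp_in (b : R) u := forall p, b < `|p.1| \/ b < `|p.2| -> u p = 0.

Lemma supp_open (b : R) : open [set p : R * R | b < `|p.1| \/ b < `|p.2|].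
Proof.
have c1 : continuous (fun p : R * R => `|p.1|).
  by move=> p; apply: cvg_norm; exact: cvg_fst.
have c2 : continuous (fun p : R * R => `|p.2|).
  by move=> p; apply: cvg_norm; exact: cvg_snd.
rewrite (_ : [set _ | _] = ((fun p : R * R => `|p.1|) @^-1` [set t | b < t]) `|`
   ((fun p : R * R => `|p.2|) @^-1` [set t | b < t])); last by [].
by apply: openU; (apply: open_comp; [by move=> ? _; first [exact: c1|exact: c2]|exact: open_gt]).
Qed.

Lemma supp_pd b j u : supp_in b u -> supp_in b (pd j u).
Proof.
move=> bu p bp; rewrite pd_derive -(derive_cst (0 : R) p (axis j)).
have := @eq_near_partials _ u (fun=> 0) [:: j] (@supp_open b).
by rewrite /=; apply; [move=> q /set_mem; exact: bu|exact: mem_set].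
Qed.

Definition lap u : R * R -> R := fun p => pd false (pd false u) p + pd true (pd true u) p.

Lemma smooth_lap u : Cinf u -> Cinf (lap u).
Proof. by move=> su; apply: smoothD; do 2 apply: smooth_pd. Qed.
Lemma supp_lap b u : supp_in b u -> supp_in b (lap u).
Proof. by move=> bu p bp; rewrite /lap !(supp_pd _ (supp_pd _ bu))// addr0. Qed.
Lemma smooth_iter_lap n u : Cinf u -> Cinf (iter n lap u).
Proof. by move=> su; elim: n => //= n; exact: smooth_lap. Qed.
Lemma supp_iter_lap b n u : supp_in b u -> supp_in b (iter n lap u).
Proof. by move=> bu; elim: n => //= n; exact: supp_lap. Qed.
Lemma lap_shift u q : Cinf u ->
  lap (fun p => u (p.1 + q.1, p.2 + q.2)) = (fun p => lap u (p.1 + q.1, p.2 + q.2)).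
Proof.
move=> su; rewrite /lap !pd_shift //; exact: smooth_pd.
Qed.
Lemma iter_lap_shift n u q : Cinf u ->
  iter n lap (fun p => u (p.1 + q.1, p.2 + q.2)) = (fun p => iter n lap u (p.1 + q.1, p.2 + q.2)).
Proof.
move=> su; elim: n => [|n IH]; first by [].
by rewrite !iterS IH (lap_shift q (smooth_iter_lap n su)).
Qed.
End Partials.

(** * Integrals over squares and integration by parts *)
Section PlaneIntegral.
Context {R : realType}.
Implicit Types (u v H Hx Hy K Kx Ky Kxx Kyy phi : R * R -> R) (b c : R).

Lemma oint_supp (f : R -> R) b a d a' d' : continuous f ->
  (forall t, b < `|t| -> f t = 0) -> a < - b -> b < d -> a' < - b -> b < d' ->
  oint a d f = oint a' d' f.
Proof.
move=> cf f0.
have E x y : (y < - b \/ b < x) -> x <= y -> oint x y f = 0.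
  move=> h xy; rewrite -(oint0 x y); apply: oint_ext => //; first exact: cst_continuous.
  move=> t /andP[xt ty]; apply: f0; case: h => h; rewrite lter_normr; lra.
have E' x y : (x < - b /\ y < - b) \/ (b < x /\ b < y) -> oint x y f = 0.
  by case: (leP x y) => xy h; [|rewrite oint_swap]; rewrite E ?oppr0//; lra.
move=> ab bd ab' bd'; rewrite (oint_cat a') (oint_cat d' a').
by rewrite E' ?(E' d')//; [ring|lra|lra].
Qed.

(** The integral over the square [-c, c]^2. Functions supported in a smaller
    square have the same integral over all larger squares [boxint_supp], so that
    this serves as the integral over the plane while all functions are merely
    continuous and every exchange of integrals is elementary. *)
Fact boxint_spec : {J : R -> (R * R -> R) -> R |
  forall c u, J c u = oint (- c) c (fun x => oint (- c) c (fun y => u (x, y)))}.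
Proof. by eexists. Qed.
Definition boxint := sval boxint_spec.
Lemma boxintE c u : boxint c u = oint (- c) c (fun x => oint (- c) c (fun y => u (x, y))).
Proof. exact: (svalP boxint_spec). Qed.

Lemma eq_boxint u v c : u =1 v -> boxint c u = boxint c v.
Proof. by move=> /funext ->. Qed.

Lemma cont_boxint (T : topologicalType) (u : T -> R * R -> R) c :
  continuous (fun p : T * (R * R) => u p.1 p.2) -> continuous (fun t => boxint c (u t)).
Proof.
move=> cu; rewrite (_ : (fun t => _) = fun t => oint (- c) c (fun x => oint (- c) c (fun y => u t (x, y)))).
  by cont.
by apply/funext => t; rewrite boxintE.
Qed.

Lemma boxintD u v c : continuous u -> continuous v ->
  boxint c (fun p => u p + v p) = boxint c u + boxint c v.
Proof.
move=> cu cv; rewrite !boxintE -ointD; [|by cont|by cont].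
by apply: eq_oint => x; rewrite ointD//; cont.
Qed.
Lemma boxintZ u a c : continuous u -> boxint c (fun p => a * u p) = a * boxint c u.
Proof.
move=> cu; rewrite !boxintE -ointZ; last by cont.
by apply: eq_oint => x; rewrite ointZ//; cont.
Qed.
Lemma boxintN u c : continuous u -> boxint c (fun p => - u p) = - boxint c u.
Proof.
move=> cu; rewrite -mulN1r -boxintZ//; apply: eq_boxint => p; by rewrite mulN1r.
Qed.
Lemma boxintB u v c : continuous u -> continuous v ->
  boxint c (fun p => u p - v p) = boxint c u - boxint c v.
Proof. by move=> cu cv; rewrite boxintD ?boxintN//; cont. Qed.
Lemma boxint0 c : boxint c (fun=> 0) = 0.
Proof. by rewrite !boxintE; under eq_fun do rewrite oint0; rewrite oint0. Qed.

Lemma boxint_ext u v c : 0 <= c -> continuous u -> continuous v ->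
  (forall p, `|p.1| <= c -> `|p.2| <= c -> u p = v p) -> boxint c u = boxint c v.
Proof.
move=> c0 cu cv uv; rewrite !boxintE; apply: oint_ext => //; [by cont|by cont|by lra|move=> x xc].
apply: oint_ext => //; [by cont|by cont|by lra|move=> y yc].
by apply: uv; rewrite ler_norml.
Qed.

Lemma boxint_Fubini (u : R * R -> R -> R) c a b :
  continuous (fun p : (R * R) * R => u p.1 p.2) ->
  boxint c (fun p => oint a b (u p)) = oint a b (fun t => boxint c (fun p => u p t)).
Proof.
move=> cu; rewrite !boxintE.
under [RHS]eq_oint => t do rewrite boxintE.
transitivity (oint (- c) c (fun x => oint a b (fun t => oint (- c) c (fun y => u (x, y) t)))).
  apply: eq_oint => x.
  by apply: (@oint_Fubini _ (fun y t => u (x, y) t)); cont.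
by apply: (@oint_Fubini _ (fun x t => oint (- c) c (fun y => u (x, y) t))); cont.
Qed.

Lemma boxint_boxint_Fubini (u : R * R -> R * R -> R) c d :
  continuous (fun p : (R * R) * (R * R) => u p.1 p.2) ->
  boxint c (fun p => boxint d (u p)) = boxint d (fun q => boxint c (fun p => u p q)).
Proof.
move=> cu; rewrite [RHS]boxintE.
under eq_boxint do rewrite boxintE.
rewrite (@boxint_Fubini (fun p x => oint (- d) d (fun y => u p (x, y)))); last by cont.
apply: eq_oint => x.
by rewrite (@boxint_Fubini (fun p y => u p (x, y))); last by cont.
Qed.

Lemma boxint_supp u b c c' : continuous u -> supp_in b u -> b < c -> b < c' ->
  boxint c u = boxint c' u.
Proof.
move=> cu bu bc bc'; rewrite !boxintE.
rewrite (@oint_supp _ b (- c) c (- c') c'); [|by cont| |lra|lra|lra|lra].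
  apply: eq_oint => x; apply: (@oint_supp _ b); [by cont| |lra|lra|lra|lra].
  by move=> t bt; apply: bu; right.
move=> t bt; rewrite -(oint0 (- c) c); apply: eq_oint => y.
by apply: bu; left.
Qed.

Lemma boxint_shift u q b c c' : continuous u -> supp_in b u ->
  b + `|q.1| < c -> b + `|q.2| < c -> b < c' ->
  boxint c (fun p => u (p.1 + q.1, p.2 + q.2)) = boxint c' u.
Proof.
move=> cu bu bc1 bc2 bc'; rewrite !boxintE /=.
have /andP[q1 q1'] : - `|q.1| <= q.1 <= `|q.1| by rewrite -ler_norml.
have /andP[q2 q2'] : - `|q.2| <= q.2 <= `|q.2| by rewrite -ler_norml.
rewrite (@oint_shift _ (fun x => oint (- c) c (fun y => u (x, y + q.2)))); last by cont.
rewrite (@oint_supp _ b _ _ (- c') c'); [|by cont| |lra|lra|lra|lra].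
  apply: eq_oint => x; rewrite (@oint_shift _ (fun y => u (x, y))); last by cont.
  apply: (@oint_supp _ b); [by cont| |lra|lra|lra|lra].
  by move=> t bt; apply: bu; right.
move=> t bt; rewrite -(oint0 (- c) c); apply: eq_oint => y.
by apply: bu; left.
Qed.

Lemma boxint_opp u c : continuous u -> boxint c (fun p => u (- p.1, - p.2)) = boxint c u.
Proof.
move=> cu; rewrite !boxintE /=.
rewrite (@oint_opp _ (fun x => oint (- c) c (fun y => u (x, - y)))) ?opprK; last by cont.
apply: eq_oint => x.
by rewrite (@oint_opp _ (fun y => u (x, y))) ?opprK//; cont.
Qed.

Lemma oint_even (f : R -> R) c : continuous f -> oint (- c) c f = oint 0 c (fun t => f t + f (- t)).
Proof.
move=> cf; rewrite ointD; [|by cont|by cont].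
by rewrite (oint_opp _ _ cf) oppr0 (oint_cat 0) addrC.
Qed.

Lemma boxint_quadrants u c : continuous u ->
  boxint c u = oint 0 c (fun x => oint 0 c (fun y => u (x, y))) +
           oint 0 c (fun x => oint 0 c (fun y => u (x, - y))) +
           oint 0 c (fun x => oint 0 c (fun y => u (- x, y))) +
           oint 0 c (fun x => oint 0 c (fun y => u (- x, - y))).
Proof.
move=> cu; rewrite !boxintE oint_even; last by cont.
rewrite -ointD; [|by cont|by cont]; rewrite -ointD; [|by cont|by cont].
rewrite -ointD; [|by cont|by cont].
apply: eq_oint => x; rewrite !oint_even; [|by cont|by cont].
rewrite ointD; [|by cont|by cont]; rewrite ointD; [|by cont|by cont].
by rewrite addrA.
Qed.

Lemma parts1 (F f G g : R -> R) c : continuous f -> continuous g ->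
  (forall x, hasD F x (f x)) -> (forall x, hasD G x (g x)) -> G c = 0 -> G (- c) = 0 ->
  oint (- c) c (fun t => F t * g t) = - oint (- c) c (fun t => f t * G t).
Proof. by move=> cf cg dF dG Gc GNc; rewrite (oint_parts _ _ cf cg dF dG) Gc GNc; ring. Qed.

Lemma parts_x K Kx phi b c : 0 <= b -> b < c -> continuous K -> continuous Kx ->
  (forall x y, hasD (fun t => K (t, y)) x (Kx (x, y))) ->
  Cinf phi -> supp_in b phi ->
  boxint c (fun p => K p * pd false phi p) = - boxint c (fun p => Kx p * phi p).
Proof.
move=> b0 bc cK cKx dK sphi bphi; rewrite !boxintE.
have cphi := smooth_cont sphi; have cdphi := smooth_cont (smooth_pd false sphi).
rewrite oint_Fubini; last by cont.
rewrite [in RHS]oint_Fubini; last by cont.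
rewrite -ointN; last by cont.
apply: eq_oint => y; apply: (@parts1 (fun x => K (x, y)) (fun x => Kx (x, y))
  (fun x => phi (x, y)) (fun x => pd false phi (x, y))).
- by cont.
- by cont.
- by move=> x; exact: dK.
- by move=> x; exact: smooth_hasDx.
- by apply: bphi; left; rewrite /= gtr0_norm//; lra.
- by apply: bphi; left; rewrite /= normrN gtr0_norm//; lra.
Qed.

Lemma parts_y K Ky phi b c : 0 <= b -> b < c -> continuous K -> continuous Ky ->
  (forall x y, hasD (fun t => K (x, t)) y (Ky (x, y))) ->
  Cinf phi -> supp_in b phi ->
  boxint c (fun p => K p * pd true phi p) = - boxint c (fun p => Ky p * phi p).
Proof.
move=> b0 bc cK cKy dK sphi bphi; rewrite !boxintE.
have cphi := smooth_cont sphi; have cdphi := smooth_cont (smooth_pd true sphi).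
rewrite -ointN; last by cont.
apply: eq_oint => x; apply: (@parts1 (fun y => K (x, y)) (fun y => Ky (x, y))
  (fun y => phi (x, y)) (fun y => pd true phi (x, y))).
- by cont.
- by cont.
- by move=> y; exact: dK.
- by move=> y; exact: smooth_hasDy.
- by apply: bphi; right; rewrite /= gtr0_norm//; lra.
- by apply: bphi; right; rewrite /= normrN gtr0_norm//; lra.
Qed.

Lemma lap_parts1 H Hx Hy phi b c : 0 <= b -> b < c ->
  continuous H -> continuous Hx -> continuous Hy ->
  (forall x y, hasD (fun t => H (t, y)) x (Hx (x, y))) ->
  (forall x y, hasD (fun t => H (x, t)) y (Hy (x, y))) ->
  Cinf phi -> supp_in b phi ->
  boxint c (fun p => H p * lap phi p) =
  - boxint c (fun p => Hx p * pd false phi p + Hy p * pd true phi p).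
Proof.
move=> b0 bc cH cHx cHy dx dy sphi bphi.
have sx := smooth_pd false sphi; have sy := smooth_pd true sphi.
have cx := smooth_cont sx; have cy := smooth_cont sy.
have cxx := smooth_cont (smooth_pd false sx); have cyy := smooth_cont (smooth_pd true sy).
have bx := supp_pd false bphi; have by_ := supp_pd true bphi.
transitivity (boxint c (fun p => H p * pd false (pd false phi) p + H p * pd true (pd true phi) p)).
  by apply: eq_boxint => p; rewrite /lap mulrDr.
rewrite boxintD; [|by cont|by cont]; rewrite [in RHS]boxintD; [|by cont|by cont].
by rewrite (parts_x b0 bc cH cHx dx sx bx) (parts_y b0 bc cH cHy dy sy by_) opprD.
Qed.

(** Green's formula for a kernel K that need not be smooth: its derivatives are
    named one by one, and only the pure second ones are used. *)
Lemma lap_parts2 K Kx Ky Kxx Kyy phi b c : 0 <= b -> b < c ->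
  continuous K -> continuous Kx -> continuous Ky -> continuous Kxx -> continuous Kyy ->
  (forall x y, hasD (fun t => K (t, y)) x (Kx (x, y))) ->
  (forall x y, hasD (fun t => K (x, t)) y (Ky (x, y))) ->
  (forall x y, hasD (fun t => Kx (t, y)) x (Kxx (x, y))) ->
  (forall x y, hasD (fun t => Ky (x, t)) y (Kyy (x, y))) ->
  Cinf phi -> supp_in b phi ->
  boxint c (fun p => K p * lap phi p) = boxint c (fun p => (Kxx p + Kyy p) * phi p).
Proof.
move=> b0 bc cK cKx cKy cKxx cKyy dx dy dxx dyy sphi bphi.
have cphi := smooth_cont sphi.
have cx := smooth_cont (smooth_pd false sphi); have cy := smooth_cont (smooth_pd true sphi).
rewrite (lap_parts1 b0 bc cK cKx cKy dx dy sphi bphi) boxintD; [|by cont|by cont].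
rewrite (parts_x b0 bc cKx cKxx dxx sphi bphi) (parts_y b0 bc cKy cKyy dyy sphi bphi).
rewrite opprD !opprK -boxintD; [|by cont|by cont].
by apply: eq_boxint => p; rewrite mulrDl.
Qed.

Lemma supp_bounded u b : continuous u -> supp_in b u -> exists2 M, 0 <= M & forall p, `|u p| <= M.
Proof.
move=> cu bu; pose K : set (R * R) := `[- `|b|, `|b|] `*` `[- `|b|, `|b|].
have cK : compact K by apply: compact_setX; exact: segment_compact.
have cuK : compact (u @` K).
  by apply: continuous_compact => //; exact: continuous_subspaceT.
have := compact_bounded cuK; move=> [M [_ /(_ (M + 1))]]; rewrite ltrDl ltr01 => /(_ isT) HM.
exists (Num.max 0 (M + 1)); first by rewrite le_max lexx.
move=> p; rewrite le_max; apply/orP.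
have [h|h] := pselect (b < `|p.1| \/ b < `|p.2|).
  by left; rewrite bu// normr0.
right; apply: HM; exists p => //; rewrite /K /= !in_itv /= -!ler_norml.
have hb := ler_norm b.
split; rewrite leNgt; apply/negP => h'; apply: h.
  by left; exact: le_lt_trans h'.
by right; exact: le_lt_trans h'.
Qed.
End PlaneIntegral.

(** * The biharmonic fundamental solution as an average of plane waves *)
Section Biharmonic.
Context {R : realType}.
Implicit Types (x y t u w : R) (phi : R * R -> R).

Definition xlnx t : R := t * ln t.

Lemma xlnx_npos t : t <= 0 -> xlnx t = 0.
Proof. by move=> t0; rewrite /xlnx ln0// mulr0. Qed.

Lemma xlnxM x y : 0 <= x -> 0 <= y -> xlnx (x * y) = x * xlnx y + y * xlnx x.
Proof.
move=> x0 y0; rewrite /xlnx; have [->|xn] := eqVneq x 0; first by rewrite !mul0r mulr0 addr0.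
have [->|yn] := eqVneq y 0; first by rewrite !(mul0r, mulr0) addr0.
by rewrite lnM ?posrE ?lt0r ?xn ?yn//; ring.
Qed.

Lemma der_xlnx t : 0 < t -> hasD xlnx t (ln t + 1).
Proof.
move=> t0; apply: der_eq.
  by apply: (derM (f := fun t => t) (g := @ln R)); [exact: derId|exact: der_ln].
by rewrite mul1r mulfV ?lt0r_neq0.
Qed.

(** ln t <= t applied to t = 1 / sqrt y. *)
Lemma xlnx_bound y : y < 1 -> `|xlnx y| <= 2 * Num.sqrt y.
Proof.
move=> y1; have [y0|y0] := leP y 0.
  by rewrite xlnx_npos// normr0 mulr_ge0// sqrtr_ge0.
set s := Num.sqrt y; have s0 : 0 < s by rewrite sqrtr_gt0.
have yE : y = s ^+ 2 by rewrite sqr_sqrtr// ltW.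
have h1 : ln s^-1 < s^-1 by apply: ln_sublinear; rewrite invr_gt0.
have h2 : ln y < 0 by apply: ln_lt0; rewrite y0.
move: h1 h2; rewrite lnV ?posrE// /xlnx yE lnXn// mulr2n => h1 h2.
rewrite normrM (ger0_norm (sqr_ge0 s)) ltr0_norm//.
have h3 : s * (- ln s) < 1 by rewrite -(@mulfV _ s) ?lt0r_neq0// ltr_pM2l.
by nra.
Qed.

(** For t <= 0 this follows from [xlnx_bound], where ln vanishes by convention on
    the negative half line. *)
Lemma xlnx_cont : continuous xlnx.
Proof.
move=> t; have [t0|t0] := leP t 0; last first.
  have [dt _] := der_xlnx t0.
  by apply/differentiable_continuous/derivable1_diffP.
rewrite /continuous_at xlnx_npos//.
have sq : (fun y => 2 * Num.sqrt y) y @[y --> t] --> 0.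
  have -> : 0 = 2 * Num.sqrt t by rewrite ler0_sqrtr// mulr0.
  by apply: cvgMr; exact: sqrt_continuous.
apply/cvgrPdist_le => e e0; move/cvgrPdist_le/(_ e e0): sq => sq.
near=> y; rewrite sub0r normrN; apply: le_trans (xlnx_bound _) _.
  by near: y; apply: lt_nbhsl; lra.
apply: le_trans (ler_norm _) _; rewrite -normrN -sub0r.
by near: y.
Unshelve. all: by end_near. Qed.

Lemma oint_period (g : R -> R) t : continuous g -> (forall x, g (x + 2 * pi) = g x) ->
  oint 0 (2 * pi) (fun x => g (x - t)) = oint 0 (2 * pi) g.
Proof.
move=> cg gp; rewrite oint_shift// add0r.
have := @der_cst R (fun c => oint c (c + 2 * pi) g) (- t) 0.
rewrite add0r addrC => -> // x.
have dg y : hasD (prim g) y (g y) by exact: prim_derive.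
apply: (@der_eq _ _ _ (g (x + 2 * pi) - g x)); last by rewrite gp subrr.
under eq_fun do rewrite ointE.
by apply: der_eq; [der|cbv beta; ring].
Qed.

Lemma cos_period x : cos (x + 2 * pi) = cos x :> R.
Proof. by rewrite mulr_natl cosD2pi. Qed.

Lemma polar x y : exists r t, [/\ 0 <= r, x = r * cos t & y = r * sin t].
Proof.
pose r := Num.sqrt (x ^+ 2 + y ^+ 2).
have rr : r ^+ 2 = x ^+ 2 + y ^+ 2 by rewrite sqr_sqrtr// addr_ge0 ?sqr_ge0.
have r0 : 0 <= r by exact: sqrtr_ge0.
have [rz|rn] := eqVneq r 0.
  exists 0, 0; rewrite !mul0r; split => //.
    by apply/eqP; rewrite -sqrf_eq0; apply/eqP; move: rr; rewrite rz; nra.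
  by apply/eqP; rewrite -sqrf_eq0; apply/eqP; move: rr; rewrite rz; nra.
have rp : 0 < r by rewrite lt0r rn.
have c1 : -1 <= x / r <= 1 by rewrite ler_pdivlMr// ler_pdivrMr//; nra.
have sE : Num.sqrt (1 - (x / r) ^+ 2) = `|y| / r.
  have -> : 1 - (x / r) ^+ 2 = (y / r) ^+ 2.
    have r2 : r ^+ 2 != 0 by rewrite expf_neq0.
    apply: (mulIf r2); rewrite mulrBl !expr_div_n !divfK// rr; ring.
  by rewrite sqrtr_sqr normrM normfV (ger0_norm r0).
have cE : cos (acos (x / r)) = x / r by apply: acosK; rewrite in_itv.
have [y0|y0] := leP 0 y.
  exists r, (acos (x / r)); split => //; first by rewrite cE mulrC divfK.
  by rewrite sin_acos// sE ger0_norm// mulrC divfK.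
exists r, (- acos (x / r)); split => //; first by rewrite cosN cE mulrC divfK.
by rewrite sinN sin_acos// sE ltr0_norm// mulNr opprK mulrC divfK.
Qed.

Lemma oint_cos2 : oint 0 (2 * pi) (fun t => cos t ^+ 2) = pi :> R.
Proof.
rewrite (@oint_FTC _ _ (fun t => (t + sin t * cos t) / 2)).
- have -> : sin (2 * pi) = 0 :> R by rewrite mulr_natl sin2pi.
  by rewrite sin0; field.
- by cont.
move=> x; apply: der_eq; first by der.
by cbv beta; have := cos2Dsin2 x; lra.
Qed.

(** The average over all directions of the plane waves of profile L. *)
Definition rad (L : R -> R) (p : R * R) : R :=
  oint 0 (2 * pi) (fun t => L (p.1 * cos t + p.2 * sin t)).

Lemma cont_rad L : continuous L -> continuous (rad L).
Proof. by move=> cL; rewrite /rad; cont. Qed.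

(** At the point of polar coordinates (r, t) the phase is r cos (a - t), and a
    full period can be shifted. *)
Lemma rad_polar L r t : continuous L ->
  rad L (r * cos t, r * sin t) = oint 0 (2 * pi) (fun x => L (r * cos x)).
Proof.
move=> cL; rewrite -(@oint_period (fun x => L (r * cos x)) t); [|by cont|].
  by apply: eq_oint => x /=; rewrite cosB; congr L; ring.
by move=> x; rewrite cos_period.
Qed.

(** The profile s^2 ln |s|, written through xlnx so that its continuity at 0 and
    its behaviour under scaling are those of xlnx. *)
Definition halfxlnx s : R := 2^-1 * xlnx (s ^+ 2).

Lemma halfxlnx_cont : continuous halfxlnx.
Proof. by have cx := xlnx_cont; rewrite /halfxlnx; cont. Qed.

(** The logarithm of r^2 (cos t)^2 splits into ln r^2, whose coefficient
    integrates to pi r^2 / 2, and a term that is a constant times r^2. *)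
Lemma rad_halfxlnx : exists C, forall p : R * R,
  rad halfxlnx p = pi * (2^-1 * xlnx (p.1 ^+ 2 + p.2 ^+ 2)) + C * (p.1 ^+ 2 + p.2 ^+ 2).
Proof.
exists (oint 0 (2 * pi) (fun t => halfxlnx (cos t))) => -[x y].
have ch := halfxlnx_cont.
have [r [t [r0 -> ->]]] := polar x y; rewrite rad_polar//=.
have -> : (r * cos t) ^+ 2 + (r * sin t) ^+ 2 = r ^+ 2.
  by rewrite !exprMn -mulrDr cos2Dsin2 mulr1.
have -> : pi * (2^-1 * xlnx (r ^+ 2)) =
    oint 0 (2 * pi) (fun t => cos t ^+ 2 * (2^-1 * xlnx (r ^+ 2))).
  by rewrite ointZr ?oint_cos2//; cont.
rewrite -ointZr; last by cont.
rewrite -ointD; [|by cont|by cont].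
apply: eq_oint => s; rewrite /halfxlnx exprMn xlnxM ?sqr_ge0//; ring.
Qed.

(** With q = |x|^2 + d^2, the function q ln q / 2 regularises the biharmonic
    kernel; its Laplacian 2 ln q + 4 - 2 d^2 / q has gradient kap (|x|^2) x. As d
    tends to 0, |x|^2 kap (|x|^2) tends to 4 away from the origin. *)
Section Quadrant.
Variables (d c : R).
Hypotheses (d0 : 0 < d) (c0 : 0 < c).

Let kap t : R := 4 / (t + d ^+ 2) + 4 * d ^+ 2 / (t + d ^+ 2) ^+ 2.

Let den_gt0 x : 0 < x ^+ 2 + d ^+ 2.
Proof. by rewrite ltr_wpDl ?sqr_ge0// exprn_gt0. Qed.

(** The mass of the error made by replacing t kap t by its limit 4. *)
Lemma oint_poisson : oint 0 c (fun x => d ^+ 2 / (x ^+ 2 + d ^+ 2)) <= 2 * d.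
Proof.
have dn : d != 0 by exact: lt0r_neq0.
rewrite (@oint_FTC _ _ (fun x => d * atan (x / d))).
- rewrite mul0r atan0 mulr0 subr0 mulrC; apply: ler_wpM2r; first exact: ltW.
  by apply: le_trans (ltW (atan_ltpi2 _)) _; have := @pihalf_lt2 R; lra.
- by cont => x; exact: lt0r_neq0 (den_gt0 x).
- move=> x; apply: der_eq; first by der.
  have := lt0r_neq0 (den_gt0 x) => h; cbv beta.
  have h2 : 1 + (x / d) ^+ 2 = (x ^+ 2 + d ^+ 2) / d ^+ 2 by field.
  by rewrite h2; field; rewrite h dn.
Qed.

(** Since t kap t = 4 - 4 (d^2 / (t + d^2))^2, the integral is close to 4 int_0^c
    g' = - 4 g 0, with an error of order d. *)
Lemma path_estimate (g g' : R -> R) N a : 1 <= a -> continuous g' ->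
  (forall x, hasD g x (g' x)) -> (forall x, `|g' x| <= N) -> g c = 0 ->
  `|oint 0 c (fun x => a * x ^+ 2 * kap (a * x ^+ 2) * g' x) + 4 * g 0| <= 8 * N * d.
Proof.
move=> a1 cg' dg gN gc.
have N0 : 0 <= N by exact: le_trans (normr_ge0 _) (gN 0).
have ax x : 0 < a * x ^+ 2 + d ^+ 2.
  by have := den_gt0 x; have := sqr_ge0 x; nra.
have axn x : a * x ^+ 2 + d ^+ 2 != 0 by exact: lt0r_neq0.
have ck : continuous (fun x => kap (a * x ^+ 2)).
  by rewrite /kap; cont => x; rewrite ?expf_neq0//.
pose e x := 4 * (d ^+ 2 / (a * x ^+ 2 + d ^+ 2)) ^+ 2.
have ce : continuous e by rewrite /e; cont.
have -> : 4 * g 0 = - oint 0 c (fun x => 4 * g' x).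
  by rewrite ointZ// (oint_FTC _ _ cg' dg) gc; ring.
rewrite -ointB; [|by cont|by cont].
have -> : oint 0 c (fun x => a * x ^+ 2 * kap (a * x ^+ 2) * g' x - 4 * g' x) =
          - oint 0 c (fun x => e x * g' x).
  rewrite -ointN; last by cont.
  by apply: eq_oint => x; rewrite /kap /e; field.
rewrite normrN.
have : `|oint 0 c (fun x => e x * g' x)| <= oint 0 c (fun x => 4 * N * (d ^+ 2 / (x ^+ 2 + d ^+ 2))).
  have cq : continuous (fun x => 4 * N * (d ^+ 2 / (x ^+ 2 + d ^+ 2))).
    by cont => x; exact: lt0r_neq0 (den_gt0 x).
  have H x : `|e x * g' x| <= 4 * N * (d ^+ 2 / (x ^+ 2 + d ^+ 2)).
    have h1 : d ^+ 2 / (a * x ^+ 2 + d ^+ 2) <= d ^+ 2 / (x ^+ 2 + d ^+ 2).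
      rewrite ler_pM2l ?exprn_gt0// lef_pV2 ?posrE//.
      by have := sqr_ge0 x; nra.
    have h2 : 0 <= d ^+ 2 / (a * x ^+ 2 + d ^+ 2) by rewrite divr_ge0 ?sqr_ge0// ltW.
    have h3 : d ^+ 2 / (a * x ^+ 2 + d ^+ 2) <= 1.
      by rewrite ler_pdivrMr// mul1r; have := sqr_ge0 x; nra.
    have h4 : 0 <= e x <= 4 * (d ^+ 2 / (x ^+ 2 + d ^+ 2)).
      rewrite /e; move: h1 h2 h3; set q := _ / _; set q' := _ / _ => *; nra.
    rewrite normrM ger0_norm; last by case/andP: h4.
    have := gN x; have := normr_ge0 (g' x); move: h4; set q' := _ / _; set ee := e x.
    by move=> /andP[? ?] ? ?; nra.
  rewrite ler_norml -ointN//; apply/andP; split.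
    apply: oint_le; [by cont|by cont|exact: ltW|].
    by move=> x _; have := H x; rewrite ler_norml => /andP[].
  apply: oint_le; [by cont|by cont|exact: ltW|].
  by move=> x _; have := H x; rewrite ler_norml => /andP[].
move=> h; apply: le_trans h _; rewrite ointZ; last first.
  by cont => x; exact: lt0r_neq0 (den_gt0 x).
by have := oint_poisson; set q := oint _ _ _; nra.
Qed.

(** In the coordinates (x, x u) and (x u, x) the radial derivative becomes the
    derivative along a ray, to which [path_estimate] applies; the two families of
    rays together give - 8 f 0 0 int_0^1 du / (1 + u^2) = - 2 pi f 0 0. *)
Lemma quadrant_estimate (f fx fy : R -> R -> R) M :
  (forall x y, hasD (fun t => f t y) x (fx x y)) ->
  (forall x y, hasD (fun t => f x t) y (fy x y)) ->
  continuous (fun p : R * R => fx p.1 p.2) ->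
  continuous (fun p : R * R => fy p.1 p.2) ->
  (forall x y, `|fx x y| <= M) -> (forall x y, `|fy x y| <= M) ->
  (forall t, f c t = 0) -> (forall t, f t c = 0) ->
  `|oint 0 c (fun x => oint 0 c (fun y => kap (x ^+ 2 + y ^+ 2) * (x * fx x y + y * fy x y)))
    + 2 * pi * f 0 0| <= 32 * M * d.
Proof.
move=> dx dy cfx cfy Mx My fc1 fc2.
have M0 : 0 <= M by exact: le_trans (normr_ge0 _) (Mx 0 0).
have pos2 x y : 0 < x ^+ 2 + y ^+ 2 + d ^+ 2.
  by rewrite -addrA ltr_wpDl ?sqr_ge0.
have neq2 x y : x ^+ 2 + y ^+ 2 + d ^+ 2 != 0 by exact: lt0r_neq0.
have ck : continuous (fun p : R * R => kap (p.1 ^+ 2 + p.2 ^+ 2)).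
  by rewrite /kap; cont => p; rewrite ?expf_neq0//; exact: neq2.
have posu x u : 0 < (1 + u ^+ 2) * x ^+ 2 + d ^+ 2.
  by have := den_gt0 x; have := sqr_ge0 x; have := sqr_ge0 u; nra.
have nequ x u : (1 + u ^+ 2) * x ^+ 2 + d ^+ 2 != 0 by exact: lt0r_neq0.
have cku : continuous (fun p : R * R => kap ((1 + p.2 ^+ 2) * p.1 ^+ 2)).
  by rewrite /kap; cont => p; rewrite ?expf_neq0//; exact: nequ.
have c1u : continuous (fun u : R => (1 + u ^+ 2)^-1) by cont; exact: add1sqr_neq0.
have ck1 x : continuous (fun u : R => kap (x ^+ 2 + (x * u) ^+ 2)).
  by rewrite /kap; cont => u; rewrite ?expf_neq0//; exact: neq2.
have ck2 x : continuous (fun u : R => kap ((x * u) ^+ 2 + x ^+ 2)).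
  by rewrite /kap; cont => u; rewrite ?expf_neq0//; exact: neq2.
rewrite (@oint_Duffy _ (fun x y => kap (x ^+ 2 + y ^+ 2) * (x * fx x y + y * fy x y))); last first.
  by cont.
pose ga u x := fx x (x * u) + fy x (x * u) * u.
pose gb u x := fx (x * u) x * u + fy (x * u) x.
have cga : continuous (fun p : R * R => ga p.1 p.2) by rewrite /ga; cont.
have cgb : continuous (fun p : R * R => gb p.1 p.2) by rewrite /gb; cont.
pose Pa u := oint 0 c (fun x => (1 + u ^+ 2) * x ^+ 2 * kap ((1 + u ^+ 2) * x ^+ 2) * ga u x).
pose Pb u := oint 0 c (fun x => (1 + u ^+ 2) * x ^+ 2 * kap ((1 + u ^+ 2) * x ^+ 2) * gb u x).
have cku1 u : continuous (fun x : R => kap ((1 + u ^+ 2) * x ^+ 2)).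
  by rewrite /kap; cont => x; rewrite ?expf_neq0//; exact: nequ.
have cku2 : continuous (fun p : R * R => kap ((1 + p.1 ^+ 2) * p.2 ^+ 2)).
  by rewrite /kap; cont => p; rewrite ?expf_neq0//; exact: nequ.
have cPa : continuous Pa by rewrite /Pa; cont.
have cPb : continuous Pb by rewrite /Pb; cont.
pose W x u := (1 + u ^+ 2)^-1 *
  ((1 + u ^+ 2) * x ^+ 2 * kap ((1 + u ^+ 2) * x ^+ 2) * (ga u x + gb u x)).
have cW : continuous (fun p : R * R => W p.1 p.2).
  by rewrite /W; cont => p; exact: add1sqr_neq0.
have -> : oint 0 c (fun x =>
     x * oint 0 1 (fun u => kap (x ^+ 2 + (x * u) ^+ 2) * (x * fx x (x * u) + x * u * fy x (x * u)))
   + x * oint 0 1 (fun u => kap ((x * u) ^+ 2 + x ^+ 2) * (x * u * fx (x * u) x + x * fy (x * u) x)))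
   = oint 0 c (fun x => oint 0 1 (W x)).
  apply: eq_oint => x; rewrite -!ointZ; [|by cont|by cont].
  rewrite -ointD; [|by cont|by cont]; apply: eq_oint => u.
  rewrite /W /ga /gb.
  have -> : x ^+ 2 + (x * u) ^+ 2 = (1 + u ^+ 2) * x ^+ 2 by ring.
  have -> : (x * u) ^+ 2 + x ^+ 2 = (1 + u ^+ 2) * x ^+ 2 by ring.
  by field; exact: add1sqr_neq0.
rewrite oint_Fubini//.
have -> : oint 0 1 (fun u => oint 0 c (fun x => W x u)) =
          oint 0 1 (fun u => (1 + u ^+ 2)^-1 * (Pa u + Pb u)).
  apply: eq_oint => u; rewrite /W ointZ; last by cont.
  rewrite -ointD; [|by cont|by cont]; congr (_ * _); apply: eq_oint => x; ring.
have -> : 2 * pi * f 0 0 = oint 0 1 (fun u => (1 + u ^+ 2)^-1 * (8 * f 0 0)).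
  by rewrite ointZr// oint_atan; field.
rewrite -ointD; [|by cont|by cont].
have -> : 32 * M * d = 32 * M * d * (1 - 0) by ring.
apply: oint_bound; [by cont|exact: ler01|move=> u /andP[u0 u1]].
rewrite -mulrDr normrM.
have ha : `|Pa u + 4 * f 0 0| <= 8 * (2 * M) * d.
  have := @path_estimate (fun x => f x (x * u)) (ga u) (2 * M) (1 + u ^+ 2).
  rewrite mul0r; apply.
  - by rewrite lerDl sqr_ge0.
  - by rewrite /ga; cont.
  - move=> x; have d1 : hasD (fun x => x * u) x u by apply: der_eq; [der|cbv beta; ring].
    apply: der_eq (der_chain dx dy cfx cfy _ _ (derId x) d1) _; [by cont|by cont|].
    by rewrite /ga; ring.
  - move=> x; rewrite /ga; apply: le_trans (ler_normD _ _) _; rewrite normrM (ger0_norm u0).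
    by have := Mx x (x * u); have := My x (x * u); have := normr_ge0 (fy x (x * u)); nra.
  - exact: fc1.
have hb : `|Pb u + 4 * f 0 0| <= 8 * (2 * M) * d.
  have := @path_estimate (fun x => f (x * u) x) (gb u) (2 * M) (1 + u ^+ 2).
  rewrite mul0r; apply.
  - by rewrite lerDl sqr_ge0.
  - by rewrite /gb; cont.
  - move=> x; have d1 : hasD (fun x => x * u) x u by apply: der_eq; [der|cbv beta; ring].
    apply: der_eq (der_chain dx dy cfx cfy _ _ d1 (derId x)) _; [by cont|by cont|].
    by rewrite /gb; ring.
  - move=> x; rewrite /gb; apply: le_trans (ler_normD _ _) _; rewrite normrM (ger0_norm u0).
    by have := Mx (x * u) x; have := My (x * u) x; have := normr_ge0 (fx (x * u) x); nra.
  - exact: fc2.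
have hi : `|(1 + u ^+ 2)^-1| <= 1.
  by rewrite ger0_norm ?invr_ge0 ?invf_le1 ?lerDl ?sqr_ge0 ?ltW ?add1sqr_gt0.
have hs : `|Pa u + Pb u + 8 * f 0 0| <= 32 * M * d.
  have -> : Pa u + Pb u + 8 * f 0 0 = (Pa u + 4 * f 0 0) + (Pb u + 4 * f 0 0) by ring.
  by apply: le_trans (ler_normD _ _) _; lra.
apply: le_trans (ler_wpM2r (normr_ge0 _) hi) _; by rewrite mul1r.
Qed.
End Quadrant.

Lemma pos_limit_le (G : R -> R) : continuous G -> (forall t, 0 < t -> G t <= 0) -> G 0 <= 0.
Proof.
move=> cG G0; rewrite leNgt; apply/negP => Gp.
have /cvgrPdist_lt/(_ _ Gp)[e /= e0 He] := cG 0.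
have e2 : 0 < e / 2 by rewrite divr_gt0.
have := He (e / 2); rewrite /= sub0r normrN gtr0_norm// => /(_ ltac:(lra)).
have := G0 _ e2; move=> h; rewrite ger0_norm; lra.
Qed.

(** Three integrations by parts move all derivatives but one to the smooth kernel
    regularised by d; each of the four quadrants then contributes 2 pi phi (0, 0).
    *)
Lemma biharmonic_estimate phi b c : 0 <= b -> b < c -> Cinf phi -> supp_in b phi ->
  exists M, forall d, 0 < d ->
  `|boxint c (fun p => 2^-1 * xlnx (p.1 ^+ 2 + p.2 ^+ 2 + d ^+ 2) * lap (lap phi) p)
    - 8 * pi * phi (0, 0)| <= 128 * M * d.
Proof.
move=> b0 bc sphi bphi.
have c0 : 0 < c by lra.
have cphi := smooth_cont sphi.
have sx := smooth_pd false sphi; have sy := smooth_pd true sphi.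
have cx := smooth_cont sx; have cy := smooth_cont sy.
have [Mx Mx0 HMx] := supp_bounded cx (supp_pd false bphi).
have [My My0 HMy] := supp_bounded cy (supp_pd true bphi).
exists (Mx + My) => d d0.
pose q (p : R * R) := p.1 ^+ 2 + p.2 ^+ 2 + d ^+ 2.
have cq : continuous q by rewrite /q; cont.
have q0 p : 0 < q p by rewrite /q ltr_wpDl ?exprn_gt0// addr_ge0 ?sqr_ge0.
have qn p : q p != 0 by exact: lt0r_neq0.
have cl : continuous (fun p => ln (q p)).
  move=> p; apply: (@continuous_comp _ _ _ q (@ln R)); first exact: cq.
  exact: continuous_ln.
have cqi : continuous (fun p => (q p)^-1) by cont.
have dqx x y : hasD (fun t => q (t, y)) x (2 * x) by apply: der_eq; [rewrite /q /=; der|cbv beta; ring].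
have dqy x y : hasD (fun t => q (x, t)) y (2 * y) by apply: der_eq; [rewrite /q /=; der|cbv beta; ring].
have dlx x y : hasD (fun t => ln (q (t, y))) x (2 * x / q (x, y)).
  apply: der_eq; first by apply: (derComp (f := @ln R)); [exact: der_ln|exact: dqx].
  by rewrite mulrC.
have dly x y : hasD (fun t => ln (q (x, t))) y (2 * y / q (x, y)).
  apply: der_eq; first by apply: (derComp (f := @ln R)); [exact: der_ln|exact: dqy].
  by rewrite mulrC.
have dix x y : hasD (fun t => (q (t, y))^-1) x (- (2 * x) / q (x, y) ^+ 2).
  by apply: derV; [exact: qn|exact: dqx].
have diy x y : hasD (fun t => (q (x, t))^-1) y (- (2 * y) / q (x, y) ^+ 2).
  by apply: derV; [exact: qn|exact: dqy].
have dxx x y : hasD (fun t => xlnx (q (t, y))) x ((ln (q (x, y)) + 1) * (2 * x)).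
  by apply: (derComp (f := xlnx) (g := fun t => q (t, y))); [exact: der_xlnx|exact: dqx].
have dxy x y : hasD (fun t => xlnx (q (x, t))) y ((ln (q (x, y)) + 1) * (2 * y)).
  by apply: (derComp (f := xlnx) (g := fun t => q (x, t))); [exact: der_xlnx|exact: dqy].
have cxq : continuous (fun p => xlnx (q p)) by have := xlnx_cont => ?; cont.
pose kap t := 4 / (t + d ^+ 2) + 4 * d ^+ 2 / (t + d ^+ 2) ^+ 2.
pose H p := 2 * ln (q p) + 4 - 2 * d ^+ 2 * (q p)^-1.
pose K p := 2^-1 * xlnx (q p).
pose Kx p := p.1 * (ln (q p) + 1); pose Ky p := p.2 * (ln (q p) + 1).
pose Kxx p := ln (q p) + 1 + 2 * p.1 ^+ 2 * (q p)^-1.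
pose Kyy p := ln (q p) + 1 + 2 * p.2 ^+ 2 * (q p)^-1.
have cK : continuous K by rewrite /K; cont.
have cKx : continuous Kx by rewrite /Kx; cont.
have cKy : continuous Ky by rewrite /Ky; cont.
have cKxx : continuous Kxx by rewrite /Kxx; cont.
have cKyy : continuous Kyy by rewrite /Kyy; cont.
have dK1 x y : hasD (fun t => K (t, y)) x (Kx (x, y)).
  by have h1 := dxx x y; have h2 := dlx x y; have h3 := dix x y;
    apply: der_eq; [rewrite /K; der|rewrite /Kx /=; cbv beta; field].
have dK2 x y : hasD (fun t => K (x, t)) y (Ky (x, y)).
  by have h1 := dxy x y; have h2 := dly x y; have h3 := diy x y;
    apply: der_eq; [rewrite /K; der|rewrite /Ky /=; cbv beta; field].
have dK11 x y : hasD (fun t => Kx (t, y)) x (Kxx (x, y)).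
  by have h1 := dxx x y; have h2 := dlx x y; have h3 := dix x y;
    apply: der_eq; [rewrite /Kx /=; der|rewrite /Kxx /=; cbv beta; field].
have dK22 x y : hasD (fun t => Ky (x, t)) y (Kyy (x, y)).
  by have h1 := dxy x y; have h2 := dly x y; have h3 := diy x y;
    apply: der_eq; [rewrite /Ky /=; der|rewrite /Kyy /=; cbv beta; field].
rewrite (lap_parts2 b0 bc cK cKx cKy cKxx cKyy dK1 dK2 dK11 dK22
  (smooth_lap sphi) (supp_lap bphi)).
have -> : boxint c (fun p => (Kxx p + Kyy p) * lap phi p) = boxint c (fun p => H p * lap phi p).
  apply: eq_boxint => p; congr (_ * _); rewrite /H /Kxx /Kyy.
  have -> : 2 * d ^+ 2 = 2 * (q p - p.1 ^+ 2 - p.2 ^+ 2) by rewrite /q; ring.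
  by field.
have ckap : continuous (fun p : R * R => kap (p.1 ^+ 2 + p.2 ^+ 2)).
  by rewrite /kap; cont => p; rewrite ?expf_neq0//; exact: qn p.
pose Hx p := p.1 * kap (p.1 ^+ 2 + p.2 ^+ 2); pose Hy p := p.2 * kap (p.1 ^+ 2 + p.2 ^+ 2).
have cH : continuous H by rewrite /H; cont.
have cHx : continuous Hx by rewrite /Hx; cont.
have cHy : continuous Hy by rewrite /Hy; cont.
have dH1 x y : hasD (fun t => H (t, y)) x (Hx (x, y)).
  have h1 := dxx x y; have h2 := dlx x y; have h3 := dix x y;
  apply: der_eq; first by rewrite /H; der.
  cbv beta; rewrite /Hx /kap /=; have := qn (x, y); rewrite /q /= => h.
  by field.
have dH2 x y : hasD (fun t => H (x, t)) y (Hy (x, y)).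
  have h1 := dxy x y; have h2 := dly x y; have h3 := diy x y;
  apply: der_eq; first by rewrite /H; der.
  cbv beta; rewrite /Hy /kap /=; have := qn (x, y); rewrite /q /= => h.
  by field.
rewrite (lap_parts1 b0 bc cH cHx cHy dH1 dH2 sphi bphi).
pose E p := kap (p.1 ^+ 2 + p.2 ^+ 2) * (p.1 * pd false phi p + p.2 * pd true phi p).
have cE : continuous E by rewrite /E; cont.
rewrite (_ : boxint c _ = boxint c E); last by apply: eq_boxint => p; rewrite /E /Hx /Hy; ring.
rewrite boxint_quadrants//.
have HQ (s1 s2 : R) : s1 ^+ 2 = 1 -> s2 ^+ 2 = 1 -> `|s1| = 1 -> `|s2| = 1 ->
    (forall y, phi (s1 * c, y) = 0) -> (forall x, phi (x, s2 * c) = 0) ->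
    `|oint 0 c (fun x => oint 0 c (fun y => E (s1 * x, s2 * y))) + 2 * pi * phi (0, 0)|
      <= 32 * (Mx + My) * d.
  move=> s11 s21 s1n s2n z1 z2.
  have := @quadrant_estimate d c d0 c0 (fun x y => phi (s1 * x, s2 * y))
    (fun x y => s1 * pd false phi (s1 * x, s2 * y))
    (fun x y => s2 * pd true phi (s1 * x, s2 * y)) (Mx + My).
  rewrite !mulr0 -/kap.
  have -> : (fun x => oint 0 c (fun y => kap (x ^+ 2 + y ^+ 2) *
     (x * (s1 * pd false phi (s1 * x, s2 * y)) + y * (s2 * pd true phi (s1 * x, s2 * y))))) =
     (fun x => oint 0 c (fun y => E (s1 * x, s2 * y))).
    apply/funext => x; apply: eq_oint => y; rewrite /E /= !exprMn s11 s21 !mul1r; ring.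
  apply.
  - move=> x y; apply: der_eq.
      apply: (derComp (f := fun t => phi (t, s2 * y)) (g := fun t => s1 * t)).
        exact: smooth_hasDx.
      by der.
    by cbv beta; ring.
  - move=> x y; apply: der_eq.
      apply: (derComp (f := fun t => phi (s1 * x, t)) (g := fun t => s2 * t)).
        exact: smooth_hasDy.
      by der.
    by cbv beta; ring.
  - by cont.
  - by cont.
  - by move=> x y; rewrite normrM s1n mul1r; apply: le_trans (HMx _) _; rewrite lerDl.
  - by move=> x y; rewrite normrM s2n mul1r; apply: le_trans (HMy _) _; rewrite lerDr.
  - by move=> t; exact: z1.
  - by move=> t; exact: z2.
have cb : b < `|c| by rewrite gtr0_norm.
have pz1 s y : `|s| = 1 -> phi (s * c, y) = 0.
  by move=> s1; apply: bphi; left; rewrite /= normrM s1 mul1r.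
have pz2 s x : `|s| = 1 -> phi (x, s * c) = 0.
  by move=> s1; apply: bphi; right; rewrite /= normrM s1 mul1r.
have n1 : `|1 : R| = 1 by exact: normr1.
have nN1 : `|-1 : R| = 1 by rewrite normrN normr1.
have e1 : (1 : R) ^+ 2 = 1 by rewrite expr1n.
have eN1 : (-1 : R) ^+ 2 = 1 by rewrite sqrrN expr1n.
have := HQ 1 1 e1 e1 n1 n1 (fun y => pz1 1 y n1) (fun x => pz2 1 x n1).
have := HQ 1 (-1) e1 eN1 n1 nN1 (fun y => pz1 1 y n1) (fun x => pz2 (-1) x nN1).
have := HQ (-1) 1 eN1 e1 nN1 n1 (fun y => pz1 (-1) y nN1) (fun x => pz2 1 x n1).
have := HQ (-1) (-1) eN1 eN1 nN1 nN1 (fun y => pz1 (-1) y nN1) (fun x => pz2 (-1) x nN1).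
have sub (s1 s2 : R) (s1' s2' : R -> R) : (forall x, s1 * x = s1' x) -> (forall x, s2 * x = s2' x) ->
   oint 0 c (fun x => oint 0 c (fun y => E (s1 * x, s2 * y))) =
   oint 0 c (fun x => oint 0 c (fun y => E (s1' x, s2' y))).
  by move=> h1 h2; apply: eq_oint => x; apply: eq_oint => y; rewrite h1 h2.
rewrite (sub _ _ _ _ (@mulN1r R) (@mulN1r R)) (sub _ _ _ _ (@mulN1r R) (@mul1r R)).
rewrite (sub _ _ _ _ (@mul1r R) (@mulN1r R)) (sub _ _ _ _ (@mul1r R) (@mul1r R)).
rewrite !ler_norml; move=> /andP[? ?] /andP[? ?] /andP[? ?] /andP[? ?].
by apply/andP; split; lra.
Qed.

(** The regularised kernels converge as d tends to 0, since the integral is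
    continuous in d up to d = 0. *)
Lemma biharmonic phi b c : 0 <= b -> b < c -> Cinf phi -> supp_in b phi ->
  boxint c (fun p => 2^-1 * xlnx (p.1 ^+ 2 + p.2 ^+ 2) * lap (lap phi) p) = 8 * pi * phi (0, 0).
Proof.
move=> b0 bc sphi bphi; have [M HM] := biharmonic_estimate b0 bc sphi bphi.
have cl := smooth_cont (smooth_lap (smooth_lap sphi)).
have cx := xlnx_cont.
pose F d := boxint c (fun p => 2^-1 * xlnx (p.1 ^+ 2 + p.2 ^+ 2 + d ^+ 2) * lap (lap phi) p).
have cF : continuous F.
  rewrite /F; apply: (cont_boxint (u := fun (d : R) (p : R * R) => 2^-1 * xlnx (p.1 ^+ 2 + p.2 ^+ 2 + d ^+ 2) *
    lap (lap phi) p)); by cont.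
have h1 : F 0 - 8 * pi * phi (0, 0) <= 0.
  have := @pos_limit_le (fun d => F d - 8 * pi * phi (0, 0) - 128 * M * d).
  rewrite mulr0 subr0; apply; first by cont.
  by move=> t t0; have := HM t t0; rewrite -/(F t) ler_norml => /andP[_]; lra.
have h2 : 8 * pi * phi (0, 0) - F 0 <= 0.
  have := @pos_limit_le (fun d => 8 * pi * phi (0, 0) - F d - 128 * M * d).
  rewrite mulr0 subr0; apply; first by cont.
  by move=> t t0; have := HM t t0; rewrite -/(F t) ler_norml => /andP[+ _]; lra.
transitivity (F 0); last by lra.
by apply: eq_boxint => p; rewrite expr0n/= addr0.
Qed.

(** The additional multiple of |x|^2 in [rad_halfxlnx] is annihilated by the
    bilaplacian. *)
Lemma rad_biharmonic phi b c : 0 <= b -> b < c -> Cinf phi -> supp_in b phi ->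
  boxint c (fun p => rad halfxlnx p * lap (lap phi) p) = 8 * pi ^+ 2 * phi (0, 0).
Proof.
move=> b0 bc sphi bphi; have [C radE] := rad_halfxlnx.
have sl := smooth_lap sphi; have bl := supp_lap bphi.
have cl := smooth_cont (smooth_lap sl); have cx := xlnx_cont.
have c1 := smooth_cont sl; have cphi := smooth_cont sphi.
transitivity (boxint c (fun p => pi * (2^-1 * xlnx (p.1 ^+ 2 + p.2 ^+ 2) * lap (lap phi) p) +
    C * ((p.1 ^+ 2 + p.2 ^+ 2) * lap (lap phi) p))).
  by apply: eq_boxint => p; rewrite radE; ring.
rewrite boxintD; [|by cont|by cont].
rewrite boxintZ; last by cont.
rewrite boxintZ; last by cont.
rewrite (biharmonic b0 bc sphi bphi).
rewrite (@lap_parts2 _ (fun p => p.1 ^+ 2 + p.2 ^+ 2) (fun p => 2 * p.1) (fun p => 2 * p.2)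
  (fun=> 2) (fun=> 2) _ b c) //; do ?[by cont]; last 4 first.
- by move=> x y /=; apply: der_eq; [der|cbv beta; ring].
- by move=> x y /=; apply: der_eq; [der|cbv beta; ring].
- by move=> x y /=; apply: der_eq; [der|cbv beta; ring].
- by move=> x y /=; apply: der_eq; [der|cbv beta; ring].
rewrite (@lap_parts2 _ (fun=> 2 + 2) (fun=> 0) (fun=> 0) (fun=> 0) (fun=> 0) _ b c) //;
  do ?[by cont]; do ?[by move=> *; exact: derC].
under eq_boxint do rewrite addr0 mul0r.
by rewrite boxint0; ring.
Qed.
End Biharmonic.

(** * A fundamental solution of the circle average *)
Section FundamentalSolution.
Context {R : realType}.
Implicit Types (s t : R) (phi : R * R -> R).

Lemma der_boxint (u du : R -> R * R -> R) c x :
  (forall t p, hasD (fun y => u y p) t (du t p)) ->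
  continuous (fun q : R * (R * R) => u q.1 q.2) ->
  continuous (fun q : R * (R * R) => du q.1 q.2) ->
  hasD (fun t => boxint c (u t)) x (boxint c (du x)).
Proof.
move=> dU cu cdu; rewrite (_ : (fun t => boxint c (u t)) =
  fun t => oint (- c) c (fun x => oint (- c) c (fun y => u t (x, y)))); last first.
  by apply/funext => t; rewrite boxintE.
rewrite boxintE; apply: (@der_oint _ (fun t x => oint (- c) c (fun y => u t (x, y)))
  (fun t x => oint (- c) c (fun y => du t (x, y)))).
- move=> t z; apply: (@der_oint _ (fun t y => u t (z, y)) (fun t y => du t (z, y))).
  + by move=> *; exact: dU.
  + by cont.
  + by cont.
- by cont.
- by cont.
Qed.

(** The second derivatives of L(x cos t + y sin t) in x and y carry the factors
    cos^2 and sin^2, which add up to 1. *)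
Lemma rad_lap_parts (L L1 L2 : R -> R) phi b c : 0 <= b -> b < c ->
  (forall s, hasD L s (L1 s)) -> (forall s, hasD L1 s (L2 s)) -> continuous L2 ->
  Cinf phi -> supp_in b phi ->
  boxint c (fun p => rad L p * lap phi p) = boxint c (fun p => rad L2 p * phi p).
Proof.
move=> b0 bc dL dL1 cL2 sphi bphi.
have cL1 : continuous L1 by apply: der_cont => s; exists (L2 s).
have cL : continuous L by apply: der_cont => s; exists (L1 s).
pose K (f : R -> R) (g : R -> R) (p : R * R) : R :=
  oint 0 (2 * pi) (fun t => f (p.1 * cos t + p.2 * sin t) * g t).
have cK f g : continuous f -> continuous g -> continuous (K f g).
  by move=> cf cg; rewrite /K; cont.
have c1 : continuous (fun _ : R => 1 : R) by cont.
have cc : continuous (@cos R) by exact: continuous_cos.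
have cs : continuous (@sin R) by exact: continuous_sin.
have ccc : continuous (fun t : R => cos t * cos t) by cont.
have css : continuous (fun t : R => sin t * sin t) by cont.
have KL f : rad f = K f (fun=> 1).
  by apply/funext => p; apply: eq_oint => t; rewrite mulr1.
have dKx f f' g x y : (forall s, hasD f s (f' s)) -> continuous f -> continuous f' ->
    continuous g -> hasD (fun t => K f g (t, y)) x (K f' (fun t => g t * cos t) (x, y)).
  move=> df cf cf' cg.
  apply: (@der_oint _ (fun x t => f (x * cos t + y * sin t) * g t)
    (fun x t => f' (x * cos t + y * sin t) * (g t * cos t))); [|by cont|by cont].
  by move=> z t; apply: der_eq; [der|cbv beta; ring].
have dKy f f' g x y : (forall s, hasD f s (f' s)) -> continuous f -> continuous f' ->
    continuous g -> hasD (fun t => K f g (x, t)) y (K f' (fun t => g t * sin t) (x, y)).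
  move=> df cf cf' cg.
  apply: (@der_oint _ (fun y t => f (x * cos t + y * sin t) * g t)
    (fun y t => f' (x * cos t + y * sin t) * (g t * sin t))); [|by cont|by cont].
  by move=> z t; apply: der_eq; [der|cbv beta; ring].
have c1c : continuous (fun t : R => 1 * cos t) by cont.
have c1s : continuous (fun t : R => 1 * sin t) by cont.
have c1cc : continuous (fun t : R => 1 * cos t * cos t) by cont.
have c1ss : continuous (fun t : R => 1 * sin t * sin t) by cont.
rewrite (KL L) (lap_parts2 b0 bc (cK L _ cL c1) (cK L1 _ cL1 c1c) (cK L1 _ cL1 c1s)
  (cK L2 _ cL2 c1cc) (cK L2 _ cL2 c1ss) (fun x y => dKx L L1 _ x y dL cL cL1 c1)
  (fun x y => dKy L L1 _ x y dL cL cL1 c1)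
  (fun x y => dKx L1 L2 _ x y dL1 cL1 cL2 c1c)
  (fun x y => dKy L1 L2 _ x y dL1 cL1 cL2 c1s) sphi bphi).
apply: eq_boxint => p; congr (_ * _); rewrite /K /rad -ointD; [|by cont|by cont].
apply: eq_oint => t; rewrite -mulrDr -!mulrA !mul1r -!expr2 cos2Dsin2 mulr1 //.
Qed.

(** The causal half of the profile s^2 ln |s|, vanishing on the negative half
    line. *)
Definition halfline s : R := halfxlnx (Num.max s 0).

Lemma halfline_vanishing : vanishing 0 halfline.
Proof.
split; last first.
  by move=> s s0; rewrite /halfline max_r// /halfxlnx expr0n/= xlnx_npos// mulr0.
have ch := @halfxlnx_cont R; have cm : continuous (fun s : R => Num.max s 0).
  by move=> s; apply: (@continuous_max _ _ (fun s => s) (fun=> 0)); [exact: cvg_id|exact: cvg_cst].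
by rewrite /halfline; cont.
Qed.

Lemma halfline_even s : halfline s + halfline (- s) = halfxlnx s.
Proof.
have [_ h0] := halfline_vanishing.
have [s0|s0] := leP s 0.
  by rewrite h0// add0r /halfline max_l ?oppr_ge0// /halfxlnx sqrrN.
by rewrite (h0 (- s)) ?oppr_le0 ?ltW// addr0 /halfline max_l// ltW.
Qed.

(** For even n, an even n-fold primitive of s^2 ln |s|, already split into a
    causal half and its mirror image. *)
Definition evenprim n s : R := iter n prim halfline s + iter n prim halfline (- s).

Lemma cont_iter_prim n : continuous (iter n prim halfline).
Proof. by elim: n => [|n IH] /=; [case: halfline_vanishing|exact: prim_cont]. Qed.

Lemma cont_evenprim n : continuous (evenprim n).
Proof. by have c := @cont_iter_prim n; rewrite /evenprim; cont. Qed.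

Lemma rad_evenprim m phi b c : 0 <= b -> b < c -> Cinf phi -> supp_in b phi ->
  boxint c (fun p => rad (evenprim m.*2) p * iter m.+2 lap phi p) = 8 * pi ^+ 2 * phi (0, 0).
Proof.
move=> b0 bc sphi bphi; rewrite -(rad_biharmonic b0 bc sphi bphi).
elim: m => [|m IH].
  apply: eq_boxint => p; congr (_ * _); apply: eq_oint => t; exact: halfline_even.
rewrite -IH doubleS.
have dp n x : hasD (iter n.+1 prim halfline) x (iter n prim halfline x).
  by apply: prim_derive; exact: cont_iter_prim.
have s2 := smooth_iter_lap m.+2 sphi; have b2 := supp_iter_lap m.+2 bphi.
apply: (rad_lap_parts b0 bc (L1 := fun s => iter (m.*2).+1 prim halfline s -
  iter (m.*2).+1 prim halfline (- s))) => //.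
- move=> s; have d2 := dp (m.*2).+1; rewrite /evenprim.
  have dn : hasD (fun s => iter (m.*2).+2 prim halfline (- s)) s
      (iter (m.*2).+1 prim halfline (- s) * (- 1)).
    apply: (derComp (f := iter (m.*2).+2 prim halfline)); first exact: d2.
    exact: (derN (derId s)).
  by apply: der_eq; [apply: derD; [exact: d2|exact: dn]|ring].
- move=> s; have d2 := dp (m.*2); rewrite /evenprim.
  have dn : hasD (fun s => iter (m.*2).+1 prim halfline (- s)) s
      (iter (m.*2) prim halfline (- s) * (- 1)).
    apply: (derComp (f := iter (m.*2).+1 prim halfline)); first exact: d2.
    exact: (derN (derId s)).
  by apply: der_eq; [apply: derB; [exact: d2|exact: dn]|ring].
- exact: cont_evenprim.
Qed.

(** On the circle around p the plane wave in direction t has the phase p . t + cos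
    (a - t). The bound on p keeps p . t in the interval where the equation for e
    holds. *)
Lemma circle_rad (e L : R -> R) T (p : R * R) : continuous e -> continuous L ->
  (forall s, `|s| <= T -> oint 0 (2 * pi) (fun a => e (s + cos a)) = L s) ->
  `|p.1| + `|p.2| <= T ->
  oint 0 (2 * pi) (fun a => rad e (p.1 + cos a, p.2 + sin a)) = rad L p.
Proof.
move=> ce cL eL pT; rewrite /rad /= oint_Fubini; last by cont.
apply: eq_oint => t; rewrite -eL.
  rewrite -(@oint_period _ (fun a => e (p.1 * cos t + p.2 * sin t + cos a)) t); [|by cont|].
    by apply: eq_oint => a; rewrite cosB; congr e; ring.
  by move=> a; rewrite cos_period.
apply: le_trans (ler_normD _ _) _; rewrite !normrM; apply: le_trans pT.
apply: lerD; apply: ler_piMr => //.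
  by rewrite ler_norml cos_geN1 cos_le1.
by rewrite ler_norml sin_geN1 sin_le1.
Qed.

(** [prim_iter_solve] gives a causal solution e1 for the causal half of the
    right-hand side; adding its mirror image gives the even profile. The number of
    primitives is even so that they are undone by Laplacians. *)
Lemma circle_fundamental_solution T : exists (k : R * R -> R) (N : nat), continuous k /\
  forall phi b c, 0 <= b -> b < c -> 2 * c <= T -> Cinf phi -> supp_in b phi ->
  boxint c (fun p => oint 0 (2 * pi) (fun a => k (p.1 + cos a, p.2 + sin a)) * iter N lap phi p) =
  8 * pi ^+ 2 * phi (0, 0).
Proof.
have [n0 Hn0] := @prim_iter_solve R T.
have nn : (n0 <= n0.*2)%N by rewrite -addnn leq_addl.
have [e1 [ce1 e10] eE] := Hn0 _ _ nn halfline_vanishing.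
pose e s := e1 (s - 1) + e1 (- s - 1).
have ce : continuous e by rewrite /e; cont.
have cL := @cont_evenprim n0.*2.
have eL s : `|s| <= T -> oint 0 (2 * pi) (fun a => e (s + cos a)) = evenprim n0.*2 s.
  rewrite ler_norml => /andP[s1 s2].
  rewrite /evenprim -!eE; [|by lra|by lra].
  rewrite /e ointD; [|by cont|by cont]; congr (_ + _); rewrite /circ /avg.
    rewrite -(@oint_period _ (fun a => 1 * e1 (s - (1 + cos a))) pi); [|by cont|].
      apply: eq_oint => a; rewrite mul1r cosB sinpi cospi mulr0 addr0 mulrN1.
      by congr e1; ring.
    by move=> a; rewrite cos_period.
  by apply: eq_oint => a; rewrite mul1r; congr e1; ring.
have crad := cont_rad ce.
exists (rad e), n0.+2; split => // phi b c b0 bc cT sphi bphi.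
rewrite -(rad_evenprim n0 b0 bc sphi bphi).
have cl := smooth_cont (smooth_iter_lap n0.+2 sphi).
have crL := cont_rad cL.
apply: boxint_ext; [by lra|by cont|by cont|move=> p p1 p2].
by rewrite (circle_rad ce cL eL)//; lra.
Qed.
End FundamentalSolution.

(** * Smooth cutoff functions *)
Section Bump.
Context {R : realType}.
Implicit Types (s t x : R) (f g : R -> R).

(** The functions t^{-n} e^{-1/t} on the positive half line, a family whose span
    is closed under differentiation [der_flat]. *)
Definition flat n t : R := if 0 < t then t ^- n * expR (- t^-1) else 0.

(** With s = 1 / t this is s^(n+2) <= C e^s, which follows from s / (n+2) <= e^(s
    / (n+2)). *)
Lemma flat_bound n : exists2 C, 0 <= C & forall t, `|flat n t| <= C * t ^+ 2.
Proof.
pose C : R := n.+2%:R ^+ n.+2.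
exists C; first by rewrite exprn_ge0.
move=> t; rewrite /flat; case: ifP => [t0|_]; last first.
  by rewrite normr0 mulr_ge0 ?sqr_ge0// exprn_ge0.
have e0 := expR_gt0 (- t^-1).
rewrite ger0_norm; last by rewrite mulr_ge0 ?invr_ge0 ?exprn_ge0 ?ltW.
pose s := t^-1; have s0 : 0 < s by rewrite invr_gt0.
have key : s ^+ n.+2 <= C * expR s.
  have h : s / n.+2%:R <= expR (s / n.+2%:R).
    by apply: le_trans (expR_ge1Dx _); rewrite lerDr ler01.
  have -> : expR s = expR (s / n.+2%:R) ^+ n.+2.
    by rewrite -expRM_natr divfK// pnatr_eq0.
  rewrite ler_pdivrMr// mulrC in h.
  rewrite /C -exprMn; apply: lerXn2r => //; rewrite nnegrE; first exact: ltW.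
  by rewrite mulr_ge0// ltW// expR_gt0.
have -> : expR (- t^-1) = (expR s)^-1 by rewrite expRN.
have -> : t ^- n = s ^+ n by rewrite /s exprVn.
have -> : t ^+ 2 = (s ^+ 2)^-1 by rewrite /s exprVn invrK.
rewrite ler_pdivrMr ?expR_gt0//.
rewrite mulrAC ler_pdivlMr ?exprn_gt0//.
by rewrite -exprD addn2.
Qed.

Lemma der_zero_of_bound f C : f 0 = 0 -> (forall t, `|f t| <= C * t ^+ 2) -> hasD f 0 0.
Proof.
move=> f0 fC; apply/is_derive1_caratheodory; exists (fun t => f t / t); split.
- move=> z; rewrite f0 !subr0; have [->|zn] := eqVneq z 0; first by rewrite f0 mulr0.
  by rewrite divfK.
- rewrite /prop_for /continuous_at f0 mul0r; apply/cvgrPdist_le => e e0.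
  have C0 : 0 <= C by have := fC 1; rewrite expr1n mulr1; exact: le_trans (normr_ge0 _).
  have d0 : 0 < e / (C + 1) by rewrite divr_gt0//; lra.
  near=> t; rewrite sub0r normrN normrM.
  have [->|tn] := eqVneq t 0; first by rewrite invr0 normr0 mulr0 ltW.
  rewrite normfV ler_pdivrMr ?normr_gt0//; apply: le_trans (fC t) _.
  have -> : t ^+ 2 = `|t| * `|t| by rewrite -normrM -expr2 ger0_norm// sqr_ge0.
  rewrite mulrA ler_wpM2r//.
  have : `|t| <= e / (C + 1).
    by near: t; exact: (@nbhs0_le _ R^o).
  rewrite ler_pdivlMr; last by lra.
  by have := normr_ge0 t; nra.
- by rewrite f0 mul0r.
Unshelve. all: by end_near. Qed.

Lemma der_flat n t : hasD (flat n) t (flat n.+2 t - n%:R * flat n.+1 t).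
Proof.
have [t0|t0|->] := ltgtP t 0.
- apply: (@der_near _ (fun=> 0)).
    near=> y; rewrite /flat ltNge ifF//; apply/negbTE; rewrite negbK.
    by apply/ltW; near: y; exact: lt_nbhsl.
  by rewrite /flat ltNge (ltW t0)/= mulr0 subr0; exact: derC.
- apply: (@der_near _ (fun y => y ^- n * expR (- y^-1))).
    near=> y; rewrite /flat ifT//.
    by rewrite -oppr_lt0; near: y; apply: Nlt_nbhsl; rewrite oppr_lt0.
  have tn : t != 0 by exact: lt0r_neq0.
  have dn : hasD (fun y => y ^- n) t (- n%:R * t ^- n.+1).
    case: n => [|n].
      rewrite oppr0 mul0r (_ : (fun y => y ^- 0) = fun=> 1); first exact: derC.
      by apply/funext => y; rewrite expr0 invr1.
    apply: der_eq.
      by apply: (derV (f := fun y => y ^+ n.+1)); [rewrite expf_neq0|der].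
    by cbv beta; rewrite !exprS; field; rewrite tn expf_neq0.
  rewrite /flat t0; apply: der_eq.
    apply: derM; first exact: dn.
    apply: (derComp (f := @expR R)); first exact: is_derive_expR.
    by apply: derN; exact: (derV (f := fun t => t) tn (derId t)).
  have E1 : t ^- n.+1 = t^-1 * t ^- n by rewrite exprS invfM.
  have E2 : t ^- n.+2 = t^-1 * (t^-1 * t ^- n) by rewrite !exprS !invfM.
  by rewrite E1 E2; cbv beta; set P := t ^- n; field; exact: tn.
- have [C C0 HC] := flat_bound n.
  have f0 m : flat m (0 : R) = 0 by rewrite /flat ltxx.
  by rewrite !f0 mulr0 subr0; exact: (der_zero_of_bound (f0 n) HC).
Unshelve. all: by end_near. Qed.

(** For m = n = 0, a smooth function that is positive exactly on ]1, 2[; its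
    normalised tail integral is the function [step], which descends from 1 to 0.
    *)
Definition flat2 m n t : R := flat m (t - 1) * flat n (2 - t).
Let c0 : R := oint 1 2 (flat2 0 0).
Definition step t : R := oint t 2 (flat2 0 0) / c0.

Lemma cont_flat n : continuous (flat n).
Proof. by apply: der_cont => t; eexists; exact: der_flat. Qed.
Lemma cont_flat2 m n : continuous (flat2 m n).
Proof. by have c := @cont_flat m; have c' := @cont_flat n; rewrite /flat2; cont. Qed.

Lemma flat_ge0 n t : 0 <= flat n t.
Proof.
rewrite /flat; case: ifP => // t0; rewrite mulr_ge0 ?expR_ge0// invr_ge0 exprn_ge0//.
exact: ltW.
Qed.
Lemma flat_gt0 n t : 0 < t -> 0 < flat n t.
Proof.
by move=> t0; rewrite /flat t0 mulr_gt0 ?expR_gt0// invr_gt0 exprn_gt0.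
Qed.

Lemma step_const_gt0 : 0 < c0.
Proof.
have cf := @cont_flat2 0 0.
have f0 a b : a <= b -> 0 <= oint a b (flat2 0 0).
  by move=> ab; apply: oint_ge0 => // t _; rewrite mulr_ge0// flat_ge0.
rewrite /c0 (oint_cat (5 / 4)) (oint_cat (7 / 4) (5 / 4)).
have [c cI ->] := @oint_MVT _ (flat2 0 0) (5 / 4) (7 / 4) cf ltac:(lra).
have h1 := f0 1 (5 / 4) ltac:(lra); have h2 := f0 (7 / 4) 2 ltac:(lra).
have : 0 < flat2 0 0 c.
  by move: cI; rewrite in_itv /= => /andP[? ?]; rewrite mulr_gt0// flat_gt0//; lra.
lra.
Qed.

Lemma step1 t : t <= 1 -> step t = 1.
Proof.
move=> t1; rewrite /step (oint_cat 1) -[X in (X + _) / _]/(oint t 1 (flat2 0 0)).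
have -> : oint t 1 (flat2 0 0) = 0.
  rewrite -(oint0 t 1); apply: oint_ext => //; [exact: cont_flat2|exact: cst_continuous|].
  by move=> x /andP[_ x1]; rewrite /flat2 /flat subr_gt0 ltNge x1 mul0r.
by rewrite add0r divff// lt0r_neq0// step_const_gt0.
Qed.

Lemma step0 t : 2 <= t -> step t = 0.
Proof.
move=> t2; rewrite /step oint_swap (_ : oint 2 t _ = 0) ?oppr0 ?mul0r//.
rewrite -(oint0 2 t); apply: oint_ext => //; [exact: cont_flat2|exact: cst_continuous|].
by move=> x /andP[x2 _]; rewrite /flat2 /(flat 0 (2 - x)) subr_gt0 ltNge x2 mulr0.
Qed.

(** The span of the step function and of all [flat2], which is stable under
    differentiation, as [smooth_class] requires. *)
Inductive step_class : (R -> R) -> Prop :=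
| StepBase : step_class step
| StepFlat m n : step_class (flat2 m n)
| StepD f g : step_class f -> step_class g -> step_class (fun t => f t + g t)
| StepZ a f : step_class f -> step_class (fun t => a * f t).

Lemma step_classP f : step_class f ->
  exists2 g, step_class g & forall t, hasD f t (g t).
Proof.
elim=> {f}.
- exists (fun t => - c0^-1 * flat2 0 0 t); first by apply: StepZ; exact: StepFlat.
  move=> t; apply: der_eq.
    rewrite /step; apply: derM; last exact: derC.
    under eq_fun do rewrite ointE.
    by apply: derB; [exact: derC|apply: prim_derive; exact: cont_flat2].
  by cbv beta; ring.
- move=> m n; exists (fun t => (flat2 m.+2 n t + - m%:R * flat2 m.+1 n t) +
     (-1 * flat2 m n.+2 t + n%:R * flat2 m n.+1 t)).
    by do 2?apply: StepD; do ?apply: StepZ; exact: StepFlat.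
  move=> t; apply: der_eq.
    rewrite /flat2; apply: derM.
      by apply: (derComp (f := flat m)); [exact: der_flat|der].
    apply: (derComp (f := flat n) (g := fun t => 2 - t)); first exact: der_flat.
    exact: (derD (derC 2 t) (derN (derId t))).
  by rewrite /flat2; cbv beta; ring.
- move=> f g _ [f' cf' df] _ [g' cg' dg]; exists (fun t => f' t + g' t); first exact: StepD.
  by move=> t; exact: derD.
- move=> a f _ [f' cf' df]; exists (fun t => a * f' t); first exact: StepZ.
  by move=> t; apply: der_eq; [der|cbv beta; ring].
Qed.

Lemma smooth_step a j : Cinf (fun p => step (a * coord j p)).
Proof.
apply: (@smooth_class _ (fun u => exists2 f, step_class f & u = fun p => f (a * coord j p)));
  last by exists step => //; exact: StepBase.
  move=> u [f /step_classP[g _ df] ->].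
  have cf : continuous f by apply: der_cont => t; eexists; exact: df.
  by rewrite /coord; case: j; cont.
move=> u i [f cf ->]; have [g cg df] := step_classP cf.
have [ij|ij] := eqVneq i j.
  exists (fun p => a * g (a * coord j p)).
    by exists (fun t => a * g t) => //; exact: StepZ.
  move=> p; rewrite ij (_ : slice _ _ _ = fun t => f (a * t)); last first.
    by apply/funext => t; case: (j).
  apply: der_eq; first by der.
  by cbv beta; ring.
exists (fun=> 0).
  exists (fun t => 0 * f t); first exact: StepZ.
  by apply/funext => p; rewrite mul0r.
move=> p; rewrite (_ : slice _ _ _ = fun=> f (a * coord j p)); first exact: derC.
by apply/funext => t; case: i j ij => -[].
Qed.

Definition bump (r : R) (p : R * R) : R :=
  step (r^-1 * coord false p) * step (- r^-1 * coord false p) *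
  (step (r^-1 * coord true p) * step (- r^-1 * coord true p)).

Lemma smooth_bump r : Cinf (bump r).
Proof. by apply: smoothM; apply: smoothM; exact: smooth_step. Qed.

Lemma bump1 r p : 0 < r -> `|p.1| <= r -> `|p.2| <= r -> bump r p = 1.
Proof.
move=> r0; rewrite !ler_norml => /andP[a1 a2] /andP[b1 b2].
have h x : x <= r -> r^-1 * x <= 1 by move=> xr; rewrite mulrC ler_pdivrMr// mul1r.
rewrite /bump /= !step1 ?mulr1//; rewrite ?mulNr -?mulrN; apply: h; lra.
Qed.

Lemma bump_supp r : 0 < r -> supp_in (2 * r) (bump r).
Proof.
move=> r0; have h x : 2 * r < x -> step (r^-1 * x) = 0.
  by move=> xr; apply: step0; rewrite mulrC ler_pdivlMr// ltW.
move=> p; rewrite /bump /= !ltr_normr => -[|] /orP[] /h.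
- by move=> ->; rewrite !mul0r.
- by rewrite mulrN -mulNr => ->; rewrite mulr0 mul0r.
- by move=> ->; rewrite mul0r mulr0.
- by rewrite mulrN -mulNr => ->; rewrite !mulr0.
Qed.
End Bump.

(** * Lebesgue integrals over the plane *)
Section LebesguePlane.
Context {R : realType}.
Local Notation mu := (@lebesgue_measure R).
Local Notation mu2 := (mu \x mu)%E.
Local Notation R2 := (measurableTypeR R * measurableTypeR R)%type.

(** An open set of the plane is a countable union of squares with rational centers
    and radii 1 / (n + 1), which are measurable for the product structure. *)
Lemma open2_measurable (U : set (R * R)) : open U -> measurable (U : set R2).
Proof.
move=> oU.
pose D (q : rat) (n : nat) : set R := [set x | `|x - ratr q| < n.+1%:R^-1].
pose F q r n : set (R * R) := if `[< D q n `*` D r n `<=` U >] then D q n `*` D r n else set0.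
have -> : U = \bigcup_q \bigcup_r \bigcup_n F q r n.
  apply/seteqP; split=> [p Up|p [q _ [r _ [n _]]]]; last first.
    by rewrite /F; case: asboolP => // DU /DU.
  have : nbhs p U by exact: open_nbhs_nbhs.
  case=> -[A B] [/= /nbhs_ballP[a a0 Aa] /nbhs_ballP[b b0 Bb]] AB.
  have [n nab] : exists n, n.+1%:R^-1 < Num.min a b / 2.
    have m0 : 0 < Num.min a b / 2 by rewrite divr_gt0// lt_min a0.
    exists (Num.truncn (Num.min a b / 2)^-1).
    by rewrite invf_plt ?posrE//; exact: truncnS_gt.
  have n0 : 0 < n.+1%:R^-1 :> R by rewrite invr_gt0.
  have [e eE] : exists e : R, e = n.+1%:R^-1 by eexists.
  rewrite -eE in n0 nab.
  have [q /= qE] := @rat_in_itvoo R (p.1 - e) p.1 ltac:(lra).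
  have [r /= rE] := @rat_in_itvoo R (p.2 - e) p.2 ltac:(lra).
  move: qE rE; rewrite !in_itv /= => /andP[q1 q2] /andP[r1 r2].
  have na : e < a / 2.
    by apply: lt_le_trans nab _; rewrite ler_pM2r// ge_min lexx.
  have nb : e < b / 2.
    by apply: lt_le_trans nab _; rewrite ler_pM2r// ge_min lexx orbT.
  exists q => //; exists r => //; exists n => //; rewrite /F; case: asboolP => [_|].
    by split => /=; rewrite /D /= -eE ltr_norml; apply/andP; split; lra.
  case=> -[x y] [/= + +]; rewrite /D /= -eE !ltr_norml => /andP[x1 x2] /andP[y1 y2].
  apply: AB; split => /=.
    by apply: Aa; rewrite /ball /= ltr_norml; apply/andP; split; lra.
  by apply: Bb; rewrite /ball /= ltr_norml; apply/andP; split; lra.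
have mD q n : measurable (D q n : set (measurableTypeR R)).
  apply: open_measurable; rewrite (_ : D q n = ball (ratr q : R) n.+1%:R^-1).
    exact: ball_open.
  by apply/seteqP; split=> x; rewrite /D /ball /= distrC.
apply: bigcupT_measurable_rat => q; apply: bigcupT_measurable_rat => r.
apply: bigcupT_measurable => n; rewrite /F; case: ifP => _; last exact: measurable0.
by apply: measurableX; exact: mD.
Qed.

Lemma cont2_measurable (u : R * R -> R) : continuous u ->
  measurable_fun [set: R2] (u : R2 -> measurableTypeR R).
Proof.
move=> /continuousP cu; apply: (measurability _ (RGenOpens.measurableE R)).
move=> _ [_ [a [b ->] <-]]; rewrite setTI; apply: open2_measurable.
exact/cu/interval_open.
Qed.

Lemma integral_supp (f : R -> R) b c : continuous f -> b < c ->
  (forall t, b < `|t| -> f t = 0) ->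
  (\int[mu]_t (f t)%:E = (oint (- c) c f)%:E)%E.
Proof.
move=> cf bc f0; have [c0|c0] := ltP c 0.
  have f00 t : f t = 0 by apply: f0; apply: lt_le_trans (normr_ge0 t); lra.
  rewrite (_ : f = fun=> 0); last by apply/funext.
  by rewrite oint0 integral0.
rewrite -oint_Rintegral//; last by lra.
have fi := cont_integrable (- c) c cf.
rewrite /Rintegral fineK; last exact: integrable_fin_num fi.
rewrite [RHS]integral_mkcond; apply: eq_integral => t _.
rewrite patchE; case: ifPn => // /negP tc.
rewrite f0//; rewrite ltNge; apply/negP => tb; apply: tc.
by apply/mem_set; rewrite /= in_itv /= -ler_norml; lra.
Qed.

(** A continuous function supported in a square is bounded with a support of
    finite measure, hence integrable, and the theorem of Fubini reduces the
    integral to iterated integrals over an interval. *)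
Lemma plane_Rintegral (u : R * R -> R) b c : continuous u -> supp_in b u -> b < c ->
  \int[mu2]_p u p = boxint c u.
Proof.
move=> cu bu bc.
have mu_u : measurable_fun [set: R2] (EFin \o u : R2 -> \bar R).
  by apply/measurable_EFinP; exact: cont2_measurable.
have iu : mu2.-integrable setT (EFin \o u).
  pose K : set R2 := `[- c, c] `*` `[- c, c].
  have mK : measurable K by apply: measurableX; exact: measurable_itv.
  have [M M0 HM] := supp_bounded cu bu.
  pose J : set (measurableTypeR R) := `[- c, c]%classic.
  have mJ : measurable J by exact: measurable_itv.
  have K2 : (mu2 K < +oo)%E.
    have -> : (mu2 K = mu J * mu J)%E by exact: product_measure1E.
    have fin : (mu J < +oo)%E.
      by rewrite /J lebesgue_measure_itv /=; case: ifP => _; rewrite ltry.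
    by rewrite lte_mul_pinfty ?ge0_fin_numE ?measure_ge0// fin.
  have : mu2.-integrable K (EFin \o u).
    apply: (measurable_bounded_integrable mK K2).
      exact: measurable_funS (cont2_measurable cu).
    exists M; split; first exact: num_real.
    by move=> x Mx p _ /=; apply: le_trans (HM p) (ltW Mx).
  rewrite integrable_mkcond//; congr (integrable _ _ _).
  apply/funext => p; rewrite patchE; case: ifPn => // /negP pK.
  rewrite /= bu//; have [h|h] := ltP b `|p.1|; first by left.
  right; rewrite ltNge; apply/negP => h2; apply: pK.
  by apply/mem_set; split; rewrite /= in_itv /= -ler_norml; lra.
rewrite /Rintegral -integral12_prod_meas1//.
have -> : (fun x => \int[mu]_y ((EFin \o u) (x, y)))%E =
    (fun x => (oint (- c) c (fun y => u (x, y)))%:E).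
  apply/funext => x; apply: (@integral_supp _ b); [by cont|by []|].
  by move=> t tb; apply: bu; right.
rewrite (@integral_supp _ b c)//; first by rewrite boxintE.
  by cont.
move=> t tb; rewrite -(oint0 (- c) c); apply: eq_oint => y.
by apply: bu; left.
Qed.
End LebesguePlane.

(** * The local inverse of the circle average *)
Section Operators.
Context {R : realType}.
Implicit Types (u v k phi psi : R * R -> R) (b c B : R).

(** The correlation of k with u: translating u, instead of k, keeps the domain of
    integration fixed and lets derivatives fall on u. *)
Definition conv k B u (z : R * R) : R := boxint B (fun w => k w * u (w.1 + z.1, w.2 + z.2)).

Lemma smooth_conv_pd k B u j p : continuous k -> Cinf u ->
  hasD (slice j (conv k B u) p) (coord j p) (conv k B (pd j u) p).
Proof.
move=> ck su; have cu := smooth_cont su; have cdu := smooth_cont (smooth_pd j su).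
case: p => x y; case: j cdu => /= cdu.
- apply: (@der_boxint _ (fun t w => k w * u (w.1 + x, w.2 + t))
    (fun t w => k w * pd true u (w.1 + x, w.2 + t))); [|by cont|by cont].
  move=> t w; apply: der_eq.
    apply: derM; first exact: derC.
    apply: (derComp (f := fun s => u (w.1 + x, s)) (g := fun t => w.2 + t)).
      exact: smooth_hasDy.
    by der.
  by cbv beta; ring.
- apply: (@der_boxint _ (fun t w => k w * u (w.1 + t, w.2 + y))
    (fun t w => k w * pd false u (w.1 + t, w.2 + y))); [|by cont|by cont].
  move=> t w; apply: der_eq.
    apply: derM; first exact: derC.
    apply: (derComp (f := fun s => u (s, w.2 + y)) (g := fun t => w.1 + t)).
      exact: smooth_hasDx.
    by der.
  by cbv beta; ring.
Qed.

Lemma cont_conv k B u : continuous k -> continuous u -> continuous (conv k B u).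
Proof.
move=> ck cu.
apply: (cont_boxint (u := fun (z : R * R) (w : R * R) => k w * u (w.1 + z.1, w.2 + z.2))).
by cont.
Qed.

Lemma smooth_conv k B u : continuous k -> Cinf u -> Cinf (conv k B u).
Proof.
move=> ck su.
apply: (@smooth_class _ (fun v => exists2 u, Cinf u & v = conv k B u)); last by exists u.
  by move=> _ [w sw ->]; apply: cont_conv => //; exact: smooth_cont.
move=> _ j [w sw ->]; exists (conv k B (pd j w)).
  by exists (pd j w) => //; exact: smooth_pd.
by move=> p; exact: smooth_conv_pd.
Qed.

(** The real form of the transpose of the circle transform. *)
Definition circT u (y : R * R) : R :=
  oint 0 (2 * pi) (fun a => u (y.1 - cos a, y.2 - sin a)).

Lemma smooth_circT u : Cinf u -> Cinf (circT u).
Proof.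
move=> su.
apply: (@smooth_class _ (fun v => exists2 u, Cinf u & v = circT u)); last by exists u.
  by move=> _ [w /smooth_cont cw ->]; rewrite /circT; cont.
move=> _ j [w sw ->]; exists (circT (pd j w)).
  by exists (pd j w) => //; exact: smooth_pd.
have cw := smooth_cont sw; have cdw := smooth_cont (smooth_pd j sw).
case=> x y; case: j cdw => /= cdw.
- apply: (@der_oint _ (fun t a => w (x - cos a, t - sin a))
    (fun t a => pd true w (x - cos a, t - sin a))); [|by cont|by cont].
  move=> t a; apply: der_eq.
    apply: (derComp (f := fun s => w (x - cos a, s)) (g := fun t => t - sin a)).
      exact: smooth_hasDy.
    by der.
  by cbv beta; ring.
- apply: (@der_oint _ (fun t a => w (t - cos a, y - sin a))
    (fun t a => pd false w (t - cos a, y - sin a))); [|by cont|by cont].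
  move=> t a; apply: der_eq.
    apply: (derComp (f := fun s => w (s, y - sin a)) (g := fun t => t - cos a)).
      exact: smooth_hasDx.
    by der.
  by cbv beta; ring.
Qed.

(** For each w, translating the inner integral by w moves the shift from u to v;
    reflecting w then gives the correlation with the reflected kernel. The square
    of radius c contains all these translates of the support of u. *)
Lemma conv_adjoint k B u v b c : continuous k -> continuous u -> continuous v ->
  0 <= B -> supp_in b u -> b + B < c ->
  boxint c (fun z => v z * conv k B u z) =
  boxint c (fun x => u x * conv (fun w => k (- w.1, - w.2)) B v x).
Proof.
move=> ck cu cv B0 bu bc.
transitivity (boxint c (fun z => boxint B (fun w => k w * (v z * u (w.1 + z.1, w.2 + z.2))))).
  apply: eq_boxint => z; rewrite /conv -boxintZ; last by cont.
  by apply: eq_boxint => w; rewrite mulrCA.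
transitivity (boxint B (fun w => k w * boxint c (fun z => v z * u (w.1 + z.1, w.2 + z.2)))).
  rewrite boxint_boxint_Fubini; last by cont.
  by apply: eq_boxint => w; rewrite boxintZ//; cont.
transitivity (boxint B (fun w => k w * boxint c (fun x => v (x.1 - w.1, x.2 - w.2) * u x))).
  have cI1 : continuous (fun w : R * R => boxint c (fun z => v z * u (w.1 + z.1, w.2 + z.2))).
    apply: (cont_boxint (u := fun (w z : R * R) => v z * u (w.1 + z.1, w.2 + z.2))).
    by cont.
  have cI2 : continuous (fun w : R * R => boxint c (fun x => v (x.1 - w.1, x.2 - w.2) * u x)).
    apply: (cont_boxint (u := fun (w x : R * R) => v (x.1 - w.1, x.2 - w.2) * u x)).
    by cont.
  apply: boxint_ext => //; [by cont|by cont|move=> w w1 w2]; congr (_ * _).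
  rewrite -(@boxint_shift _ (fun x => v (x.1 - w.1, x.2 - w.2) * u x) w b c c); last 5 first.
  - by cont.
  - by move=> p bp; rewrite bu ?mulr0.
  - by lra.
  - by lra.
  - by lra.
  apply: eq_boxint => -[x y] /=; rewrite !addrK; congr (_ * u _).
  by rewrite addrC [y + _]addrC.
transitivity (boxint c (fun x => boxint B (fun w => k w * (v (x.1 - w.1, x.2 - w.2) * u x)))).
  rewrite [RHS]boxint_boxint_Fubini; last by cont.
  by apply: eq_boxint => w; rewrite boxintZ//; cont.
apply: eq_boxint => x; rewrite /conv -(@boxint_opp _ (fun w => k (- w.1, - w.2) *
  v (w.1 + x.1, w.2 + x.2))); last by cont.
rewrite -boxintZ; last by cont.
apply: eq_boxint => -[w1 w2] /=; rewrite !opprK (addrC (- w1)) (addrC (- w2)); ring.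
Qed.

Lemma lap_adjoint n u v b c : 0 <= b -> b < c -> Cinf u -> Cinf v -> supp_in b u ->
  boxint c (fun p => v p * iter n lap u p) = boxint c (fun p => iter n lap v p * u p).
Proof.
move=> b0 bc su sv bu; elim: n v sv => [//|n IH] v sv.
rewrite [iter n.+1 lap v]iterSr -(IH _ (smooth_lap sv)).
have sx := smooth_pd false sv; have sy := smooth_pd true sv.
have sxx := smooth_pd false sx; have syy := smooth_pd true sy.
exact: (lap_parts2 b0 bc (smooth_cont sv) (smooth_cont sx) (smooth_cont sy)
  (smooth_cont sxx) (smooth_cont syy) (fun x y => smooth_hasDx x y sv)
  (fun x y => smooth_hasDy x y sv) (fun x y => smooth_hasDx x y sx)
  (fun x y => smooth_hasDy x y sy) (smooth_iter_lap n su) (supp_iter_lap n bu)).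
Qed.

Lemma suppM b u v : supp_in b u -> supp_in b (fun p => u p * v p).
Proof. by move=> bu p bp; rewrite bu// mul0r. Qed.
Lemma suppMr b u v : supp_in b v -> supp_in b (fun p => u p * v p).
Proof. by move=> bv p bp; rewrite bv// mulr0. Qed.


(** The cutoff inside makes [circle_fundamental_solution] applicable to the
    translates of bump r * phi, and the one outside gives the solution a compact
    support. The second is 1 on all unit circles with center in the square of
    radius r. The points of these circles and of the support of bump r differ by
    at most 3 r + 1 in each coordinate, which is the reach needed for the kernel.
    *)
Lemma local_inverse (r : R) : 0 < r -> exists k N, continuous k /\
  forall phi (y : R * R), Cinf phi -> `|y.1| <= r -> `|y.2| <= r ->
  circT (fun z => bump (r + 1) z *
    conv k (3 * r + 2) (iter N lap (fun p => bump r p * phi p)) z) y =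
  8 * pi ^+ 2 * phi y.
Proof.
move=> r0; have [k [N [ck Hk]]] := @circle_fundamental_solution R (6 * r + 6).
exists k, N; split=> // phi y sphi y1 y2.
pose phi1 p := bump r p * phi p.
have sphi1 : Cinf phi1 by apply: smoothM => //; exact: smooth_bump.
have bphi1 : supp_in (2 * r) phi1 by apply: suppM; exact: bump_supp.
pose u := iter N lap phi1.
have su : Cinf u by exact: smooth_iter_lap.
have bu : supp_in (2 * r) u by exact: supp_iter_lap.
have cu := smooth_cont su.
have cconv := cont_conv (B := 3 * r + 2) ck cu.
have cb := smooth_cont (smooth_bump (r + 1)).
have co (a : R) : `|cos a| <= 1 by rewrite ler_norml cos_geN1 cos_le1.
have si (a : R) : `|sin a| <= 1 by rewrite ler_norml sin_geN1 sin_le1.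
rewrite -/phi1 -/u.
transitivity (circT (conv k (3 * r + 2) u) y).
  apply: eq_oint => a; rewrite bump1 ?mul1r//=; first by lra.
    by apply: le_trans (ler_normB _ _) _; have := co a; lra.
  by apply: le_trans (ler_normB _ _) _; have := si a; lra.
have := Hk (fun p => phi1 (p.1 + y.1, p.2 + y.2)) (3 * r) (3 * r + 3).
rewrite iter_lap_shift// -/u !add0r.
have -> : phi1 (y.1, y.2) = phi y.
  by rewrite /phi1 bump1// mul1r; case: (y).
move=> <-; last 5 first.
- by lra.
- by lra.
- by lra.
- exact: smooth_shift.
- move=> p bp; apply: bphi1 => /=.
  have h1 := ler_normB (p.1 + y.1) y.1; have h2 := ler_normB (p.2 + y.2) y.2.
  by rewrite !addrK in h1 h2; case: bp => bp; [left|right]; lra.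
transitivity (boxint (3 * r + 3) (fun p => oint 0 (2 * pi) (fun a =>
    k (p.1 + cos a, p.2 + sin a) * u (p.1 + y.1, p.2 + y.2)))); last first.
  by apply: eq_boxint => p; rewrite ointZr//; cont.
rewrite (@boxint_Fubini _ (fun p a => k (p.1 + cos a, p.2 + sin a) * u (p.1 + y.1, p.2 + y.2)));
  last by cont.
apply: eq_oint => a; rewrite /conv.
rewrite -(@boxint_shift _ (fun w => k w * u (w.1 + (y.1 - cos a), w.2 + (y.2 - sin a)))
   (cos a, sin a) (3 * r + 1) (3 * r + 3)) /=; last 5 first.
- by cont.
- move=> p bp; rewrite bu ?mulr0//=.
  have h1 := ler_normB (p.1 + (y.1 - cos a)) (y.1 - cos a).
  have h2 := ler_normB (p.2 + (y.2 - sin a)) (y.2 - sin a).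
  have h3 := ler_normB y.1 (cos a); have h4 := ler_normB y.2 (sin a).
  have := co a; have := si a => *.
  by rewrite !addrK in h1 h2; case: bp => bp; [left|right]; lra.
- by have := co a; lra.
- by have := si a; lra.
- by lra.
by apply: eq_boxint => p; congr (_ * u (_, _)); ring.
Qed.
End Operators.

Section ComplexFunctions.
Context {R : realType}.
Implicit Types (u v : R * R -> R) (phi psi : R * R -> R[i]).
Local Open Scope complex_scope.

(** Distributions act on complex functions, but by linearity only real ones need
    be considered. *)
Definition real_fun u : R * R -> R[i] := fun p => u p +i* 0.

Lemma smooth_real_fun u : Cinf u -> smooth (real_fun u).
Proof.
move=> [su]; split; first exact: su.
by have [s0] := @smooth_cst R 0; exact: s0.
Qed.

Lemma circle_transpose_real_fun u : continuous u -> circle_transpose (real_fun u) = real_fun (circT u).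
Proof.
move=> cu; apply/funext => y; rewrite /circle_transpose /real_fun /re_part /im_part /=.
have p0 : 0 <= 2 * pi :> R by rewrite mulr_ge0// pi_ge0.
by rewrite !oint_Rintegral ?oint0//; cont.
Qed.

Lemma compact_box (K : set (R * R)) : compact K ->
  exists2 b : R, 0 <= b & forall p, K p -> `|p.1| <= b /\ `|p.2| <= b.
Proof.
move=> cK.
have H (f : R * R -> R) : continuous f -> exists M, forall p, K p -> `|f p| <= M.
  move=> cf; have : compact (f @` K).
    by apply: continuous_compact => //; exact: continuous_subspaceT.
  move=> /compact_bounded[M [_ /(_ (M + 1))]]; rewrite ltrDl ltr01 => /(_ isT) HM.
  by exists (M + 1) => p Kp; apply: HM; exists p.
have [M HM] := H fst (fun p => cvg_fst); have [N HN] := H snd (fun p => cvg_snd).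
exists (`|M| + `|N|); first by rewrite addr_ge0.
move=> p Kp; have := HM p Kp; have := HN p Kp.
by have := ler_norm M; have := ler_norm N; have := normr_ge0 M; have := normr_ge0 N; lra.
Qed.

Lemma box_open (r : R) : open [set p : R * R | `|p.1| < r /\ `|p.2| < r].
Proof.
have c1 : continuous (fun p : R * R => `|p.1|).
  by move=> p; apply: cvg_norm; exact: cvg_fst.
have c2 : continuous (fun p : R * R => `|p.2|).
  by move=> p; apply: cvg_norm; exact: cvg_snd.
rewrite (_ : [set _ | _] = ((fun p : R * R => `|p.1|) @^-1` [set t | t < r]) `&`
   ((fun p : R * R => `|p.2|) @^-1` [set t | t < r])); last by [].
by apply: openI; (apply: open_comp; [by move=> ? _; first [exact: c1|exact: c2]|exact: open_lt]).
Qed.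

Lemma partials0 s : partials s (fun=> 0 : R) = fun=> 0.
Proof.
elim: s => [//|j s IH] /=; apply/funext => p.
by rewrite -/(partials s _) IH derive_cst.
Qed.

(** Seminorms on a compact set do not see functions that vanish near it. *)
Lemma partials_eq0 (U : set (R * R)) u s p : open U -> (forall q, U q -> u q = 0) -> U p ->
  partials s u p = 0.
Proof.
move=> oU u0 Up; have := @eq_near_partials _ U u (fun=> 0) s oU.
by rewrite partials0; apply; [move=> q /set_mem; exact: u0|exact: mem_set].
Qed.

Lemma normc_le0 (z : R[i]) : Normc.normc z <= 0 -> z = 0.
Proof.
move=> z0; apply: Normc.eq0_normc; apply/eqP; rewrite eq_le z0.
by case: z {z0} => x y; rewrite /Normc.normc sqrtr_ge0.
Qed.

Lemma supp_compact b u : supp_in b u -> exists K : set (R * R), compact K /\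
  forall x, ~ K x -> real_fun u x = 0.
Proof.
move=> bu; exists (`[- b, b] `*` `[- b, b]); split.
  by apply: compact_setX; exact: segment_compact.
move=> p pK; rewrite /real_fun bu//; have [h|h] := ltP b `|p.1|; first by left.
right; rewrite ltNge; apply/negP => h2; apply: pK.
by split; rewrite /= in_itv /= -ler_norml.
Qed.

Lemma test_real_fun b u : Cinf u -> supp_in b u -> test_function (real_fun u).
Proof. by move=> su bu; split; [exact: smooth_real_fun|exact: supp_compact bu]. Qed.

Lemma plane_integral_real_fun (g : R * R -> R[i]) u b c :
  continuous (re_part g) -> continuous (im_part g) -> continuous u ->
  supp_in b u -> b < c ->
  plane_integral (fun x => g x * real_fun u x) =
  boxint c (fun p => re_part g p * u p) +i* boxint c (fun p => im_part g p * u p).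
Proof.
move=> cr ci cu bu bc; rewrite /plane_integral.
have -> : re_part (fun x => g x * real_fun u x) = (fun p => re_part g p * u p).
  by apply/funext => p; rewrite /re_part /real_fun; case: (g p) => x y /=; rewrite mulr0 subr0.
have -> : im_part (fun x => g x * real_fun u x) = (fun p => im_part g p * u p).
  by apply/funext => p; rewrite /im_part /real_fun; case: (g p) => x y /=; rewrite mulr0 add0r.
by congr (_ +i* _); apply: plane_Rintegral bc; do ?[by cont]; exact: suppMr.
Qed.
End ComplexFunctions.

Theorem proposition7 (R : realType) (f : functional R)
  (hf : compactly_supported_distribution f)
  (hIf : smooth_distribution (circle_transform f)) :
  smooth_distribution f.
Proof.
have [flin [K [n [C [cK fC]]]]] := hf.
have [g [[sgr sgi] hg]] := hIf.
have {sgr}sgr : Cinf (re_part g) by split; exact: sgr.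
have {sgi}sgi : Cinf (im_part g) by split; exact: sgi.
have [b b0 Kb] := compact_box cK.
pose r := b + 1; have r0 : 0 < r by rewrite /r; lra.
have [k [N [ck Hk]]] := local_inverse r0.
pose B := 3 * r + 2.
have B0 : 0 <= B by rewrite /B; lra.
pose kap : R := (8 * pi ^+ 2)^-1.
have kapE : kap * (8 * pi ^+ 2) = 1.
  by rewrite mulVf// mulf_neq0 ?expf_neq0// lt0r_neq0 ?pi_gt0.
pose k' (w : R * R) := k (- w.1, - w.2).
have ck' : continuous k' by rewrite /k'; cont.
pose Q (h : R * R -> R) := iter N lap (conv k' B (fun p => h p * bump (r + 1) p)).
have sQ h : Cinf h -> Cinf (Q h).
  move=> sh; apply: smooth_iter_lap; apply: smooth_conv => //.
  by apply: smoothM => //; exact: smooth_bump.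
pose G h p := kap * bump r p * Q h p.
have sG h : Cinf h -> Cinf (G h).
  move=> sh; apply: smoothM; last exact: sQ.
  by apply: smoothM; [exact: smooth_cst|exact: smooth_bump].
(* By linearity the density of f is determined by its values on real functions. *)
have real u bu c : Cinf u -> 0 <= bu -> supp_in bu u -> bu < c ->
    f (real_fun u) = (boxint c (fun p => G (re_part g) p * u p) +i* boxint c (fun p => G (im_part g) p * u p))%C.
  move=> su bu0 buu buc.
  pose psi z := bump (r + 1) z * conv k B (iter N lap (fun p => bump r p * u p)) z.
  have sru : Cinf (fun p => bump r p * u p).
    by apply: smoothM => //; exact: smooth_bump.
  have spsi : Cinf psi.
    by apply: smoothM; [exact: smooth_bump|apply: smooth_conv => //; exact: smooth_iter_lap].
  have bpsi : supp_in (2 * (r + 1)) psi.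
    by apply: suppM; apply: bump_supp; lra.
  have cpsi := smooth_cont spsi.
  have sT := smooth_circT spsi.
  (* The circle averages of psi and 8 pi^2 u agree near K, so that no seminorm on K
     sees their difference. *)
  have step1 : f (real_fun u) = (kap +i* 0)%C * f (circle_transpose (real_fun psi)).
    rewrite circle_transpose_real_fun//.
    have := flin (- (kap +i* 0)%C) _ _ (smooth_real_fun sT) (smooth_real_fun su).
    set D := (X in f X = _) => fD.
    suff D0 : f D = 0.
      by apply/eqP; rewrite -subr_eq0 -D0 fD mulNr addrC.
    have reD : re_part D = (fun p => - kap * circT psi p + u p).
      by apply/funext => p; rewrite /re_part /D /real_fun /=; ring.
    have imD : im_part D = (fun=> 0).
      by apply/funext => p; rewrite /im_part /D /real_fun /=; ring.
    have sD : smooth D.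
      split; first by rewrite reD; apply: CinfP; apply: smoothD => //;
        apply: smoothM => //; exact: smooth_cst.
      by rewrite imD; apply: CinfP; exact: smooth_cst.
    have := fC D 0 sD; rewrite mulr0 => fD0.
    have {}fD0 : Normc.normc (f D) <= 0.
      apply: fD0 => s x _ Kx; rewrite /cpartials reD imD.
      have [x1 x2] := Kb x Kx.
      rewrite (@partials_eq0 _ _ _ s x (@box_open _ r)).
      - by rewrite partials0 /Normc.normc expr0n/= addr0 sqrtr0.
      - move=> q [q1 q2]; rewrite (Hk u q su (ltW q1) (ltW q2)).
        by rewrite mulrA mulNr kapE mulN1r addNr.
      - by rewrite /r; split => /=; lra.
    exact: normc_le0.
  rewrite step1.
  have -> : f (circle_transpose (real_fun psi)) = circle_transform f (real_fun psi) by [].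
  rewrite (hg _ (test_real_fun spsi bpsi)).
  pose c1 := Num.max c (5 * r + 10).
  have cc1 : c <= c1 by rewrite le_max lexx.
  have rc1 : 5 * r + 10 <= c1 by rewrite le_max lexx orbT.
  have cgr := smooth_cont sgr; have cgi := smooth_cont sgi; have cu := smooth_cont su.
  rewrite (@plane_integral_real_fun _ _ psi (2 * (r + 1)) c1)//; last by lra.
  (* The Laplacians and the kernel pass from the test function to h. *)
  have part h : Cinf h -> kap * boxint c1 (fun p => h p * psi p) = boxint c (fun p => G h p * u p).
    move=> sh; have ch := smooth_cont sh; have cG := smooth_cont (sG h sh).
    have cQ := smooth_cont (sQ h sh).
    have cb := smooth_cont (smooth_bump r); have cb1 := smooth_cont (smooth_bump (r + 1)).
    have shb : Cinf (fun p => h p * bump (r + 1) p).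
      by apply: smoothM => //; exact: smooth_bump.
    have brub : supp_in (2 * r) (fun p => bump r p * u p) by apply: suppM; exact: bump_supp.
    rewrite (@boxint_supp _ (fun p => G h p * u p) bu c c1)//; last 3 first.
    - by cont.
    - exact: suppMr.
    - by lra.
    transitivity (kap * boxint c1 (fun p => Q h p * (bump r p * u p))); last first.
      rewrite -boxintZ; last by cont.
      by apply: eq_boxint => p; rewrite /G; ring.
    congr (_ * _).
    rewrite -(@lap_adjoint _ N _ _ (2 * r) c1)//; [|by lra|by lra|exact: smooth_conv].
    transitivity (boxint c1 (fun p => (h p * bump (r + 1) p) *
        conv k B (iter N lap (fun p => bump r p * u p)) p)).
      by apply: eq_boxint => p; rewrite mulrA.
    rewrite (@conv_adjoint _ k B _ _ (2 * r) c1)//.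
    - by apply: eq_boxint => p; rewrite mulrC.
    - exact: smooth_cont (smooth_iter_lap N sru).
    - exact: smooth_cont.
    - exact: supp_iter_lap.
    - by rewrite /B; lra.
  rewrite -!part//.
  by apply/eqP; rewrite eq_complex /=; apply/andP; split; apply/eqP; ring.
exists (fun p => (G (re_part g) p +i* G (im_part g) p)%C); split.
  by split; apply: CinfP; exact: sG.
move=> phi [[sr si] [L [cL phiL]]].
have {sr}sr : Cinf (re_part phi) by split; exact: sr.
have {si}si : Cinf (im_part phi) by split; exact: si.
have [d d0 Ld] := compact_box cL.
have phi0 p : d < `|p.1| \/ d < `|p.2| -> phi p = 0.
  move=> dp; apply: phiL => Lp; have [p1 p2] := Ld p Lp.
  by case: dp; lra.
have br : supp_in d (re_part phi) by move=> p /phi0; rewrite /re_part => ->.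
have bi : supp_in d (im_part phi) by move=> p /phi0; rewrite /im_part => ->.
have dd : d < d + 1 by lra.
have phiE : phi = (fun x => (0 +i* 1)%C * real_fun (im_part phi) x + real_fun (re_part phi) x).
  apply/funext => x; rewrite /real_fun /re_part /im_part; case: (phi x) => y z.
  by apply/eqP; rewrite eq_complex /=; apply/andP; split; apply/eqP; ring.
rewrite [in LHS]phiE (flin _ _ _ (smooth_real_fun si) (smooth_real_fun sr)).
rewrite (real _ d (d + 1) si d0 bi dd) (real _ d (d + 1) sr d0 br dd).
have cr := smooth_cont sr; have ci := smooth_cont si.
have cGr := smooth_cont (sG _ sgr); have cGi := smooth_cont (sG _ sgi).
rewrite /plane_integral.
have -> : re_part (fun x => (G (re_part g) x +i* G (im_part g) x)%C * phi x) =
    (fun p => G (re_part g) p * re_part phi p - G (im_part g) p * im_part phi p).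
  by apply/funext => p; rewrite /re_part /im_part; case: (phi p) => y z.
have -> : im_part (fun x => (G (re_part g) x +i* G (im_part g) x)%C * phi x) =
    (fun p => G (re_part g) p * im_part phi p + G (im_part g) p * re_part phi p).
  by apply/funext => p; rewrite /re_part /im_part; case: (phi p) => y z.
rewrite (@plane_Rintegral _ _ d (d + 1))//; [|by cont|]; last first.
  by move=> p dp; rewrite br// bi// !mulr0 subr0.
rewrite (@plane_Rintegral _ _ d (d + 1))//; [|by cont|]; last first.
  by move=> p dp; rewrite br// bi// !mulr0 addr0.
rewrite boxintB; [|by cont|by cont]; rewrite boxintD; [|by cont|by cont].
by apply/eqP; rewrite eq_complex /=; apply/andP; split; apply/eqP; ring.
Qed.
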